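(* Let $\mathfrak g=\mathfrak{sl}_2$ and let $\xi=(\xi_1\ge\cdots\ge\xi_\ell>0)$ be a partition with $\ell\ge1$ parts. (i) If $\ell>1$, there exists a short exact sequence of $\mathfrak g[t]$-modules $$0\to\tau_{(\ell-1)\xi_\ell}V(\xi^-)\xrightarrow{\ \varphi^-\ }V(\xi)\xrightarrow{\ \varphi^+\ }V(\xi^+)\to0.$$ (ii) For all $\ell\ge1$ and any distinct scalars $z_1,\dots,z_\ell\in\mathbf C$, there is an isomorphism of $\mathfrak g[t]$-modules $$V(\xi)\cong V^{z_1}(\xi_1)*\cdots*V^{z_\ell}(\xi_\ell),$$ the right side being the fusion product, with parameters $z_1,\dots,z_\ell$, of the modules $\mathrm{ev}_0V(\xi_1),\dots,\mathrm{ev}_0V(\xi_\ell)$. (iii) The elements $$\{(x^-\otimes1)^{i_1}(x^-\otimes t)^{i_2}\cdots(x^-\otimes t^{\ell-1})^{i_\ell}v_\xi:\ (i_1,\dots,i_\ell)\in\mathbb I(\xi)\}$$ form a basis of $V(\xi)$.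
   Context: $\mathbf Z_+$ is the set of non-negative integers, $\mathbf N$ the positive integers. $\mathfrak{sl}_2$ has standard basis $x^+,h,x^-$ with $[h,x^\pm]=\pm2x^\pm$, $[x^+,x^-]=h$; $\mathfrak g[t]=\mathfrak{sl}_2\otimes\mathbf C[t]$, graded by degree in $t$, and $\mathbf U(\mathfrak g[t])[s]$ is the grade $s$ part of its enveloping algebra. $\tau_r$ shifts the grading of a graded module uniformly up by $r$ (action unchanged). $V(r)$ for $r\in\mathbf Z_+$ is the irreducible $\mathfrak{sl}_2$-module of dimension $r+1$ with highest weight vector $v_r$; $\mathrm{ev}_0V(r)$ is $V(r)$ with $x\otimes t^s$ acting by $0$ for $s>0$ and $x\otimes1$ acting as $x$. For a non-empty partition $\xi=(\xi_1\ge\xi_2\ge\cdots)$ with $|\xi|=\sum\xi_j$, $V(\xi)$ is the graded $\mathfrak g[t]$-module generated by $v_\xi$ (in grade $0$) with defining relations: $(x^+\otimes t^s)v_\xi=0$, $(h\otimes t^s)v_\xi=\delta_{s,0}|\xi|v_\xi$ ($s\in\mathbf Z_+$), $(x^-\otimes1)^{|\xi|+1}v_\xi=0$, and $(x^+\otimes t)^s(x^-\otimes1)^{s+r}v_\xi=0$ for all $s,r\in\mathbf N$ such that $s+r\ge1+rk+\sum_{j\ge k+1}\xi_j$ for some $k\in\mathbf N$. For the empty partition, $V(\xi)$ is the trivial one-dimensional module. For $\ell>1$: $\xi^-$ is the partition with $\xi^-_r=\xi_r$ for $r<\ell-1$, $\xi^-_{\ell-1}=\xi_{\ell-1}-\xi_\ell$,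 $\xi^-_r=0$ for $r\ge\ell$; and $\xi^+$ is the partition obtained by rearranging $(\xi_1,\dots,\xi_{\ell-2},\xi_{\ell-1}+1,\xi_\ell-1)$ in non-increasing order (zero parts discarded). $\mathbb I(\xi)$ is the set of $(i_1,\dots,i_\ell)\in\mathbf Z_+^\ell$ such that, for all $2\le k\le\ell+1$ and $1\le j\le k-1$, $$ji_{k-1}+(j+1)i_k+2\sum_{p=k+1}^\ell i_p\le\sum_{p=k-j}^\ell\xi_p,$$ where $i_{\ell+1}=0$. Fusion products: if $V$ is a cyclic $\mathfrak g[t]$-module generated by $v$, set $F^rV=\sum_{0\le s\le r}\mathbf U(\mathfrak g[t])[s]v$; the associated graded space $\mathrm{gr}\,V$ is a graded $\mathfrak g[t]$-module, where for $w\in F^rV$ the element $x\otimes t^s$ sends the class of $w$ in $F^rV/F^{r-1}V$ to the class of $(x\otimes t^s)w$ in $F^{r+s}V/F^{r+s-1}V$. For $z\in\mathbf C$, $V^z$ is the space $V$ with $x\otimes t^r$ acting as $x\otimes(t+z)^r$. For finite-dimensional graded cyclic modules $V_1,\dots,V_m$ with generators $v_1,\dots,v_m$ and distinct $z_1,\dots,z_m\in\mathbf C$, the module $V_1^{z_1}\otimes\cdots\otimes V_m^{z_m}$ is cyclic on $v_1\otimes\cdots\otimes v_m$; its associated graded module is the fusion product with parameters $z_1,\dots,z_m$. The generator of $\mathrm{ev}_0V(\xi_s)$ is $v_{\xi_s}$. *)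

(* Defs.v *)
From HB Require Import structures.
From mathcomp Require Import all_boot all_order all_algebra.
From mathcomp Require Import boolp reals.
From mathcomp Require Import complex.
From mathcomp Require Import ring.

Set Implicit Arguments.
Unset Strict Implicit.
Unset Printing Implicit Defensive.

Import Order.TTheory GRing.Theory Num.Theory.
Local Open Scope ring_scope.
Local Open Scope quotient_scope.

Section Span.
Variables (K : fieldType) (V : lmodType K).

Inductive lspan (S : V -> Prop) : V -> Prop :=
| lspan0 : lspan S 0
| lspanP a u v of S u & lspan S v : lspan S (a *: u + v).

Lemma lspan_lin S a u v : lspan S u -> lspan S v -> lspan S (a *: u + v).
Proof.
move=> su sv; elim: su => [|b w y Sw _ IH]; first by rewrite scaler0 add0r.
by rewrite scalerDr scalerA -addrA; apply: lspanP.
Qed.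

Lemma lspan_gen (S : V -> Prop) u : S u -> lspan S u.
Proof. by move=> Su; rewrite -[u]scale1r -[_ *: _]addr0; apply: lspanP => //; apply: lspan0. Qed.

(* The family (b i)_{i in P} is a basis: it is linearly independent (in
   particular injective on P) and spans V. *)
Definition is_basis (I : eqType) (P : I -> Prop) (b : I -> V) : Prop :=
  (forall (s : seq I) (c : I -> K), uniq s -> (forall i, i \in s -> P i) ->
     \sum_(i <- s) c i *: b i = 0 -> forall i, i \in s -> c i = 0) /\
  (forall v : V, exists (s : seq I) (c : I -> K),
     (forall i, i \in s -> P i) /\ v = \sum_(i <- s) c i *: b i).

End Span.

Record setoid_lmod (K : fieldType) := SetoidLmod {
  sl_car :> Type;
  sl_eq : sl_car -> sl_car -> Prop;
  sl_zero : sl_car;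
  sl_add : sl_car -> sl_car -> sl_car;
  sl_scale : K -> sl_car -> sl_car;
  sl_refl : forall t, sl_eq t t;
  sl_sym : forall t u, sl_eq t u -> sl_eq u t;
  sl_trans : forall t u w, sl_eq t u -> sl_eq u w -> sl_eq t w;
  sl_addE : forall t t' u u', sl_eq t t' -> sl_eq u u' ->
    sl_eq (sl_add t u) (sl_add t' u');
  sl_scaleE : forall a t t', sl_eq t t' -> sl_eq (sl_scale a t) (sl_scale a t');
  sl_addA : forall t u w, sl_eq (sl_add t (sl_add u w)) (sl_add (sl_add t u) w);
  sl_addC : forall t u, sl_eq (sl_add t u) (sl_add u t);
  sl_add0 : forall t, sl_eq (sl_add sl_zero t) t;
  sl_addN : forall t, sl_eq (sl_add (sl_scale (-1) t) t) sl_zero;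
  sl_scaleA : forall a b t,
    sl_eq (sl_scale a (sl_scale b t)) (sl_scale (a * b) t);
  sl_scale1 : forall t, sl_eq (sl_scale 1 t) t;
  sl_scaleDr : forall a t u,
    sl_eq (sl_scale a (sl_add t u)) (sl_add (sl_scale a t) (sl_scale a u));
  sl_scaleDl : forall a b t,
    sl_eq (sl_scale (a + b) t) (sl_add (sl_scale a t) (sl_scale b t)) }.

Section Quotient.
Variables (K : fieldType) (S : setoid_lmod K).

Definition sl_type : Type := sl_car S.
HB.instance Definition _ := gen_eqMixin sl_type.
HB.instance Definition _ := gen_choiceMixin sl_type.

Definition sl_rel (t u : sl_type) : bool := `[< sl_eq t u >].

Lemma sl_rel_refl : reflexive sl_rel.
Proof. by move=> t; apply/asboolP; apply: sl_refl. Qed.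
Lemma sl_rel_sym : symmetric sl_rel.
Proof. by move=> t u; apply/asboolP/asboolP; apply: sl_sym. Qed.
Lemma sl_rel_trans : transitive sl_rel.
Proof. by move=> t u w /asboolP tu /asboolP uw; apply/asboolP; apply: sl_trans tu uw. Qed.

Canonical sl_equiv := EquivRel sl_rel sl_rel_refl sl_rel_sym sl_rel_trans.

Definition quo : Type := {eq_quot sl_equiv}.
HB.instance Definition _ := Choice.on quo.

Definition cls (t : S) : quo := \pi_({eq_quot sl_equiv}) (t : sl_type).
Definition rep (q : quo) : S := repr (q : {eq_quot sl_equiv}).

Lemma clsP t u : cls t = cls u <-> sl_eq t u.
Proof.
split=> [/eqP|tu]; first by rewrite /cls eqmodE => /asboolP.
by apply/eqP; rewrite /cls eqmodE; apply/asboolP.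
Qed.

Lemma repK q : cls (rep q) = q.
Proof. exact: reprK. Qed.

Lemma rep_cls t : sl_eq (rep (cls t)) t.
Proof. by apply/clsP; rewrite repK. Qed.

Lemma quo_ind (P : quo -> Prop) : (forall t, P (cls t)) -> forall q, P q.
Proof. by move=> Pc q; rewrite -(repK q). Qed.

Definition quo_add (p q : quo) : quo := cls (sl_add (rep p) (rep q)).
Definition quo_scale (a : K) (q : quo) : quo := cls (sl_scale a (rep q)).
Definition quo_zero : quo := cls (sl_zero S).
Definition quo_opp (q : quo) : quo := quo_scale (-1) q.

Lemma quo_addE t u : quo_add (cls t) (cls u) = cls (sl_add t u).
Proof. by apply/clsP/sl_addE; apply: rep_cls. Qed.
Lemma quo_scaleE a t : quo_scale a (cls t) = cls (sl_scale a t).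
Proof. by apply/clsP/sl_scaleE/rep_cls. Qed.

Lemma quo_addA : associative quo_add.
Proof.
elim/quo_ind=> t; elim/quo_ind=> u; elim/quo_ind=> w.
by rewrite !quo_addE; apply/clsP/sl_addA.
Qed.
Lemma quo_addC : commutative quo_add.
Proof.
by elim/quo_ind=> t; elim/quo_ind=> u; rewrite !quo_addE; apply/clsP/sl_addC.
Qed.
Lemma quo_add0 : left_id quo_zero quo_add.
Proof. by elim/quo_ind=> t; rewrite quo_addE; apply/clsP/sl_add0. Qed.
Lemma quo_addN : left_inverse quo_zero quo_opp quo_add.
Proof. by elim/quo_ind=> t; rewrite /quo_opp quo_scaleE quo_addE; apply/clsP/sl_addN. Qed.

HB.instance Definition _ :=
  GRing.isZmodule.Build quo quo_addA quo_addC quo_add0 quo_addN.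

Lemma quo_scaleA a b q : quo_scale a (quo_scale b q) = quo_scale (a * b) q.
Proof. by elim/quo_ind: q => t; rewrite !quo_scaleE; apply/clsP/sl_scaleA. Qed.
Lemma quo_scale1 : left_id 1 quo_scale.
Proof. by elim/quo_ind=> t; rewrite quo_scaleE; apply/clsP/sl_scale1. Qed.
Lemma quo_scaleDr : right_distributive quo_scale +%R.
Proof.
move=> a; elim/quo_ind=> t; elim/quo_ind=> u.
change (quo_scale a (quo_add (cls t) (cls u)) =
        quo_add (quo_scale a (cls t)) (quo_scale a (cls u))).
by rewrite !(quo_scaleE, quo_addE); apply/clsP/sl_scaleDr.
Qed.
Lemma quo_scaleDl q : {morph quo_scale^~ q : a b / a + b}.
Proof.
move=> a b; elim/quo_ind: q => t.
change (quo_scale (a + b) (cls t) =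
        quo_add (quo_scale a (cls t)) (quo_scale b (cls t))).
by rewrite !(quo_scaleE, quo_addE); apply/clsP/sl_scaleDl.
Qed.

HB.instance Definition _ := GRing.Zmodule_isLmodule.Build K quo
  quo_scaleA quo_scale1 quo_scaleDr quo_scaleDl.

Lemma clsD t u : cls (sl_add t u) = cls t + cls u.
Proof. by rewrite -quo_addE. Qed.
Lemma clsZ a t : cls (sl_scale a t) = a *: cls t.
Proof. by rewrite -quo_scaleE. Qed.
Lemma cls0 : cls (sl_zero S) = 0.
Proof. by []. Qed.

End Quotient.

Section Presentation.
Variables (K : fieldType) (G O : Type).

Inductive term : Type :=
| Gen of G
| Zero
| Add of term & term
| Scale of K & term
| Op of O & term.

(* The least congruence containing [Rel] for which terms form a K-vector
   space with linear operators (Op o). *)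
Inductive cong (Rel : term -> term -> Prop) : term -> term -> Prop :=
| cong_rel t u of Rel t u : cong Rel t u
| cong_refl t : cong Rel t t
| cong_sym t u of cong Rel t u : cong Rel u t
| cong_trans t u w of cong Rel t u & cong Rel u w : cong Rel t w
| cong_add t t' u u' of cong Rel t t' & cong Rel u u' :
    cong Rel (Add t u) (Add t' u')
| cong_scale a t t' of cong Rel t t' : cong Rel (Scale a t) (Scale a t')
| cong_op o t t' of cong Rel t t' : cong Rel (Op o t) (Op o t')
| cong_addA t u w : cong Rel (Add t (Add u w)) (Add (Add t u) w)
| cong_addC t u : cong Rel (Add t u) (Add u t)
| cong_add0 t : cong Rel (Add Zero t) t
| cong_addN t : cong Rel (Add (Scale (-1) t) t) Zero
| cong_scaleA a b t : cong Rel (Scale a (Scale b t)) (Scale (a * b) t)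
| cong_scale1 t : cong Rel (Scale 1 t) t
| cong_scaleDr a t u :
    cong Rel (Scale a (Add t u)) (Add (Scale a t) (Scale a u))
| cong_scaleDl a b t :
    cong Rel (Scale (a + b) t) (Add (Scale a t) (Scale b t))
| cong_op_linear o a t u :
    cong Rel (Op o (Add (Scale a t) u)) (Add (Scale a (Op o t)) (Op o u)).

Variable Rel : term -> term -> Prop.

Definition pres_setoid : setoid_lmod K :=
  @SetoidLmod K term (cong Rel) Zero Add Scale
    (@cong_refl Rel) (@cong_sym Rel) (@cong_trans Rel)
    (@cong_add Rel) (@cong_scale Rel)
    (@cong_addA Rel) (@cong_addC Rel) (@cong_add0 Rel) (@cong_addN Rel)
    (@cong_scaleA Rel) (@cong_scale1 Rel) (@cong_scaleDr Rel) (@cong_scaleDl Rel).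

Definition pres : lmodType K := quo pres_setoid.

Definition pcls (t : term) : pres := @cls K pres_setoid t.
Definition pgen (g : G) : pres := pcls (Gen g).
Definition pop (o : O) (q : pres) : pres := pcls (Op o (@rep K pres_setoid q)).

Lemma pclsP t u : pcls t = pcls u <-> cong Rel t u.
Proof. exact: (@clsP K pres_setoid). Qed.

Lemma pcls_ind (P : pres -> Prop) : (forall t, P (pcls t)) -> forall q, P q.
Proof. exact: (@quo_ind K pres_setoid). Qed.

Lemma popE o t : pop o (pcls t) = pcls (Op o t).
Proof. by rewrite /pop; apply/pclsP; apply: cong_op; exact: (@rep_cls K pres_setoid t). Qed.

Lemma pclsD t u : pcls (Add t u) = pcls t + pcls u.
Proof. exact: (@clsD K pres_setoid). Qed.
Lemma pclsZ a t : pcls (Scale a t) = a *: pcls t.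
Proof. exact: (@clsZ K pres_setoid). Qed.

Lemma pop_linear o : linear (pop o).
Proof.
move=> a; elim/pcls_ind=> t; elim/pcls_ind=> u.
by rewrite -pclsZ -pclsD !popE -pclsZ -pclsD; apply/pclsP/cong_op_linear.
Qed.

Section Lift.
Variables (W : lmodType K) (wg : G -> W) (wo : O -> W -> W).

Fixpoint teval (t : term) : W :=
  match t with
  | Gen g => wg g
  | Zero => 0
  | Add t u => teval t + teval u
  | Scale a t => a *: teval t
  | Op o t => wo o (teval t)
  end.

Hypothesis wo_linear : forall o, linear (wo o).
Hypothesis wRel : forall t u, Rel t u -> teval t = teval u.

Lemma teval_cong t u : cong Rel t u -> teval t = teval u.
Proof.
elim=> {t u} //=.
- by move=> t u w _ -> _ ->.
- by move=> t t' u u' _ -> _ ->.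
- by move=> a t t' _ ->.
- by move=> o t t' _ ->.
- by move=> t u w; rewrite addrA.
- by move=> t u; rewrite addrC.
- by move=> t; rewrite add0r.
- by move=> t; rewrite scaleN1r addNr.
- by move=> a b t; rewrite scalerA.
- by move=> t; rewrite scale1r.
- by move=> a t u; rewrite scalerDr.
- by move=> a b t; rewrite scalerDl.
- by move=> o a t u; rewrite wo_linear.
Qed.

Definition pres_lift (q : pres) : W := teval (@rep K pres_setoid q).

Lemma pres_liftE t : pres_lift (pcls t) = teval t.
Proof. by apply: teval_cong; exact: (@rep_cls K pres_setoid t). Qed.

Lemma pres_lift_linear : linear pres_lift.
Proof.
move=> a; elim/pcls_ind=> t; elim/pcls_ind=> u.
by rewrite -pclsZ -pclsD !pres_liftE.
Qed.

Lemma pres_lift_op o q : pres_lift (pop o q) = wo o (pres_lift q).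
Proof. by elim/pcls_ind: q => t; rewrite popE !pres_liftE. Qed.

Lemma pres_lift_gen g : pres_lift (pgen g) = wg g.
Proof. exact: pres_liftE. Qed.

End Lift.
End Presentation.

Arguments Zero {K G O}.
Arguments Gen {K G O}.

(* sl2 A = sl_2 (x) A, where (a, b, c) stands for
   x^+ (x) a + h (x) b + x^- (x) c. *)
Definition sl2 (A : Type) : Type := (A * A * A)%type.

Definition bracket (A : comPzRingType) (x y : sl2 A) : sl2 A :=
  let: (a, b, c) := x in let: (a', b', c') := y in
  ((b * a' - a * b') *+ 2, a * c' - c * a', (c * b' - b * c') *+ 2).

Lemma sl2_ext (A : Type) (x y : sl2 A) :
  x.1.1 = y.1.1 -> x.1.2 = y.1.2 -> x.2 = y.2 -> x = y.
Proof. by case: x y => [[? ?] ?] [[? ?] ?] /= -> -> ->. Qed.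

Lemma bracket_alternating (A : comPzRingType) (x : sl2 A) : bracket x x = 0.
Proof.
by case: x => [[a b] c]; apply: sl2_ext => /=; ring.
Qed.

Lemma bracket_jacobi (A : comPzRingType) (x y z : sl2 A) :
  bracket x (bracket y z) + bracket y (bracket z x) + bracket z (bracket x y) = 0.
Proof.
case: x y z => [[a b] c] [[a' b'] c'] [[a2 b2] c2] /=.
by apply: sl2_ext => /=; ring.
Qed.

Section Current.
Variable K : numFieldType.

Definition xp : sl2 K := (1, 0, 0).
Definition hh : sl2 K := (0, 1, 0).
Definition xm : sl2 K := (0, 0, 1).

Definition tens (x : sl2 K) (f : {poly K}) : sl2 {poly K} :=
  (x.1.1 *: f, x.1.2 *: f, x.2 *: f).

Definition tcoef (x : sl2 {poly K}) (s : nat) : sl2 K :=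
  (x.1.1`_s, x.1.2`_s, x.2`_s).

End Current.

Arguments xp {K}.
Arguments hh {K}.
Arguments xm {K}.
Notation "x ⊗ f" := (tens x f) (at level 40, left associativity).

Section CurrentTheory.
Variable K : numFieldType.
Implicit Types (a b : sl2 K) (f g : {poly K}) (x y z : sl2 {poly K}).

Lemma tens_bracket a b f g :
  bracket (a ⊗ f) (b ⊗ g) = bracket a b ⊗ (f * g).
Proof.
case: a b => [[a1 a2] a3] [[b1 b2] b3]; rewrite /tens.
by apply: sl2_ext; rewrite /= -!mul_polyC ?(polyCB, polyCM, polyCMn); ring.
Qed.

Lemma bracket_linl y : linear (fun x => bracket x y).
Proof.
case: y => [[b1 b2] b3] k [[a1 a2] a3] [[c1 c2] c3].
by apply: sl2_ext => /=; rewrite -?mul_polyC; ring.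
Qed.

Lemma bracket_linr x : linear (bracket x).
Proof.
case: x => [[b1 b2] b3] k [[a1 a2] a3] [[c1 c2] c3].
by apply: sl2_ext => /=; rewrite -?mul_polyC; ring.
Qed.

Lemma hpart_linear s : linear (fun x => tcoef x s ⊗ 'X^s).
Proof.
move=> k [[a1 a2] a3] [[c1 c2] c3]; rewrite /tcoef /tens.
by apply: sl2_ext; rewrite /= coefD coefZ scalerDl scalerA.
Qed.

Lemma tens0 f : (0 : sl2 K) ⊗ f = 0.
Proof. by apply: sl2_ext; rewrite /= scale0r. Qed.

Lemma tcoef_tensXn a r s : tcoef (a ⊗ 'X^r) s = if s == r then a else 0.
Proof.
case: a => [[a1 a2] a3]; rewrite /tcoef /tens /= !coefZ coefXn.
by case: eqP => _; rewrite ?mulr1 ?mulr0.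
Qed.

Lemma tcoef_finite x : exists n, forall s, (n <= s)%N -> tcoef x s = 0.
Proof.
case: x => [[f g] h]; exists (maxn (size f) (maxn (size g) (size h))) => s.
rewrite !geq_max => /and3P[lf lg lh].
by rewrite /tcoef /= !nth_default.
Qed.

Lemma cur_decomp x :
  exists n, x = \sum_(s < n) tcoef x s ⊗ 'X^s.
Proof.
case: x => [[f g] h]; exists (maxn (size f) (maxn (size g) (size h))).
set n := maxn _ _.
have E (p : {poly K}) : (size p <= n)%N -> p = \sum_(s < n) p`_s *: 'X^s.
  move=> lp; apply/polyP=> i; rewrite coef_sum.
  under eq_bigr => s _ do rewrite coefZ coefXn.
  case: (ltnP i n) => [lin|lni]; last first.
    rewrite nth_default ?(leq_trans lp) // big1 // => s _.
    by rewrite gtn_eqF ?mulr0 // (leq_trans (ltn_ord s)).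
  rewrite (bigD1 (Ordinal lin)) //= eqxx mulr1 big1 ?addr0 // => s nes.
  by rewrite -val_eqE eq_sym /= in nes; rewrite (negbTE nes) mulr0.
have S1 (F : 'I_n -> sl2 {poly K}) :
    \sum_s F s = (\sum_s (F s).1.1, \sum_s (F s).1.2, \sum_s (F s).2).
  apply: sl2_ext => /=.
  - exact: (big_morph (fun x : sl2 {poly K} => x.1.1) (fun _ _ => erefl) erefl).
  - exact: (big_morph (fun x : sl2 {poly K} => x.1.2) (fun _ _ => erefl) erefl).
  - exact: (big_morph (fun x : sl2 {poly K} => x.2) (fun _ _ => erefl) erefl).
by rewrite S1 /tens /tcoef /= -!E // /n !leq_max leqnn ?orbT.
Qed.

Definition cur_subst (q : {poly K}) x : sl2 {poly K} :=
  (x.1.1 \Po q, x.1.2 \Po q, x.2 \Po q).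

Lemma cur_subst_linear q : linear (cur_subst q).
Proof. by move=> k x y; apply: sl2_ext; rewrite /= comp_polyD comp_polyZ. Qed.

Lemma cur_subst_bracket q x y :
  cur_subst q (bracket x y) = bracket (cur_subst q x) (cur_subst q y).
Proof.
case: x y => [[a b] c] [[a' b'] c'].
by apply: sl2_ext; rewrite /= ?mulr2n !(comp_polyB, comp_polyD, comp_polyM).
Qed.

Lemma cur_ind (P : sl2 {poly K} -> Prop) :
  P 0 -> (forall a s, P (a ⊗ 'X^s)) -> (forall x y, P x -> P y -> P (x + y)) ->
  forall x, P x.
Proof.
move=> P0 Pt PD x; have [n ->] := cur_decomp x.
by elim/big_ind: _.
Qed.

Record gtmod := Gtmod {
  gt_car :> lmodType K;
  gt_act : sl2 {poly K} -> gt_car -> gt_car;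
  gt_act_linear : forall x, linear (gt_act x);
  gt_act_linearl : forall v, linear (fun x => gt_act x v);
  gt_act_bracket : forall x y v,
    gt_act (bracket x y) v = gt_act x (gt_act y v) - gt_act y (gt_act x v) }.

HB.instance Definition _ (V : gtmod) x :=
  GRing.isLinear.Build K V V *:%R (gt_act x) (@gt_act_linear V x).

Lemma gt_actDl (V : gtmod) x y (v : V) :
  gt_act (x + y) v = gt_act x v + gt_act y v.
Proof. by have := gt_act_linearl v 1 x y; rewrite !scale1r. Qed.
Lemma gt_actZl (V : gtmod) k x (v : V) : gt_act (k *: x) v = k *: gt_act x v.
Proof.
have A0 : gt_act 0 v = 0.
  by have := gt_act_linearl v (-1) 0 0; rewrite scaler0 addr0 scaleN1r addNr.
by have := gt_act_linearl v k x 0; rewrite A0 !addr0.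
Qed.
Lemma gt_act0l (V : gtmod) (v : V) : gt_act 0 v = 0.
Proof. by rewrite -(scale0r (0 : sl2 {poly K})) gt_actZl scale0r. Qed.

Definition is_gthom (V W : gtmod) (phi : V -> W) : Prop :=
  linear phi /\ forall x v, phi (gt_act x v) = gt_act x (phi v).

(* [Upart v s] is U(g[t])[s] v, the grade s part of the enveloping algebra
   being spanned by the monomials (a_1 (x) t^(s_1)) ... (a_k (x) t^(s_k)) with
   s_1 + ... + s_k = s. *)
Definition mono_act (V : gtmod) (w : seq (sl2 K * nat)) (v : V) : V :=
  foldr (fun p u => gt_act (p.1 ⊗ 'X^(p.2)) u) v w.

Definition Upart (V : gtmod) (v : V) (s : nat) : V -> Prop :=
  lspan (fun u => exists w : seq (sl2 K * nat),
    sumn [seq p.2 | p <- w] = s /\ u = mono_act w v).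

Lemma Upart0 (V : gtmod) (v : V) s : Upart v s 0.
Proof. exact: lspan0. Qed.
Lemma Upart_lin (V : gtmod) (v : V) s k u w :
  Upart v s u -> Upart v s w -> Upart v s (k *: u + w).
Proof. exact: lspan_lin. Qed.
Lemma Upart_gen (V : gtmod) (v : V) : Upart v 0 v.
Proof. by apply: lspan_gen; exists [::]. Qed.
Lemma Upart_act (V : gtmod) (v : V) a r s u :
  Upart v s u -> Upart v (r + s) (gt_act (a ⊗ 'X^r) u).
Proof.
elim=> [|k y w [m [<- ->]] _ IH]; first by rewrite linear0; apply: Upart0.
rewrite linearP; apply: lspanP => //.
by exists ((a, r) :: m).
Qed.

(* All gradings are by Z_+. *)
Record grmod := Grmod {
  gr_mod :> gtmod;
  grade : nat -> gr_mod -> Prop;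
  grade0 : forall s, grade s 0;
  grade_lin : forall s k u v, grade s u -> grade s v -> grade s (k *: u + v);
  grade_sum : forall v, exists (n : nat) (w : nat -> gr_mod),
    (forall s, grade s (w s)) /\ v = \sum_(s < n) w s;
  grade_direct : forall (n : nat) (w : nat -> gr_mod),
    (forall s, grade s (w s)) -> \sum_(s < n) w s = 0 ->
    forall s, (s < n)%N -> w s = 0;
  grade_act : forall a r s v,
    grade s v -> grade (r + s) (gt_act (a ⊗ 'X^r) v) }.

Definition is_grhom (V W : grmod) (phi : V -> W) : Prop :=
  is_gthom phi /\ forall s v, grade s v -> grade s (phi v).

Definition gr_isomorphic (V W : grmod) : Prop :=
  exists2 phi : V -> W, is_grhom phi & bijective phi.

Definition short_exact (U V W : grmod) (phi : U -> V) (psi : V -> W) : Prop :=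
  [/\ is_grhom phi, is_grhom psi, injective phi,
      (forall v, psi v = 0 <-> exists u, phi u = v)
    & forall w, exists v, psi v = w].

Section GradeSum.
Variables (V : lmodType K) (P : nat -> V -> Prop).
Hypothesis P0 : forall s, P s 0.
Hypothesis Plin : forall s k u v, P s u -> P s v -> P s (k *: u + v).

Lemma lspan_sum v : lspan (fun u => exists s, P s u) v ->
  exists (n : nat) (w : nat -> V), (forall s, P s (w s)) /\ v = \sum_(s < n) w s.
Proof.
elim=> [|k u w [s Psu] _ [n [g [Pg ->]]]].
  by exists 0%N, (fun=> 0); rewrite big_ord0.
pose N := maxn n s.+1.
exists N, (fun i => k *: (if i == s then u else 0) + (if (i < n)%N then g i else 0)).
split=> [i|].
  apply: Plin; first by case: eqP => [->|].
  by case: ifP.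
rewrite big_split /=; congr (_ + _).
  have lsN : (s < N)%N by rewrite leq_max leqnn orbT.
  rewrite (bigD1 (Ordinal lsN)) //= eqxx big1 ?addr0 // => i.
  by rewrite -val_eqE /= => /negbTE ->; rewrite scaler0.
rewrite -(big_mkord xpredT (fun i => if (i < n)%N then g i else 0)).
rewrite (big_cat_nat (n := n)) //= ?leq_maxl // [X in _ = _ + X]big_nat.
rewrite [X in _ = _ + X]big1 => [|i /andP[/leq_gtF -> _]] //.
by rewrite addr0 big_mkord; apply: eq_bigr => i _; rewrite ltn_ord.
Qed.
End GradeSum.

Section Tau.
Variables (r : nat) (V : grmod).

Definition tau_grade (s : nat) (v : V) : Prop :=
  if (r <= s)%N then grade (s - r) v else v = 0.

Lemma tau_grade0 s : tau_grade s 0.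
Proof. by rewrite /tau_grade; case: ifP => // _; apply: grade0. Qed.
Lemma tau_grade_lin s k u v :
  tau_grade s u -> tau_grade s v -> tau_grade s (k *: u + v).
Proof.
rewrite /tau_grade; case: ifP => _; first exact: grade_lin.
by move=> -> ->; rewrite scaler0 addr0.
Qed.
Lemma tau_grade_sum v : exists (n : nat) (w : nat -> V),
  (forall s, tau_grade s (w s)) /\ v = \sum_(s < n) w s.
Proof.
have [n [w [gw ->]]] := grade_sum v.
exists (r + n)%N, (fun s => if (r <= s)%N then w (s - r)%N else 0); split=> [s|].
  by rewrite /tau_grade; case: (r <= s)%N; first exact: gw.
rewrite big_split_ord /= [X in _ = X + _]big1 ?add0r => [|i _]; last by rewrite leqNgt ltn_ord.
by apply: eq_bigr => i _; rewrite leq_addr addKn.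
Qed.
Lemma tau_grade_direct (n : nat) (w : nat -> V) :
  (forall s, tau_grade s (w s)) -> \sum_(s < n) w s = 0 ->
  forall s, (s < n)%N -> w s = 0.
Proof.
move=> gw w0 s ltsn; case: (leqP r s) => [lrs|lsr]; last first.
  by have := gw s; rewrite /tau_grade leqNgt lsr.
have lrn : (r <= n)%N by rewrite ltnW // (leq_ltn_trans lrs).
have gw' i : grade i (w (r + i)%N).
  by have := gw (r + i)%N; rewrite /tau_grade leq_addr addKn.
rewrite -(subnKC lrs); apply: (grade_direct gw' (n := n - r)); last first.
  by rewrite ltn_sub2r // (leq_ltn_trans lrs).
rewrite -[RHS]w0 -[RHS](big_mkord xpredT w).
rewrite (big_cat_nat (n := r)) //= [X in _ = X + _]big_nat.
rewrite [X in _ = X + _]big1 ?add0r => [|i /andP[_ lir]]; last first.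
  by have := gw i; rewrite /tau_grade leqNgt lir.
rewrite -[in RHS](add0n r) big_addn big_mkord.
by apply: eq_bigr => i _; rewrite addnC.
Qed.
Lemma tau_grade_act a q s v :
  tau_grade s v -> tau_grade (q + s) (gt_act (a ⊗ 'X^q) v).
Proof.
rewrite /tau_grade; case: (leqP r s) => [lrs gv|_ ->].
  by rewrite (leq_trans lrs) ?leq_addl // -addnBA //; apply: grade_act.
by rewrite linear0; case: ifP => // _; apply: grade0.
Qed.

Definition tau : grmod :=
  Grmod tau_grade0 tau_grade_lin tau_grade_sum tau_grade_direct tau_grade_act.
End Tau.

End CurrentTheory.

Section Modules.
Variable K : numFieldType.

Section Irreducible.
Variable r : nat.

(* V(r) in the basis v_i = (x^-)^i v_r (0 <= i <= r), in which
     h v_i = (r - 2 i) v_i, x^- v_i = v_(i+1), x^+ v_(i+1) = (i+1)(r-i) v_i,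
   with v_(r+1) = 0. *)
Definition irr_xp (u : 'cV[K]_r.+1) : 'cV[K]_r.+1 :=
  \col_(i < r.+1) ((i.+1 * (r - i))%:R * u (inord i.+1) 0).
Definition irr_h (u : 'cV[K]_r.+1) : 'cV[K]_r.+1 :=
  \col_(i < r.+1) ((r%:R - 2 * i%:R) * u i 0).
Definition irr_xm (u : 'cV[K]_r.+1) : 'cV[K]_r.+1 :=
  \col_(i < r.+1) (if (i : nat) is i'.+1 then u (inord i') 0 else 0).

Definition irr_act (x : sl2 K) (u : 'cV[K]_r.+1) : 'cV[K]_r.+1 :=
  x.1.1 *: irr_xp u + x.1.2 *: irr_h u + x.2 *: irr_xm u.

Lemma irr_act_linear x : linear (irr_act x).
Proof.
move=> k u v; apply/matrixP=> i j; rewrite !mxE.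
by case: (i : nat) => [|i']; rewrite ?mxE; ring.
Qed.

Lemma irr_xp_h u : irr_h (irr_xp u) - irr_xp (irr_h u) = 2 *: irr_xp u.
Proof.
apply/matrixP=> i j; rewrite !mxE; case: (ltnP i r) => ir.
  rewrite inordK // natrM; have -> : (i.+1)%:R = i%:R + 1 :> K by rewrite -natr1.
  by ring.
have -> : (r - i = 0)%N by apply/eqP; rewrite subn_eq0.
by rewrite muln0; ring.
Qed.

Lemma irr_xm_h u : irr_h (irr_xm u) - irr_xm (irr_h u) = (- 2) *: irr_xm u.
Proof.
apply/matrixP=> i j; rewrite !mxE; case E: (i : nat) => [|i']; first by ring.
rewrite !mxE inordK; last by rewrite (leq_trans _ (ltn_ord i)) // E.
have -> : (i'.+1)%:R = i'%:R + 1 :> K by rewrite -natr1.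
by ring.
Qed.

Lemma irr_xp_xm u : irr_xp (irr_xm u) - irr_xm (irr_xp u) = irr_h u.
Proof.
apply/matrixP=> i j; rewrite !mxE.
have -> : (if (i : nat) is i'.+1 then irr_xp u (inord i') 0 else 0) =
          (i * (r - i).+1)%:R * u i 0.
  case E: (i : nat) => [|i']; first by rewrite mul0n mul0r.
  have lir : (i' < r)%N by have := ltn_ord i; rewrite E.
  rewrite !mxE inordK; last by rewrite ltnW.
  by rewrite -E inord_val E subnSK.
case: (ltnP i r) => ir.
  rewrite inordK //= inord_val !natrM.
  have -> : (i.+1)%:R = i%:R + 1 :> K by rewrite -natr1.
  have -> : ((r - i).+1)%:R = r%:R - i%:R + 1 :> K by rewrite -natr1 natrB // ltnW.
  by rewrite natrB ?(ltnW ir) //; ring.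
have {ir} -> : (i : nat) = r by apply/eqP; rewrite eqn_leq ir -ltnS ltn_ord.
by rewrite subnn muln0 muln1; ring.
Qed.

Lemma irr_act_bracket x y u :
  irr_act (bracket x y) u = irr_act x (irr_act y u) - irr_act y (irr_act x u).
Proof.
have L (f : 'cV[K]_r.+1 -> 'cV[K]_r.+1) : linear f -> forall a b c u v w,
    f (a *: u + b *: v + c *: w) = a *: f u + b *: f v + c *: f w.
  move=> lf a b c u1 v w; rewrite -!addrA lf; congr (_ + _).
  rewrite lf; congr (_ + _); have f0 : f 0 = 0.
    by have := lf (-1) 0 0; rewrite scaler0 addr0 scaleN1r addNr.
  by have := lf c w 0; rewrite !addr0 f0 addr0.
have Lp : linear irr_xp.
  by move=> k v w; apply/matrixP=> i j; rewrite !mxE; ring.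
have Lh : linear irr_h.
  by move=> k v w; apply/matrixP=> i j; rewrite !mxE; ring.
have Lm : linear irr_xm.
  move=> k v w; apply/matrixP=> i j; rewrite !mxE.
  by case: (i : nat) => [|i']; rewrite ?mxE; ring.
have E1 : irr_h (irr_xp u) = 2 *: irr_xp u + irr_xp (irr_h u).
  by rewrite -irr_xp_h subrK.
have E2 : irr_h (irr_xm u) = (-2) *: irr_xm u + irr_xm (irr_h u).
  by rewrite -irr_xm_h subrK.
have E3 : irr_xp (irr_xm u) = irr_h u + irr_xm (irr_xp u).
  by rewrite -irr_xp_xm subrK.
case: x y => [[a b] c] [[a' b'] c']; rewrite /irr_act /=.
rewrite !(L _ Lp) !(L _ Lh) !(L _ Lm) E1 E2 E3.
apply/matrixP=> i j; move: (irr_xp u) (irr_h u) (irr_xm u) => P H M.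
move: (irr_xp P) (irr_xp H) (irr_h H) (irr_xm P) (irr_xm H) (irr_xm M).
by move=> m1 m2 m3 m4 m5 m6; rewrite !mxE; ring.
Qed.

Definition cur_ev0 (x : sl2 {poly K}) : sl2 K := (x.1.1.[0], x.1.2.[0], x.2.[0]).

Definition ev0_act (x : sl2 {poly K}) (u : 'cV[K]_r.+1) : 'cV[K]_r.+1 :=
  irr_act (cur_ev0 x) u.

Lemma ev0_act_linearl u : linear (fun x => ev0_act x u).
Proof.
move=> k x y; rewrite /ev0_act /irr_act /= !hornerE.
by apply/matrixP=> i j; rewrite !mxE; ring.
Qed.

Lemma ev0_act_bracket x y u :
  ev0_act (bracket x y) u = ev0_act x (ev0_act y u) - ev0_act y (ev0_act x u).
Proof.
rewrite /ev0_act -irr_act_bracket; congr irr_act.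
case: x y => [[a b] c] [[a' b'] c'].
by apply: sl2_ext; rewrite /= !(hornerMn, hornerD, hornerN, hornerM).
Qed.

Definition ev0V : gtmod K :=
  Gtmod (fun x => irr_act_linear (cur_ev0 x)) ev0_act_linearl ev0_act_bracket.

Definition irr_gen : ev0V := delta_mx ord0 ord0.

End Irreducible.

Section GtPresentation.
Variables (G : Type) (Rel : term K G (sl2 {poly K}) -> term K G (sl2 {poly K}) -> Prop).

Inductive gt_rel : term K G (sl2 {poly K}) -> term K G (sl2 {poly K}) -> Prop :=
| gt_rel_def t u of Rel t u : gt_rel t u
| gt_rel_linear k x y t :
    gt_rel (Op (k *: x + y) t) (Add (Scale k (Op x t)) (Op y t))
| gt_rel_bracket x y t :
    gt_rel (Op (bracket x y) t)
           (Add (Op x (Op y t)) (Scale (-1) (Op y (Op x t)))).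

Lemma gt_pres_linearl (v : pres gt_rel) : linear (fun x => pop x v).
Proof.
move=> k x y; elim/pcls_ind: v => t.
by rewrite !popE -pclsZ -pclsD; apply/pclsP/cong_rel/gt_rel_linear.
Qed.

Lemma gt_pres_bracket x y (v : pres gt_rel) :
  pop (bracket x y) v = pop x (pop y v) - pop y (pop x v).
Proof.
elim/pcls_ind: v => t.
rewrite [pop y (pcls _ t)]popE [pop x (pcls _ t)]popE !popE -scaleN1r -pclsZ -pclsD.
by apply/pclsP/cong_rel/gt_rel_bracket.
Qed.

(* The sl_2[t]-module generated by G with defining relations Rel: terms modulo
   the congruence generated by Rel and the axioms of an sl_2[t]-module. *)
Definition gt_pres : gtmod K :=
  Gtmod (@pop_linear _ _ _ gt_rel) gt_pres_linearl gt_pres_bracket.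

End GtPresentation.

Section Vxi.
Variable xi : seq nat.

(* [sumn (drop k xi)] is the sum of the parts xi_j with j >= k + 1. *)
Local Notation v := (Gen tt).

Inductive V_rel : term K unit (sl2 {poly K}) -> term K unit (sl2 {poly K}) -> Prop :=
| V_rel_xp s : V_rel (Op (xp ⊗ 'X^s) v) Zero
| V_rel_h s : V_rel (Op (hh ⊗ 'X^s) v) (Scale ((s == 0%N)%:R * (sumn xi)%:R) v)
| V_rel_xm : V_rel (iter (sumn xi).+1 (Op (xm ⊗ 1)) v) Zero
| V_rel_mixed s r k of (0 < s)%N & (0 < r)%N & (0 < k)%N
    & (1 + r * k + sumn (drop k xi) <= s + r)%N :
    V_rel (iter s (Op (xp ⊗ 'X)) (iter (s + r) (Op (xm ⊗ 1)) v)) Zero.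

Definition V_pres : gtmod K := gt_pres V_rel.
Definition V_pres_gen : V_pres := pgen (gt_rel V_rel) tt.

Lemma V_pres_ind (P : V_pres -> Prop) :
  P 0 -> P V_pres_gen -> (forall k u w, P u -> P w -> P (k *: u + w)) ->
  (forall x u, P u -> P (gt_act x u)) -> forall u, P u.
Proof.
move=> P0 Pg Pl Pa; elim/pcls_ind; elim=> [[]|//|t Pt u Pu|k t Pt|x t Pt].
- exact: Pg.
- by rewrite pclsD -[pcls _ t]scale1r; apply: Pl.
- by rewrite pclsZ -[_ *: _]addr0; apply: Pl.
- by rewrite -popE; apply: Pa.
Qed.

Definition V_grade : nat -> V_pres -> Prop := Upart V_pres_gen.

Lemma V_grade_sum u : exists (n : nat) (w : nat -> V_pres),
  (forall s, V_grade s (w s)) /\ u = \sum_(s < n) w s.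
Proof.
apply: lspan_sum => [s|s k u1 u2|]; [exact: Upart0|exact: Upart_lin|].
elim/V_pres_ind: u => [||k u w|x u Hu]; [exact: lspan0| |exact: lspan_lin|].
  by apply: lspan_gen; exists 0%N; apply: Upart_gen.
elim/(@cur_ind K): x => [|a r|x y Hx Hy].
- by rewrite gt_act0l; apply: lspan0.
- elim: Hu => [|k u1 w [s Us] _ IH]; first by rewrite linear0; apply: lspan0.
  rewrite linearP; apply: lspanP => //; exists (r + s)%N; exact: Upart_act.
- by rewrite gt_actDl -[gt_act x u]scale1r; apply: lspan_lin.
Qed.

(* Directness of the grading is obtained from the automorphism of V(xi)
   induced by t |-> 2 t, which acts on the grade s part by 2 ^ s. *)
Definition dil : sl2 {poly K} -> sl2 {poly K} := cur_subst (2%:P * 'X).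

Lemma dil_tens (a : sl2 K) s : dil (a ⊗ 'X^s) = (2 ^+ s) *: (a ⊗ 'X^s).
Proof.
apply: sl2_ext; rewrite /= comp_polyZ rmorphXn /= comp_polyX exprMn -polyC_exp.
all: by rewrite mul_polyC !scalerA mulrC.
Qed.

Lemma dil_tens1 (a : sl2 K) : dil (a ⊗ 1) = a ⊗ 1.
Proof. by have := dil_tens a 0; rewrite expr0 scale1r. Qed.
Lemma dil_tensX (a : sl2 K) : dil (a ⊗ 'X) = 2 *: (a ⊗ 'X).
Proof. exact: (dil_tens a 1). Qed.

Definition wdil : sl2 {poly K} -> V_pres -> V_pres := fun x => gt_act (dil x).

Local Notation wev := (@teval K unit (sl2 {poly K}) V_pres (fun=> V_pres_gen) wdil).

Lemma pcls_iter n x t :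
  pcls (gt_rel V_rel) (iter n (Op x) t) = iter n (@gt_act K V_pres x) (pcls _ t).
Proof. by elim: n => //= n <-; rewrite -popE. Qed.

Lemma teval_iter n x t :
  wev (iter n (Op x) t) =
  iter n (wdil x) (wev t).
Proof. by elim: n => //= n ->. Qed.

Lemma iter_actZ (V : gtmod K) n k x (u : V) :
  iter n (@gt_act K V (k *: x)) u = k ^+ n *: iter n (@gt_act K V x) u.
Proof.
elim: n => [|n IH] /=; first by rewrite expr0 scale1r.
by rewrite IH gt_actZl linearZ scalerA exprS.
Qed.

Lemma V_rel0 t u : V_rel t u -> pcls (gt_rel V_rel) t = pcls _ u.
Proof. by move=> tu; apply/pclsP/cong_rel/gt_rel_def. Qed.

Lemma wdil_rel t u : gt_rel V_rel t u ->
  wev t = wev u.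
Proof.
case=> {t u} [t u tu|k x y t|x y t] /=; last 2 first.
- by rewrite /wdil /dil cur_subst_linear gt_act_linearl.
- by rewrite /wdil /dil cur_subst_bracket gt_act_bracket scaleN1r.
have wdil1 a : wdil (a ⊗ 1) = gt_act (a ⊗ 1) by rewrite /wdil dil_tens1.
have wdilX a : wdil (a ⊗ 'X) = gt_act (2 *: (a ⊗ 'X)) by rewrite /wdil dil_tensX.
have V0 := V_rel0 tu.
case: tu V0 => [s|s||s r k _ _ _ _].
- rewrite -popE /= => E; rewrite /wdil dil_tens gt_actZl.
  by rewrite [gt_act _ _]E scaler0.
- rewrite -popE pclsZ /= => E; rewrite /wdil dil_tens gt_actZl.
  rewrite [gt_act _ _]E scalerA.
  by case: s {E} => [|s]; rewrite ?expr0 ?mul1r // mul0r mulr0.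
- by rewrite pcls_iter teval_iter wdil1.
- by rewrite !pcls_iter !teval_iter wdil1 wdilX iter_actZ => ->; rewrite scaler0.
Qed.

Definition theta : V_pres -> V_pres :=
  @pres_lift K unit (sl2 {poly K}) (gt_rel V_rel) V_pres (fun=> V_pres_gen) wdil.

Lemma theta_linear : linear theta.
Proof. by apply: pres_lift_linear; [move=> x; exact: gt_act_linear|exact: wdil_rel]. Qed.
HB.instance Definition _ := GRing.isLinear.Build K V_pres V_pres *:%R theta theta_linear.

Lemma theta_act x u : theta (gt_act x u) = gt_act (dil x) (theta u).
Proof. by apply: pres_lift_op; [move=> y; exact: gt_act_linear|exact: wdil_rel]. Qed.

Lemma theta_gen : theta V_pres_gen = V_pres_gen.
Proof. by apply: pres_lift_gen; [move=> y; exact: gt_act_linear|exact: wdil_rel]. Qed.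

Lemma theta_grade s u : V_grade s u -> theta u = 2 ^+ s *: u.
Proof.
elim=> [|k w1 w2 [m [<- ->]] _ IH]; first by rewrite linear0 scaler0.
rewrite theta_linear IH scalerDr !scalerA mulrC -scalerA; congr (_ + _).
congr (_ *: _).
elim: m {IH} => [|[a r] m IHm] /=; first by rewrite expr0 scale1r theta_gen.
by rewrite theta_act IHm dil_tens gt_actZl linearZ /= scalerA exprD.
Qed.

Lemma V_grade_direct (n : nat) (w : nat -> V_pres) :
  (forall s, V_grade s (w s)) -> \sum_(s < n) w s = 0 ->
  forall s, (s < n)%N -> w s = 0.
Proof.
elim: n w => // n IH w gw w0.
have H : forall s, (s < n)%N -> w s = 0.
  move=> s ltsn; have : (2 ^+ s - 2 ^+ n) *: w s = 0.
    apply: (IH (fun s => (2 ^+ s - 2 ^+ n) *: w s)) => // [i|].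
      by rewrite -[_ *: _]addr0; apply: Upart_lin; [exact: gw|exact: Upart0].
    have : theta (\sum_(s < n.+1) w s) - 2 ^+ n *: (\sum_(s < n.+1) w s) = 0.
      by rewrite w0 linear0 scaler0 subrr.
    rewrite linear_sum scaler_sumr -sumrB big_ord_recr /= (theta_grade (gw n)).
    rewrite subrr addr0 => {2}<-; apply: eq_bigr => i _.
    by rewrite (theta_grade (gw i)) scalerBl.
  move/eqP; rewrite scaler_eq0 subr_eq0 => /orP[|/eqP //].
  by rewrite -!natrX eqr_nat eqn_exp2l // ltn_eqF.
move=> s; rewrite ltnS leq_eqVlt => /orP[/eqP->|]; last exact: H.
move: w0; rewrite big_ord_recr /= big1 ?add0r // => i _; exact: H.
Qed.

Definition V_presg : grmod K :=
  Grmod (@Upart0 K _ V_pres_gen) (@Upart_lin K _ V_pres_gen) V_grade_sum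
        V_grade_direct (@Upart_act K _ V_pres_gen).

End Vxi.


Section Trivial.

Definition triv_act (x : sl2 {poly K}) (u : K^o) : K^o := 0.
Lemma triv_act_linear x : linear (triv_act x).
Proof. by move=> k u v; rewrite /triv_act scaler0 addr0. Qed.
Lemma triv_act_linearl u : linear (fun x => triv_act x u).
Proof. by move=> k x y; rewrite /triv_act scaler0 addr0. Qed.
Lemma triv_act_bracket x y u :
  triv_act (bracket x y) u = triv_act x (triv_act y u) - triv_act y (triv_act x u).
Proof. by rewrite /triv_act subrr. Qed.

Definition trivV : gtmod K := Gtmod triv_act_linear triv_act_linearl triv_act_bracket.

Definition triv_grade (s : nat) (u : trivV) : Prop := (0 < s)%N -> u = 0.

Lemma triv_grade0 s : triv_grade s 0.
Proof. by []. Qed.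
Lemma triv_grade_lin s k u v :
  triv_grade s u -> triv_grade s v -> triv_grade s (k *: u + v).
Proof. by move=> gu gv s0; rewrite gu // gv // scaler0 addr0. Qed.
Lemma triv_grade_sum v : exists (n : nat) (w : nat -> trivV),
  (forall s, triv_grade s (w s)) /\ v = \sum_(s < n) w s.
Proof.
exists 1%N, (fun s => if s == 0%N then v else 0); split; first by case.
by rewrite big_ord_recl big_ord0 addr0.
Qed.
Lemma triv_grade_direct (n : nat) (w : nat -> trivV) :
  (forall s, triv_grade s (w s)) -> \sum_(s < n) w s = 0 ->
  forall s, (s < n)%N -> w s = 0.
Proof.
move=> gw; case: n => // n; rewrite big_ord_recl big1 ?addr0 => [w0|i _]; last exact: gw.
by case=> [//|s] _; apply: gw.
Qed.
Lemma triv_grade_act a r s v :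
  triv_grade s v -> triv_grade (r + s) (gt_act (a ⊗ 'X^r) v).
Proof. by []. Qed.

Definition trivVg : grmod K :=
  Grmod triv_grade0 triv_grade_lin triv_grade_sum triv_grade_direct triv_grade_act.

End Trivial.

Definition Vmod (xi : seq nat) : grmod K :=
  if xi is [::] then trivVg else V_presg xi.

Definition Vgen (xi : seq nat) : Vmod xi :=
  match xi return Vmod xi with
  | [::] => (1 : K^o)
  | n :: xi' => V_pres_gen (n :: xi')
  end.

Section Tensor.
Variables (I : finType) (V : I -> gtmod K).

Local Notation gen := (forall i, V i).

Inductive multilin : term K gen void -> term K gen void -> Prop :=
| Multilin (v : gen) (i : I) (k : K) (u w : V i) :
    multilin (Gen (dfwith v (k *: u + w)))
             (Add (Scale k (Gen (dfwith v u))) (Gen (dfwith v w))).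

Definition tensor_space : lmodType K := pres multilin.
Definition pure (v : gen) : tensor_space := pgen multilin v.

Lemma pure_lin (v : gen) i k (u w : V i) :
  pure (dfwith v (k *: u + w)) = k *: pure (dfwith v u) + pure (dfwith v w).
Proof. by rewrite /pure /pgen -pclsZ -pclsD; apply/pclsP/cong_rel/Multilin. Qed.

Lemma tensor_ind (P : tensor_space -> Prop) :
  P 0 -> (forall v, P (pure v)) ->
  (forall k u w, P u -> P w -> P (k *: u + w)) -> forall u, P u.
Proof.
move=> P0 Pp Pl; elim/pcls_ind; elim=> [g|//|t Pt u Pu|k t Pt|[]].
- exact: Pp.
- by rewrite pclsD -[pcls _ t]scale1r; apply: Pl.
- by rewrite pclsZ -[_ *: _]addr0; apply: Pl.
Qed.

Lemma dfwith_same (v : gen) i (u w : V i) : dfwith (dfwith v u) w = dfwith v w.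
Proof.
apply: functional_extensionality_dep => j; case: (dfwithP v w) => [|k ik].
  by rewrite dfwith_in.
by rewrite !dfwith_out.
Qed.

Lemma dfwith_comm (v : gen) i j (u : V i) (w : V j) : i != j ->
  dfwith (dfwith v u) w = dfwith (dfwith v w) u.
Proof.
move=> ij; apply: functional_extensionality_dep => k.
case: (eqVneq j k) => [jk|jk].
  by subst k; rewrite dfwith_in (dfwith_out _ _ ij) dfwith_in.
rewrite (dfwith_out _ _ jk).
case: (eqVneq i k) => [ik|ik]; first by subst k; rewrite !dfwith_in.
by rewrite !(dfwith_out _ _ ik) dfwith_out.
Qed.

Definition pure_act (x : sl2 {poly K}) (v : gen) : tensor_space :=
  \sum_i pure (dfwith v (gt_act x (v i))).

(* x (v_1 (x) ... (x) v_m) = sum_i v_1 (x) ... (x) x v_i (x) ... (x) v_m,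
   see [tensor_actE]. *)
Definition tensor_act (x : sl2 {poly K}) : tensor_space -> tensor_space :=
  @pres_lift K gen void multilin tensor_space (pure_act x) (of_void _).

Lemma pure_act_rel x t u : multilin t u ->
  teval (pure_act x) (of_void _) t = teval (pure_act x) (of_void _) u.
Proof.
case=> {t u} v i k u w /=; rewrite /pure_act scaler_sumr -big_split /=.
apply: eq_bigr => j _; case: (eqVneq i j) => [<-|ij].
  by rewrite !dfwith_in !dfwith_same linearP pure_lin.
by rewrite !(dfwith_out _ _ ij) !(dfwith_comm _ _ _ ij) pure_lin.
Qed.

Lemma tensor_act_linear x : linear (tensor_act x).
Proof. by apply: pres_lift_linear => [[]|]; apply: pure_act_rel. Qed.

Lemma tensor_actE x v : tensor_act x (pure v) = pure_act x v.
Proof. by apply: pres_lift_gen => [[]|]; apply: pure_act_rel. Qed.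

HB.instance Definition _ x := GRing.isLinear.Build K tensor_space tensor_space *:%R
  (tensor_act x) (tensor_act_linear x).

Lemma tensor_act_linearl u : linear (fun x => tensor_act x u).
Proof.
move=> k x y; elim/tensor_ind: u => [|v|c u w IHu IHw].
- by rewrite !linear0 addr0.
- rewrite !tensor_actE /pure_act scaler_sumr -big_split /=.
  by apply: eq_bigr => i _; rewrite gt_act_linearl pure_lin.
- by rewrite !tensor_act_linear IHu IHw !scalerDr !scalerA [k * c]mulrC addrACA.
Qed.

Lemma tensor_act_bracket x y u :
  tensor_act (bracket x y) u =
  tensor_act x (tensor_act y u) - tensor_act y (tensor_act x u).
Proof.
elim/tensor_ind: u => [|v|c u w IHu IHw].
- by rewrite !linear0 addr0.
- have E a b : tensor_act a (tensor_act b (pure v)) =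
      \sum_i pure (dfwith v (gt_act a (gt_act b (v i)))) +
      \sum_i \sum_(j | j != i) pure (dfwith (dfwith v (gt_act b (v i))) (gt_act a (v j))).
    rewrite tensor_actE linear_sum -big_split /=; apply: eq_bigr => i _.
    rewrite tensor_actE /pure_act (bigD1 i) //= dfwith_in dfwith_same.
    by congr (_ + _); apply: eq_bigr => j ji; rewrite dfwith_out // eq_sym.
  rewrite !E [X in _ - (_ + X)](exchange_big_dep xpredT) //=.
  rewrite opprD addrACA [X in _ + X](_ : _ = 0).
    rewrite addr0 -sumrB tensor_actE; apply: eq_bigr => i _.
    by rewrite gt_act_bracket addrC -scaleN1r pure_lin scaleN1r addrC.
  rewrite -sumrB big1 // => i _; apply/eqP; rewrite subr_eq0; apply/eqP.
  apply: eq_big => j; first by rewrite eq_sym.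
  by move=> ji; rewrite dfwith_comm // eq_sym.
- by rewrite !tensor_act_linear IHu IHw /= scalerBr opprD addrACA.
Qed.

Definition tensor : gtmod K :=
  Gtmod tensor_act_linear tensor_act_linearl tensor_act_bracket.

End Tensor.

Section Twist.
Variables (z : K) (V : gtmod K).

Definition twist_act (x : sl2 {poly K}) : V -> V :=
  gt_act (cur_subst ('X + z%:P) x).

Lemma twist_act_linear x : linear (twist_act x).
Proof. exact: gt_act_linear. Qed.
Lemma twist_act_linearl v : linear (fun x => twist_act x v).
Proof. by move=> k x y; rewrite /twist_act cur_subst_linear gt_act_linearl. Qed.
Lemma twist_act_bracket x y v :
  twist_act (bracket x y) v = twist_act x (twist_act y v) - twist_act y (twist_act x v).
Proof. by rewrite /twist_act cur_subst_bracket gt_act_bracket. Qed.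

(* On V^z, the element x (x) f(t) acts as x (x) f(t + z). *)
Definition twist : gtmod K :=
  Gtmod twist_act_linear twist_act_linearl twist_act_bracket.

End Twist.

Section AssociatedGraded.
Variables (V : gtmod K) (v0 : V).

Definition filt (r : nat) (u : V) : Prop :=
  exists w : nat -> V, (forall s, Upart v0 s (w s)) /\ u = \sum_(s < r.+1) w s.

(* F^(r-1) V, with F^(-1) V = 0 *)
Definition filt_pred (r : nat) (u : V) : Prop :=
  if r is r'.+1 then filt r' u else u = 0.

Lemma filt0 r : filt r 0.
Proof. by exists (fun=> 0); split=> [s|]; [exact: Upart0|rewrite big1]. Qed.
Lemma filt_lin r k u w : filt r u -> filt r w -> filt r (k *: u + w).
Proof.
move=> [f [Uf ->]] [g [Ug ->]]; exists (fun s => k *: f s + g s).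
by split=> [s|]; [exact: Upart_lin|rewrite scaler_sumr big_split].
Qed.
Lemma filt_act a s r u : filt r u -> filt (s + r) (gt_act (a ⊗ 'X^s) u).
Proof.
move=> [f [Uf ->]].
exists (fun i => if (s <= i)%N then gt_act (a ⊗ 'X^s) (f (i - s)%N) else 0).
split=> [i|].
  case: leqP => [lsi|_]; last exact: Upart0.
  by rewrite -{1}(subnKC lsi); apply: Upart_act.
rewrite linear_sum -addnS big_split_ord /= [X in _ = X + _]big1 ?add0r => [|i _].
  by apply: eq_bigr => i _; rewrite leq_addr addKn.
by rewrite leqNgt ltn_ord.
Qed.

Lemma filt_pred0 r : filt_pred r 0.
Proof. by case: r => //= r; apply: filt0. Qed.
Lemma filt_pred_lin r k u w :
  filt_pred r u -> filt_pred r w -> filt_pred r (k *: u + w).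
Proof.
by case: r => [|r]; [move=> /= -> ->; rewrite scaler0 addr0|apply: filt_lin].
Qed.
Lemma filt_pred_act a s r u :
  filt_pred r u -> filt_pred (s + r) (gt_act (a ⊗ 'X^s) u).
Proof.
case: r => [/= ->|r]; last by rewrite addnS; apply: filt_act.
by rewrite linear0; apply: filt_pred0.
Qed.

(* The direct sum of the F^r V: finitely supported sequences (f_r)_r with
   f_r in F^r V; gr V is its quotient by the direct sum of the F^(r-1) V. *)
Record filt_sum := FiltSum {
  fs_fun :> nat -> V;
  fs_filt : forall r, filt r (fs_fun r);
  fs_fin : exists n, forall r, (n <= r)%N -> fs_fun r = 0 }.

Definition fs_eq (f g : filt_sum) : Prop := forall r, filt_pred r (f r - g r).

Definition fs_zero : filt_sum :=
  @FiltSum (fun=> 0) filt0 (ex_intro _ 0%N (fun _ _ => erefl)).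

Lemma fs_lin_filt k (f g : filt_sum) r : filt r (k *: f r + g r).
Proof. by apply: filt_lin; apply: fs_filt. Qed.
Lemma fs_lin_fin k (f g : filt_sum) :
  exists n, forall r, (n <= r)%N -> k *: f r + g r = 0.
Proof.
have [n fn] := fs_fin f; have [m gm] := fs_fin g; exists (maxn n m) => r.
by rewrite geq_max => /andP[nr mr]; rewrite fn // gm // scaler0 addr0.
Qed.
Definition fs_lin k (f g : filt_sum) : filt_sum :=
  FiltSum (fs_lin_filt k f g) (fs_lin_fin k f g).

Definition fs_add (f g : filt_sum) : filt_sum := fs_lin 1 f g.
Definition fs_scale (k : K) (f : filt_sum) : filt_sum := fs_lin k f fs_zero.

Lemma fs_eqW (f g : filt_sum) : f =1 g -> fs_eq f g.
Proof. by move=> fg r; rewrite fg subrr; apply: filt_pred0. Qed.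

Lemma fs_sym f g : fs_eq f g -> fs_eq g f.
Proof.
move=> fg r; rewrite -opprB -scaleN1r -[_ *: _]addr0.
by apply: filt_pred_lin => //; apply: filt_pred0.
Qed.
Lemma fs_trans f g h : fs_eq f g -> fs_eq g h -> fs_eq f h.
Proof.
move=> fg gh r; rewrite -(subrK (g r) (f r)) -addrA -[f r - g r]scale1r.
exact: filt_pred_lin.
Qed.
Lemma fs_linE k f f' g g' :
  fs_eq f f' -> fs_eq g g' -> fs_eq (fs_lin k f g) (fs_lin k f' g').
Proof.
move=> ff gg r /=; rewrite opprD addrACA -scalerBr; exact: filt_pred_lin.
Qed.

Definition fs_setoid : setoid_lmod K.
Proof.
refine (@SetoidLmod K filt_sum fs_eq fs_zero fs_add fs_scale
  _ fs_sym fs_trans (@fs_linE 1) _ _ _ _ _ _ _ _ _).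
- by move=> t; apply: fs_eqW.
- by move=> a t t' tt'; apply: fs_linE => //; apply: fs_eqW.
- by move=> t u w; apply: fs_eqW => r /=; rewrite !scale1r addrA.
- by move=> t u; apply: fs_eqW => r /=; rewrite !scale1r addrC.
- by move=> t; apply: fs_eqW => r /=; rewrite scaler0 add0r.
- by move=> t; apply: fs_eqW => r /=; rewrite scale1r addr0 scaleN1r addNr.
- by move=> a b t; apply: fs_eqW => r /=; rewrite !addr0 scalerA.
- by move=> t; apply: fs_eqW => r /=; rewrite scale1r addr0.
- by move=> a t u; apply: fs_eqW => r /=; rewrite !addr0 !scale1r scalerDr.
- by move=> a b t; apply: fs_eqW => r /=; rewrite !addr0 !scale1r scalerDl.
Defined.

Definition gr_space : lmodType K := quo fs_setoid.
Definition gr_cls (f : filt_sum) : gr_space := @cls K fs_setoid f.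

Lemma gr_clsP f g : gr_cls f = gr_cls g <-> fs_eq f g.
Proof. exact: (@clsP K fs_setoid). Qed.
Lemma gr_cls_ind (P : gr_space -> Prop) : (forall f, P (gr_cls f)) -> forall q, P q.
Proof. exact: (@quo_ind K fs_setoid). Qed.
Lemma gr_cls_lin k f g : gr_cls (fs_lin k f g) = k *: gr_cls f + gr_cls g.
Proof.
rewrite /gr_cls -(@clsZ K fs_setoid) -(@clsD K fs_setoid).
by apply/gr_clsP/fs_eqW => r /=; rewrite addr0 scale1r.
Qed.

(* (x f)_n = sum_(s <= n) (x_s (x) t^s) f_(n - s), for x = sum_s x_s (x) t^s *)
Definition fs_act_fun (x : sl2 {poly K}) (f : nat -> V) (n : nat) : V :=
  \sum_(s < n.+1) gt_act (tcoef x s ⊗ 'X^s) (f (n - s)%N).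

Lemma fs_act_filt x (f : filt_sum) n : filt n (fs_act_fun x f n).
Proof.
rewrite /fs_act_fun; elim/big_ind: _ => [|u w Fu Fw|s _]; first exact: filt0.
  by rewrite -[u]scale1r; apply: filt_lin.
have lsn : (s <= n)%N by rewrite -ltnS.
by have := filt_act (tcoef x s) s (fs_filt f (n - s)); rewrite subnKC.
Qed.

Lemma fs_act_fin x (f : filt_sum) :
  exists n, forall r, (n <= r)%N -> fs_act_fun x f r = 0.
Proof.
have [n fn] := fs_fin f; have [m xm0] := tcoef_finite x.
exists (m + n)%N => r lr; rewrite /fs_act_fun big1 // => s _.
case: (leqP m s) => [lms|lsm]; first by rewrite xm0 // tens0 gt_act0l.
have lsr : (s <= r)%N by rewrite -ltnS.
rewrite (fn (r - s)%N) ?linear0 // leq_subRL //.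
by apply: leq_trans lr; rewrite leq_add2r ltnW.
Qed.

Definition fs_act x (f : filt_sum) : filt_sum :=
  FiltSum (fs_act_filt x f) (fs_act_fin x f).

Definition gr_act (x : sl2 {poly K}) (q : gr_space) : gr_space :=
  gr_cls (fs_act x (@rep K fs_setoid q)).

Lemma gr_actE x f : gr_act x (gr_cls f) = gr_cls (fs_act x f).
Proof.
rewrite /gr_act; apply/gr_clsP => n /=; rewrite /fs_act_fun -sumrB.
elim/big_ind: _ => [|u w Fu Fw|s _]; first exact: filt_pred0.
  by rewrite -[u]scale1r; apply: filt_pred_lin.
have lsn : (s <= n)%N by rewrite -ltnS.
rewrite -linearB -{1}(subnKC lsn); apply: filt_pred_act.
exact: (@rep_cls K fs_setoid f).
Qed.

Lemma gr_act_linear x : linear (gr_act x).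
Proof.
move=> k; elim/gr_cls_ind=> f; elim/gr_cls_ind=> g.
rewrite -gr_cls_lin !gr_actE -gr_cls_lin; apply/gr_clsP/fs_eqW => n /=.
rewrite /fs_act_fun scaler_sumr -big_split /=.
by apply: eq_bigr => s _; rewrite linearP.
Qed.

Lemma gr_act_linearl q : linear (fun x => gr_act x q).
Proof.
move=> k x y; elim/gr_cls_ind: q => f.
rewrite !gr_actE -!gr_cls_lin; apply/gr_clsP/fs_eqW => n /=.
rewrite /fs_act_fun scaler_sumr -big_split /=.
by apply: eq_bigr => s _; rewrite hpart_linear gt_act_linearl.
Qed.

HB.instance Definition _ x := GRing.isLinear.Build K gr_space gr_space *:%R
  (gr_act x) (gr_act_linear x).

Lemma fs_act_homog a s (f : filt_sum) n :
  fs_act (a ⊗ 'X^s) f n =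
  if (s <= n)%N then gt_act (a ⊗ 'X^s) (f (n - s)%N) else 0.
Proof.
rewrite /= /fs_act_fun; case: leqP => [lsn|lns].
  have lsn1 : (s < n.+1)%N by [].
  rewrite (bigD1 (Ordinal lsn1)) //= tcoef_tensXn eqxx big1 ?addr0 // => i.
  by rewrite -val_eqE /= => /negbTE ne; rewrite tcoef_tensXn ne tens0 gt_act0l.
rewrite big1 // => i _; rewrite tcoef_tensXn ltn_eqF ?tens0 ?gt_act0l //.
by rewrite (leq_trans (ltn_ord i)).
Qed.

Lemma fs_act_homog2 a b r s (f : filt_sum) n :
  fs_act (a ⊗ 'X^s) (fs_act (b ⊗ 'X^r) f) n =
  if (s + r <= n)%N then
    gt_act (a ⊗ 'X^s) (gt_act (b ⊗ 'X^r) (f (n - (s + r))%N)) else 0.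
Proof.
rewrite fs_act_homog; case: (leqP s n) => [lsn|lns]; last first.
  by rewrite leqNgt (leq_trans lns) ?leq_addr.
rewrite fs_act_homog leq_subRL // -subnDA.
by case: leqP => // _; rewrite linear0.
Qed.

Lemma gr_act_bracket x y q :
  gr_act (bracket x y) q = gr_act x (gr_act y q) - gr_act y (gr_act x q).
Proof.
have A0 u : gr_act 0 u = 0.
  by have := gr_act_linearl u (-1) 0 0; rewrite scaler0 addr0 scaleN1r addNr.
have AD x1 x2 u : gr_act (x1 + x2) u = gr_act x1 u + gr_act x2 u.
  by have := gr_act_linearl u 1 x1 x2; rewrite !scale1r.
elim/(@cur_ind K): x => [|a s|x1 x2 IH1 IH2].
- have -> : bracket 0 y = 0.
    have := bracket_linl y (-1) 0 0.
    by rewrite scaler0 addr0 scaleN1r addNr.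
  by rewrite !A0 linear0 subrr.
- elim/(@cur_ind K): y => [|b r|y1 y2 IH1 IH2].
  + have -> : bracket (a ⊗ 'X^s) 0 = 0.
      have := bracket_linr (a ⊗ 'X^s) (-1) 0 0.
      by rewrite scaler0 addr0 scaleN1r addNr.
    by rewrite !A0 linear0 subrr.
  + rewrite tens_bracket -exprD; elim/gr_cls_ind: q => f.
    rewrite !gr_actE -scaleN1r addrC -gr_cls_lin.
    apply/gr_clsP/fs_eqW => n.
    rewrite [RHS](_ : _ = -1 *: fs_act (b ⊗ 'X^r) (fs_act (a ⊗ 'X^s) f) n +
      fs_act (a ⊗ 'X^s) (fs_act (b ⊗ 'X^r) f) n) // fs_act_homog !fs_act_homog2.
    rewrite [(r + s)%N]addnC; case: leqP => _; last by rewrite scaler0 addr0.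
    by rewrite exprD -tens_bracket gt_act_bracket scaleN1r addrC.
  + have -> : bracket (a ⊗ 'X^s) (y1 + y2) =
        bracket (a ⊗ 'X^s) y1 + bracket (a ⊗ 'X^s) y2.
      by have := bracket_linr (a ⊗ 'X^s) 1 y1 y2; rewrite !scale1r.
    by rewrite !AD IH1 IH2 linearD opprD addrACA.
- have -> : bracket (x1 + x2) y = bracket x1 y + bracket x2 y.
    by have := bracket_linl y 1 x1 x2; rewrite !scale1r.
  by rewrite !AD IH1 IH2 linearD opprD addrACA.
Qed.

Definition gr_gtmod : gtmod K := Gtmod gr_act_linear gr_act_linearl gr_act_bracket.

Lemma fs_mask_filt (p : pred nat) (f : filt_sum) r : filt r (if p r then f r else 0).
Proof. by case: ifP => _; [apply: fs_filt|apply: filt0]. Qed.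
Lemma fs_mask_fin (p : pred nat) (f : filt_sum) :
  exists n, forall r, (n <= r)%N -> (if p r then f r else 0) = 0.
Proof. by have [n fn] := fs_fin f; exists n => r lr; rewrite fn // if_same. Qed.
Definition fs_mask p f : filt_sum := FiltSum (fs_mask_filt p f) (fs_mask_fin p f).

(* The copy of F^r V / F^(r-1) V inside gr V. *)
Definition gr_grade (r : nat) (q : gr_gtmod) : Prop :=
  exists2 f : filt_sum, (forall s, s <> r -> f s = 0) & q = gr_cls f.

Lemma gr_grade0 s : gr_grade s 0.
Proof. by exists fs_zero. Qed.
Lemma gr_grade_lin s k u v : gr_grade s u -> gr_grade s v -> gr_grade s (k *: u + v).
Proof.
move=> [f f0 ->] [g g0 ->]; exists (fs_lin k f g); last by rewrite gr_cls_lin.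
by move=> r rs /=; rewrite f0 // g0 // scaler0 addr0.
Qed.
Lemma gr_grade_sum q : exists (n : nat) (w : nat -> gr_gtmod),
  (forall s, gr_grade s (w s)) /\ q = \sum_(s < n) w s.
Proof.
elim/gr_cls_ind: q => f; have [n fn] := fs_fin f.
exists n, (fun s => gr_cls (fs_mask (pred1 s) f)); split=> [s|].
  by exists (fs_mask (pred1 s) f) => // r /eqP rs /=; rewrite (negbTE rs).
have -> : gr_cls f = gr_cls (fs_mask (fun r => r < n)%N f).
  by apply/gr_clsP/fs_eqW => r /=; case: ltnP => // /fn.
elim: n {fn} => [|n IH].
  rewrite big_ord0 -[RHS]/(gr_cls fs_zero).
  by apply/gr_clsP/fs_eqW => r.
rewrite big_ord_recr /= -IH addrC -[gr_cls (fs_mask (pred1 n) f)]scale1r -gr_cls_lin.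
apply/gr_clsP/fs_eqW => r /=; rewrite scale1r ltnS leq_eqVlt.
by case: eqP => [->|_]; rewrite ?ltnn ?addr0 ?add0r.
Qed.

Definition gr_proj (r : nat) (q : gr_space) : gr_space :=
  gr_cls (fs_mask (pred1 r) (@rep K fs_setoid q)).

Lemma gr_projE r f : gr_proj r (gr_cls f) = gr_cls (fs_mask (pred1 r) f).
Proof.
apply/gr_clsP => n /=; case: eqP => _; last by rewrite subrr; apply: filt_pred0.
exact: (@rep_cls K fs_setoid f).
Qed.

Lemma gr_proj_linear r : linear (gr_proj r).
Proof.
move=> k; elim/gr_cls_ind=> f; elim/gr_cls_ind=> g.
rewrite -gr_cls_lin !gr_projE -gr_cls_lin; apply/gr_clsP/fs_eqW => n /=.
by case: eqP => //; rewrite scaler0 addr0.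
Qed.
HB.instance Definition _ r := GRing.isLinear.Build K gr_space gr_space *:%R
  (gr_proj r) (gr_proj_linear r).

Lemma gr_proj_grade r s (q : gr_space) :
  gr_grade s q -> gr_proj r q = if s == r then q else 0.
Proof.
move=> [f f0 ->]; rewrite gr_projE; case: eqP => [<-|sr].
  apply/gr_clsP/fs_eqW => n /=; case: eqP => // ns; by rewrite f0.
rewrite -[RHS]/(gr_cls fs_zero); apply/gr_clsP/fs_eqW => n /=.
by case: eqP => // ->; rewrite f0 // => rs; apply: sr.
Qed.

Lemma gr_grade_direct (n : nat) (w : nat -> gr_gtmod) :
  (forall s, gr_grade s (w s)) -> \sum_(s < n) w s = 0 ->
  forall s, (s < n)%N -> w s = 0.
Proof.
move=> gw w0 s ltsn; have : gr_proj s (\sum_(s < n) w s) = 0 by rewrite w0 linear0.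
rewrite linear_sum (bigD1 (Ordinal ltsn)) //= (gr_proj_grade _ (gw s)) eqxx.
rewrite big1 ?addr0 // => i; rewrite -val_eqE /= => /negbTE si.
by rewrite (gr_proj_grade _ (gw i)) si.
Qed.

Lemma gr_grade_act a r s q :
  gr_grade s q -> gr_grade (r + s) (@gt_act K gr_gtmod (a ⊗ 'X^r) q).
Proof.
move=> [f f0 ->]; exists (fs_act (a ⊗ 'X^r) f); last exact: gr_actE.
move=> n nrs; rewrite fs_act_homog; case: leqP => // lrn.
by rewrite f0 ?linear0 // => ns; apply: nrs; rewrite -ns subnKC.
Qed.

Definition assoc_graded : grmod K :=
  Grmod gr_grade0 gr_grade_lin gr_grade_sum gr_grade_direct gr_grade_act.

End AssociatedGraded.

(* The fusion product of the V_k with generators v_k and parameters z_k; for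
   cyclic V_k and pairwise distinct z_k the vector v_1 (x) ... (x) v_m generates
   the tensor product. *)
Definition fusion (m : nat) (z : 'I_m -> K) (V : 'I_m -> gtmod K)
    (v : forall k, V k) : grmod K :=
  @assoc_graded (tensor (fun k => twist (z k) (V k)))
                (pure (V := fun k => twist (z k) (V k)) v).

End Modules.

(* Partitions are non-increasing lists of positive integers. *)
Definition is_partition (xi : seq nat) : bool := sorted geq xi && (0%N \notin xi).

(* The parts are numbered from 1, and are 0 beyond the length. *)
Definition part (xi : seq nat) (j : nat) : nat := nth 0%N xi j.-1.

Definition xi_minus (xi : seq nat) : seq nat :=
  let l := size xi in
  [seq x <- rcons (take (l - 2) xi) (part xi (l - 1) - part xi l)%N | (0 < x)%N].

Definition xi_plus (xi : seq nat) : seq nat :=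
  let l := size xi in
  [seq x <- sort geq (take (l - 2) xi ++
                        [:: (part xi (l - 1) + 1)%N; (part xi l - 1)%N]) | (0 < x)%N].

Definition index_set (xi : seq nat) (i : (size xi).-tuple nat) : Prop :=
  forall k j : nat, (2 <= k <= size xi + 1)%N -> (1 <= j <= k - 1)%N ->
    (j * part i (k - 1) + (j + 1) * part i k
       + 2 * (\sum_(k + 1 <= p < (size xi).+1) part i p)
     <= \sum_(k - j <= p < (size xi).+1) part xi p)%N.

(* (x^- (x) 1)^(i_1) (x^- (x) t)^(i_2) ... (x^- (x) t^(l-1))^(i_l) v_xi *)
Definition basis_elt (K : numFieldType) (xi : seq nat) (i : (size xi).-tuple nat) :
    Vmod K xi :=
  foldr (fun (p : nat) (u : Vmod K xi) =>
           iter (part i p.+1) (gt_act (xm ⊗ 'X^p)) u)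
        (Vgen K xi) (iota 0 (size xi)).

(* Main.v *)
(** Write [f(u)] for the generating series of the [xm ⊗ 'X^p], and [M_r] for
    [sum_j min(xi_j, r)].  Garland's identity turns the relations
    [(xp ⊗ t)^s (xm ⊗ 1)^(s + r) v = 0] of [V(xi)] into the condition that
    [f(u)^r v] is a polynomial in [u] of degree at most [M_r - r], for all [r].

    Upper bound.  Let [w = (xm ⊗ t^(l-1))^(xi_l) v].  A degree count shows that
    the relations of [V(xi^+)] hold modulo the submodule generated by [w]; a
    cluster argument (a series vanishing doubly along each diagonal, of too small
    degree, is zero) shows that [w] satisfies the relations of [V(xi^-)].  As
    [I(xi)] is the disjoint union of [I(xi^+)] and of [I(xi^-)] extended by
    [i_l = xi_l], the monomials indexed by [I(xi)] span [V(xi)], and there are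
    [prod_j (xi_j + 1)] of them.

    Lower bound.  On the tensor product of evaluation modules [f(u)] is a sum of
    terms [F_i / (1 - z_i u)] with [F_i^(xi_i + 1) v = 0], so
    [prod_i (1 - z_i u)^(min(xi_i, r)) f(u)^r v] is a polynomial of degree at most
    [M_r - r].  Hence the fusion product, of dimension [prod_j (xi_j + 1)], is a
    quotient of [V(xi)].  The two bounds agree, so all these maps are
    isomorphisms, and comparing bases gives the exact sequence. *)
Require Import Defs.
From HB Require Import structures.
From mathcomp Require Import all_boot all_order all_algebra.
From mathcomp Require Import boolp reals complex.
From mathcomp Require Import zify ring.

Set Implicit Arguments.
Unset Strict Implicit.
Unset Printing Implicit Defensive.

Import Order.TTheory GRing.Theory Num.Theory.

(** * Partitions and the index set *)

(** The quotient of V(xi) by the submodule generated by [w] is never formed: the upper bound is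
    proved modulo a subspace [N] stable under the operators, and passing to xi^+ only enlarges [N].
    Zero parts are allowed in the lists, so that xi^- and xi^+ keep the lengths l - 1 and l and
    their index sets can be compared with I(xi) entry by entry; zeros are removed and parts
    reordered only at the end, which changes neither |xi| nor the numbers M_r.

    The recursion yields only the inequality |I(xi)| <= prod_j (xi_j + 1) and the spanning property.
    Freeness does not come from a dimension of the associated graded module. The spanning property
    is lifted from gr to the tensor product, whose prod_j (xi_j + 1) coordinate functionals force
    the spanning monomials to be free there; freeness then descends to gr one weight at a time, and
    to V(xi) along the map onto gr.

    Characteristic 0 enters through divisions by integers, in the moment argument and in the scalars
    of Garland's identity. *)

Lemma geq_trans : transitive geq.
Proof. by move=> y x z /= xy yz; apply: leq_trans yz xy. Qed.

Lemma sorted_rcons_geq xi b : sorted geq (rcons xi b) =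
  sorted geq xi && all (geq^~ b) xi.
Proof. by rewrite !(sorted_pairwise geq_trans) pairwise_rcons andbC. Qed.

(** In xi^+ one part [a] becomes [a.+1]. Isolating the block of parts equal to [a] allows the raised
    part to be put in front of this block, where the list stays sorted. *)
Lemma sorted_last_block y a : sorted geq (rcons y a) ->
  exists2 eta, all (ltn a) eta & exists c, y = eta ++ nseq c a.
Proof.
elim/last_ind: y => [|y x IH]; first by exists [::] => //; exists 0.
rewrite sorted_rcons_geq => /andP[syx]; rewrite all_rcons /= => /andP[ax ay].
move: ax; rewrite leq_eqVlt => /orP[/eqP E|ax]; last first.
  exists (rcons y x); last by exists 0; rewrite cats0.
  rewrite all_rcons; apply/andP; split=> //; apply/allP => t ty.
  move: syx; rewrite sorted_rcons_geq => /andP[_ /allP/(_ t ty)] /=.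
  exact: leq_trans ax.
subst x; have [eta ea [c ->]] := IH syx; exists eta => //; exists c.+1.
by rewrite -addn1 nseqD catA cats1.
Qed.

Lemma sorted_minus_plus eta c a b : all (ltn a) eta ->
  sorted geq (rcons (rcons (eta ++ nseq c a) a) b) ->
  sorted geq (rcons (eta ++ nseq c a) (a - b)) /\
  sorted geq (rcons (eta ++ a.+1 :: nseq c a) b.-1).
Proof.
move=> eta_a; rewrite sorted_rcons_geq all_rcons => /andP[sya /andP[/= leba _]].
move: sya; rewrite sorted_rcons_geq => /andP[sy /allP ya].
have seta : sorted geq eta.
  by move: sy; rewrite !(sorted_pairwise geq_trans) pairwise_cat => /and3P[].
have nseq_geq k x : x <= a -> all (geq^~ x) (nseq k a).
  by move=> xa; apply/allP => t; rewrite mem_nseq => /andP[_ /eqP->].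
split.
  rewrite sorted_rcons_geq sy all_cat nseq_geq ?leq_subr // andbT.
  apply/allP => t /(allP eta_a) /=; lia.
have snseq k : sorted geq (nseq k a).
  rewrite (sorted_pairwise geq_trans); elim: k => //= k ->; rewrite andbT.
  by apply/allP => t; rewrite mem_nseq => /andP[_ /eqP->] /=.
rewrite sorted_rcons_geq all_cat /= nseq_geq ?andbT; last by lia.
rewrite (sorted_pairwise geq_trans) pairwise_cat -!(sorted_pairwise geq_trans) seta /=.
rewrite path_sortedE //; last exact: geq_trans.
rewrite snseq andbT; apply/andP; split; [apply/andP; split|].
- apply/allrelP => t u /= te; rewrite inE => /orP[/eqP->|].
    by move/allP: eta_a => /(_ t te).
  by rewrite mem_nseq => /andP[_ /eqP->]; have /= := allP eta_a t te; lia.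
- by apply/allP => t; rewrite mem_nseq => /andP[_ /eqP->] /=.
- apply/andP; split; last by lia.
  by apply/allP => t /(allP eta_a) /=; lia.
Qed.

(* Non-increasing lists, where zero parts are allowed; the step is
   xi^-, xi^+ => xi for xi = (eta, a, ..., a, a, b). *)
Lemma weak_partition_ind (P : seq nat -> Prop) :
  P [::] -> (forall b, P [:: b]) ->
  (forall xi, P xi -> P (rcons xi 0)) ->
  (forall eta c a b, all (ltn a) eta -> 0 < b <= a ->
     P (rcons (eta ++ nseq c a) (a - b)) ->
     P (rcons (eta ++ a.+1 :: nseq c a) b.-1) ->
     P (rcons (rcons (eta ++ nseq c a) a) b)) ->
  forall xi, sorted geq xi -> P xi.
Proof.
(* Lexicographic induction on the length and the last part: xi^- is shorter, while xi^+ has the same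
   length and a smaller last part. *)
move=> P0 P1 Pz Pstep xi; have [n] := ubnP (size xi).
elim: n xi => // n IHn xi ltn; have [m] := ubnP (last 0 xi).
elim: m xi ltn => // m IHm xi; case/lastP: xi => // xi b.
rewrite last_rcons size_rcons !ltnS => ltn lbm.
case: b lbm => [|b] lbm sxi.
  apply: Pz; apply: IHn => //; move: sxi; rewrite sorted_rcons_geq.
  by case/andP.
case/lastP: xi ltn sxi => [_ _|y a]; first exact: P1.
rewrite size_rcons => ltn sxi.
have := sxi; rewrite sorted_rcons_geq all_rcons => /andP[sya /andP[leba _]].
have [eta eta_a [c yE]] := sorted_last_block sya; subst y.
have [sm sp] := sorted_minus_plus eta_a sxi.
apply: Pstep => //; first by apply: IHn; rewrite ?size_rcons.
apply: IHm; rewrite ?last_rcons //.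
by move: ltn; rewrite size_rcons !size_cat /= !size_nseq; lia.
Qed.

(* With parts numbered from [0], the left-hand side of the inequality of [I(xi)]
   for the indices [k + 1] and [j = k - m]. *)
Definition ineq_lhs (i : seq nat) (k m : nat) : nat :=
  (k - m) * nth 0 i k.-1 + (k - m).+1 * nth 0 i k + 2 * sumn (drop k.+1 i).

Definition in_index_set (xi i : seq nat) : Prop :=
  size i = size xi /\
  forall k m, m < k <= size xi -> ineq_lhs i k m <= sumn (drop m xi).

Lemma sumn_drop_rcons s x m :
  sumn (drop m (rcons s x)) = sumn (drop m s) + (m <= size s) * x.
Proof.
case: leqP => le; first by rewrite drop_rcons // -cats1 sumn_cat /= mul1n addn0.
by rewrite !drop_oversize ?size_rcons // ltnW.
Qed.

Lemma sumn_drop_nth s m : sumn (drop m s) = nth 0 s m + sumn (drop m.+1 s).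
Proof.
case: (ltnP m (size s)) => lt; first by rewrite (drop_nth 0 lt).
by rewrite nth_default // !drop_oversize // ltnW.
Qed.

Lemma ineq_lhs_rcons i x k m : k <= (size i).+1 ->
  ineq_lhs (rcons i x) k m =
  if k < size i then ineq_lhs i k m + 2 * x else
  if k == size i then ineq_lhs i k m + (k - m).+1 * x
  else (k - m) * (nth 0 (rcons i x) k.-1).
Proof.
rewrite /ineq_lhs sumn_drop_rcons !nth_rcons => le_k.
case: (ltngtP k (size i)) => [lt|gt|->].
- have -> : k.-1 < size i by lia. lia.
- have Ek : k = (size i).+1 by lia.
  rewrite drop_oversize; last by lia.
  by rewrite /=; lia.
- rewrite [nth 0 i (size i)]nth_default // drop_oversize //=; case E: (size i) => [|n] /=.
    by rewrite nth_default ?E //; lia.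
  by rewrite leqnn; lia.
Qed.

Lemma in_index_set1 b x : x <= b -> in_index_set [:: b] [:: x].
Proof.
move=> xb; split=> // k m /= /andP[mk k1].
have -> : k = 1 by lia. have -> : m = 0 by lia.
by rewrite /ineq_lhs /=; lia.
Qed.

(** For k = l + 1 and j = 1 the inequality of I(xi) reads i_l <= xi_l. *)
Lemma in_index_set_last xi b i x :
  in_index_set (rcons xi b) (rcons i x) -> x <= b.
Proof.
move=> [/eqP]; rewrite !size_rcons eqSS => /eqP szi /(_ (size xi).+1 (size xi)).
rewrite ineq_lhs_rcons szi //.
have -> : ((size xi).+1 < size xi) = false by lia.
have -> : ((size xi).+1 == size xi) = false by lia.
rewrite nth_rcons szi ltnn eqxx sumn_drop_rcons !leqnn drop_size /=.
by move/(_ isT); lia.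
Qed.

Lemma in_index_set_rcons0 xi i :
  in_index_set xi i <-> in_index_set (rcons xi 0) (rcons i 0).
Proof.
split=> [[szi H]|[/eqP]].
  split=> [|k m]; first by rewrite !size_rcons szi.
  rewrite size_rcons => /andP[mk le_k]; rewrite ineq_lhs_rcons ?szi //.
  rewrite sumn_drop_rcons !muln0 !addn0.
  case: ltngtP le_k => // [lt _|gt le|Ek _]; [by apply: H; lia| |by apply: H; lia].
  have -> : k = (size i).+1 by lia.
  by rewrite nth_rcons ltnn eqxx muln0.
rewrite !size_rcons eqSS => /eqP szi H; split=> // k m /andP[mk le_k].
have := H k m; rewrite mk (leqW le_k) ineq_lhs_rcons ?szi ?(leqW le_k) //.
rewrite sumn_drop_rcons !muln0 !addn0.
by case: ltngtP le_k => // _ _; apply.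
Qed.

Lemma sumn_drop_ge (eta : seq nat) a m :
  all (leq a) eta -> (size eta - m) * a <= sumn (drop m eta).
Proof.
elim: eta m => [|x eta IH] [|m] //= /andP[ax al].
  by have := IH 0 al; rewrite drop0 subn0 mulSn; move: ax; lia.
exact: IH.
Qed.

(** For k < n both sides grow by 2b. At k = n the inequalities for all m follow from the one for m =
    n - 1, which says that the last exponent of [i] is at most a - b, because the earlier parts are
    at least [a]; at k = n + 1 they follow from b <= a. *)
Lemma in_index_set_minus eta a b i : b <= a -> all (leq a) eta ->
  in_index_set (rcons eta (a - b)) i <->
  in_index_set (rcons (rcons eta a) b) (rcons i b).
Proof.
move=> ba etaa; pose n := (size eta).+1.
have S m : m <= n -> sumn (drop m (rcons (rcons eta a) b)) =
    sumn (drop m eta) + (m < n) * a + b.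
  by move=> mn; rewrite !sumn_drop_rcons size_rcons mn mul1n.
have S' m : m < n -> sumn (drop m (rcons eta (a - b))) = sumn (drop m eta) + (a - b).
  by move=> mn; rewrite sumn_drop_rcons -ltnS mn mul1n.
have L m : size i = n -> ineq_lhs i n m = (n - m) * nth 0 i n.-1.
  by move=> szi; rewrite /ineq_lhs [nth 0 i n]nth_default ?szi // drop_oversize ?szi //=; lia.
have etas m : (n.-1 - m) * a <= sumn (drop m eta) by exact: sumn_drop_ge.
split=> [[szi H]|[/eqP szi H]].
- have {}szi : size i = n by rewrite szi size_rcons.
  split=> [|k m]; first by rewrite !size_rcons szi.
  rewrite !size_rcons -/n => /andP[mk le_k].
  rewrite ineq_lhs_rcons ?szi // S; last by lia.
  have last_i : nth 0 i n.-1 <= a - b.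
    have := H n n.-1; rewrite size_rcons !leqnn L // S' ?leqnn //.
    rewrite drop_size /n /=; move/(_ isT); lia.
  have := etas m; case: ltngtP le_k => // [lt _|gt le|E _].
  + have := H k m; rewrite size_rcons mk S' /=; last by lia.
    move/(_ (ltnW lt)); have -> : m < n by lia. lia.
  + have Ek : k = n.+1 by lia. subst k; rewrite nth_rcons szi ltnn eqxx.
    case: (ltnP m n) => mn etam.
      have -> : n.+1 - m = (n.-1 - m).+2 by move: mn; rewrite /n; lia.
      by move: etam; move: (n.-1 - m) (sumn _) => d T; nia.
    have -> : m = n by lia.
    by rewrite subSnn; lia.
  + subst k; rewrite L // mk mul1n.
    have -> : n - m = (n.-1 - m).+1 by rewrite /n; lia.
    by move: last_i; nia.
- have {}szi : size i = n by move: szi; rewrite !size_rcons eqSS => /eqP.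
  split=> [|k m]; first by rewrite size_rcons szi.
  rewrite !size_rcons -/n => /andP[mk le_k]; rewrite S'; last by lia.
  have le_k' := leqW le_k.
  have := H k m; rewrite !size_rcons -/n mk le_k' ineq_lhs_rcons ?szi //.
  move=> /(_ isT); rewrite S; last by lia.
  have -> : m < n by lia.
  case: ltngtP le_k => // [_ _|E _ _]; first by lia.
  subst k; rewrite L //.
  have := H n n.-1; rewrite !size_rcons -/n leqnn leqnSn ineq_lhs_rcons ?szi ?leqnSn //.
  move/(_ isT); rewrite ltnn eqxx L // S ?leq_pred // leqnn drop_size /=.
  have := etas m.
  have -> : n - m = (n.-1 - m).+1 by rewrite /n; lia.
  by rewrite /n /= subSnn; nia.
Qed.

Lemma rcons_block eta c a : rcons (eta ++ nseq c a) a = eta ++ a :: nseq c a :> seq nat.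
Proof. by rewrite -cats1 -catA -[[:: a]]/(nseq 1 a) -nseqD addn1. Qed.

Lemma sumn_drop_block eta c a x y m :
  sumn (drop m (rcons (eta ++ x :: nseq c a) y)) =
  if m <= size eta then sumn (drop m eta) + x + c * a + y
  else if m <= size eta + c.+1 then (size eta + c.+1 - m) * a + y else 0.
Proof.
have dn k : drop k (nseq c a) = nseq (c - k) a.
  by elim: c k => [|c IH] [|k] //=; rewrite IH.
rewrite sumn_drop_rcons size_cat /= size_nseq drop_cat.
case: ltngtP => [lt|gt|->].
- have -> : m <= size eta + c.+1 by lia.
  by rewrite sumn_cat /= sumn_nseq mul1n; lia.
- have -> : m - size eta = (m - size eta).-1.+1 by lia.
  rewrite /= dn sumn_nseq; case: leqP => le.
    have -> : size eta + c.+1 - m = c - (m - size eta).-1 by lia.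
    by rewrite mul1n mulnC.
  have -> : c - (m - size eta).-1 = 0 by lia.
  by rewrite muln0.
- by rewrite subnn drop_size leq_addr /= sumn_nseq mul1n; lia.
Qed.

(** * Comparison of I(xi) with I(xi^+) *)

Section IndexSetPlus.
Variables (eta : seq nat) (c a b : nat).
Hypothesis b_range : 0 < b <= a.
Let xi := rcons (rcons (eta ++ nseq c a) a) b.
Let xip := rcons (eta ++ a.+1 :: nseq c a) b.-1.
Let n := size eta + c.+1.

(** The tail sums of xi^+ equal those of xi up to the raised part and are smaller by one between it
    and the end. *)
Lemma in_index_set_plus i : in_index_set xip i -> in_index_set xi i.
Proof.
rewrite /in_index_set /xi rcons_block !size_rcons !size_cat /=.
move=> [szi H]; split=> // k m mk; apply: leq_trans (H k m mk) _.
rewrite !sumn_drop_block; case: ifP => _; first by lia.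
by case: ifP => _; lia.
Qed.

Lemma ineq_lhs_prev i k m : 0 < m < k ->
  ineq_lhs i k m.-1 = ineq_lhs i k m + nth 0 i k.-1 + nth 0 i k.
Proof.
move=> mk; rewrite /ineq_lhs (_ : k - m.-1 = (k - m).+1); last by lia.
by rewrite !mulSn; lia.
Qed.

Lemma ineq_lhs_diag i k m : m < k ->
  ineq_lhs i k m =
  (k - m).-1 * (nth 0 i k.-1 + nth 0 i k) + nth 0 i k.-1 + nth 0 i k + ineq_lhs i k.+1 k.
Proof.
move=> mk; rewrite /ineq_lhs subSnn /= (sumn_drop_nth i k.+1).
have [d ->] : exists d, k - m = d.+1 by exists (k - m).-1; lia.
by rewrite /= !mulSn mulnDr; lia.
Qed.

(* Equality at [(k, m)] would force equality at [(k + 1, k)], and so on up to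
   [k = l + 1], where it would say that the last exponent is at least [b]. *)
Lemma ineq_lhs_strict i x : in_index_set xi (rcons i x) -> x < b ->
  forall k m, size eta < m < k -> k <= n.+1 ->
  ineq_lhs (rcons i x) k m < (n - m) * a + b.
Proof.
rewrite /in_index_set /xi rcons_block !size_rcons !size_cat /= size_nseq -/n.
move=> [[szi] H] xb k m mk le_k.
have [d Ed] : exists d, (k + d = n.+1)%N by exists (n.+1 - k); lia.
elim: d k m mk le_k Ed => [|d IH] k m mk le_k Ed.
  have -> : k = n.+1 by lia.
  rewrite ineq_lhs_rcons ?szi //.
  have -> : (n.+1 < n) = false by lia.
  have -> : (n.+1 == n) = false by lia.
  rewrite nth_rcons szi ltnn eqxx.
  have -> : n.+1 - m = (n - m).+1 by lia.
  by move: b_range xb; nia.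
rewrite ltnNge; apply/negP => ge.
have lt_diag : ineq_lhs (rcons i x) k.+1 k < (n - k) * a + b by apply: IH; lia.
(* As [size eta <= m.-1], the part at position [m.-1] is [a]; this is where the block of equal parts
   matters. *)
have : ineq_lhs (rcons i x) k m.-1 <= (n - m).+1 * a + b.
  have := H k m.-1; rewrite sumn_drop_block -/n => /(_ ltac:(lia)) le_prev.
  apply: leq_trans le_prev _; case: ifP => le1.
    by rewrite drop_oversize /=; [rewrite (_ : n - m = c)|]; lia.
  case: ifP => _ //; have -> : n - m.-1 = (n - m).+1 by lia.
  exact: leqnn.
rewrite ineq_lhs_prev; last by lia.
move: ge; rewrite ineq_lhs_diag; last by lia.
set p := nth _ _ _; set q := nth _ _ _ => ge le_prev.
(* The left-hand side grows by p + q from m to m - 1, the bound only by [a]. The left-hand side at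
   (k, m) is the one at (k + 1, k) plus k - m copies of p + q, so the strict bound at (k + 1, k)
   contradicts [ge]. *)
have pq : p + q <= a by lia.
have := leq_mul (leqnn (k - m).-1) pq.
have En : n - m = (k - m).-1 + (n - k).+1 by lia.
by move: ge lt_diag; rewrite En mulnDl mulSn; move: (_ * a) ((n - k) * a); lia.
Qed.

(** Beyond position [size eta] the tail sums of xi^+ are smaller by one, which strictness
    compensates. *)
Lemma in_index_set_plus_lt i x : x < b ->
  in_index_set xi (rcons i x) -> in_index_set xip (rcons i x).
Proof.
move=> xb Hi; have strict := ineq_lhs_strict Hi xb.
move: Hi; rewrite /in_index_set /xi /xip rcons_block !size_rcons !size_cat /= size_nseq.
move=> [szi H]; split=> // k m mk.
have := H k m mk; rewrite !sumn_drop_block.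
case: (leqP m (size eta)) => [_|lt]; first by lia.
case: (leqP m (size eta + c.+1)) => le //; have := strict k m; rewrite -/n.
by move: mk; rewrite -/n => mk /(_ ltac:(lia) ltac:(lia)); lia.
Qed.
End IndexSetPlus.

Definition dim_prod (xi : seq nat) : nat := \prod_(x <- xi) x.+1.

(** The bound satisfies the same recursion as the index sets, since (a + 1)(b + 1) = (a - b + 1) +
    (a + 2) b. An upper bound is enough: the tensor product supplies the opposite one. *)
Lemma index_set_enum xi : sorted geq xi -> exists2 E : seq (seq nat),
  forall i, in_index_set xi i -> i \in E & size E <= dim_prod xi.
Proof.
move: xi; apply: weak_partition_ind.
- exists [:: [::]]; last by rewrite /dim_prod big_nil.
  by case=> [|x i] [].
- move=> b; exists [seq [:: x] | x <- iota 0 b.+1].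
    move=> i Hi; case: i Hi => [|x [|y i]] [] // Hs H.
    apply: map_f; rewrite mem_iota add0n ltnS.
    exact: (@in_index_set_last [::] b [::] x).
  by rewrite /dim_prod big_seq1 size_map size_iota.
- move=> xi [E HE sE]; exists [seq rcons i 0 | i <- E].
    move=> i; case/lastP: i => [|i x] Hi.
      by case: Hi; rewrite size_rcons.
    have x0 : x = 0 by have := in_index_set_last Hi; case: (x).
    subst x; apply: map_f; apply: HE; exact/in_index_set_rcons0.
  by rewrite size_map /dim_prod -cats1 big_cat big_seq1 /= muln1.
- move=> eta c a b eta_a b_range [E1 HE1 sE1] [E2 HE2 sE2].
  exists ([seq rcons i b | i <- E1] ++ E2).
    move=> i; case/lastP: i => [|i x] Hi; first by case: Hi; rewrite size_rcons.
    rewrite mem_cat; have := in_index_set_last Hi.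
    rewrite leq_eqVlt => /orP[/eqP xb|xb].
      subst x; apply/orP; left; apply: map_f; apply: HE1.
      apply/in_index_set_minus => //.
        by case/andP: b_range.
      rewrite all_cat; apply/andP; split; apply/allP => t.
        by move/(allP eta_a); apply: ltnW.
      by rewrite mem_nseq => /andP[_ /eqP->] /=.
    by rewrite HE2 ?orbT //; apply: in_index_set_plus_lt.
  rewrite size_cat size_map (leq_trans (leq_add sE1 sE2)) // rcons_block.
  rewrite /dim_prod -!cats1 !big_cat !big_cons /= !big_nil.
  set P := \prod_(_ <- eta) _; set Q := \prod_(_ <- nseq _ _) _.
  have [d Ed] : exists d, a = d + b by exists (a - b); lia.
  have -> : (a - b).+1 = d.+1 by lia.
  have -> : b.-1.+1 = b by lia.
  by rewrite Ed; nia.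
Qed.

Local Open Scope ring_scope.

(** * Powers of a formal current of commuting operators *)

Lemma sum_triangle (V : nmodType) (s : nat) (G : nat -> nat -> V) :
  \sum_(p < s.+1) \sum_(q < (s - p).+1) G p q =
  \sum_(q < s.+1) \sum_(p < (s - q).+1) G p q.
Proof.
pose H p q := if (p + q <= s)%N then G p q else 0.
have E (F : nat -> nat -> V) :
    \sum_(p < s.+1) \sum_(q < (s - p).+1) F p q =
    \sum_(p < s.+1) \sum_(q < s.+1) (if (p + q <= s)%N then F p q else 0).
  apply: eq_bigr => p _.
  rewrite -[RHS](big_mkord xpredT (fun q => if (p + q <= s)%N then F p q else 0)).
  rewrite (big_cat_nat (n := (s - p).+1)) //=; last by rewrite ltnS leq_subr.
  rewrite [X in _ = _ + X]big_nat_cond [X in _ = _ + X]big1 => [|i]; last first.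
    by rewrite andbT => /andP[ple _]; case: leqP => //; lia.
  rewrite addr0 big_mkord; apply: eq_bigr => q _; rewrite ifT //.
  by have := ltn_ord q; have := ltn_ord p; lia.
rewrite E (E (fun q p => G p q)) exchange_big; apply: eq_bigr => q _.
by apply: eq_bigr => p _; rewrite addnC.
Qed.

Section CommutingOperators.
Variables (K : numFieldType) (V : lmodType K) (f : nat -> {linear V -> V}).
Hypothesis fC : forall p q u, f p (f q u) = f q (f p u).

(* The coefficient of [u^s] in [(sum_p f p u^p)^r]. *)
Fixpoint powc (r s : nat) (u : V) : V :=
  if r is r'.+1 then \sum_(p < s.+1) f p (powc r' (s - p) u)
  else (s == 0%N)%:R *: u.

#[global] Arguments powc : simpl never.

Lemma powc0 s u : powc 0 s u = (s == 0%N)%:R *: u.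
Proof. by []. Qed.

Lemma powcS r s u : powc r.+1 s u = \sum_(p < s.+1) f p (powc r (s - p) u).
Proof. by []. Qed.

Lemma powc_f r s p u : powc r s (f p u) = f p (powc r s u).
Proof.
elim: r s => [|r IH] s; first by rewrite !powc0 linearZ.
by rewrite !powcS linear_sum; apply: eq_bigr => q _; rewrite IH fC.
Qed.

Lemma powc_linear r s : linear (powc r s).
Proof.
move=> k u w; elim: r s => [|r IH] s.
  by rewrite !powc0 scalerDr !scalerA mulrC.
rewrite !powcS scaler_sumr -big_split /=; apply: eq_bigr => p _.
by rewrite IH linearP.
Qed.

Lemma powc1 s u : powc 1%N s u = f s u.
Proof.
rewrite powcS big_ord_recr /= subnn powc0 scale1r big1 ?add0r // => i _.
by rewrite powc0 subn_eq0 leqNgt ltn_ord scale0r linear0.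
Qed.

(* The coefficient form of [r f^(r-1) f' = (f^r)']. *)
Lemma powc_moment r s u :
  r.+1%:R *: (\sum_(p < s.+1) p%:R *: f p (powc r (s - p) u)) =
  s%:R *: powc r.+1 s u.
Proof.
elim: r s => [|r IH] s.
  rewrite scale1r powc1 big_ord_recr /= subnn powc0 scale1r big1 ?add0r // => i _.
  by rewrite powc0 subn_eq0 leqNgt ltn_ord scale0r linear0 scaler0.
have E : \sum_(p < s.+1) p%:R *: f p (powc r.+1 (s - p) u) =
    \sum_(q < s.+1) f q (\sum_(p < (s - q).+1) p%:R *: f p (powc r (s - q - p) u)).
  pose G p q := p%:R *: f p (f q (powc r (s - p - q) u)).
  transitivity (\sum_(p < s.+1) \sum_(q < (s - p).+1) G p q).
    by apply: eq_bigr => p _; rewrite powcS linear_sum scaler_sumr.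
  rewrite sum_triangle; apply: eq_bigr => q _; rewrite linear_sum.
  by apply: eq_bigr => p _; rewrite linearZ /= fC /G subnAC.
rewrite -[r.+2%:R]natr1 scalerDl scale1r {1}E scaler_sumr.
under eq_bigr => q _ do rewrite -linearZ /= IH linearZ /=.
rewrite -big_split /= powcS scaler_sumr; apply: eq_bigr => q _.
rewrite -scalerDl -natrD subnK //; by rewrite -ltnS.
Qed.

Definition subspace (N : V -> Prop) : Prop :=
  N 0 /\ forall k u w, N u -> N w -> N (k *: u + w).

Definition stable (N : V -> Prop) : Prop := forall p u, N u -> N (f p u).

Section Subspace.
Variable N : V -> Prop.
Hypothesis Nsub : subspace N.

Lemma subspD u w : N u -> N w -> N (u + w).
Proof. by move=> Nu Nw; rewrite -[u]scale1r; apply: Nsub.2. Qed.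
Lemma subspZ k u : N u -> N (k *: u).
Proof. by move=> Nu; rewrite -[_ *: _]addr0; apply: Nsub.2 => //; apply: Nsub.1. Qed.
Lemma subspB u w : N u -> N w -> N (u - w).
Proof. by move=> Nu Nw; rewrite -scaleN1r addrC; apply: Nsub.2. Qed.
Lemma subsp_sum (I : Type) (r : seq I) (P : pred I) (F : I -> V) :
  (forall i, P i -> N (F i)) -> N (\sum_(i <- r | P i) F i).
Proof.
by move=> NF; elim/big_ind: _ => //; [exact: Nsub.1|exact: subspD].
Qed.

End Subspace.

Lemma stable_powc N r s u : subspace N -> stable N -> N u -> N (powc r s u).
Proof.
move=> Nsub Nst Nu; elim: r s => [|r IH] s; first exact: subspZ.
by rewrite powcS; apply: subsp_sum => // p _; apply: Nst.
Qed.

Definition fword (q : seq nat) (u : V) : V := foldr (fun p => f p) u q.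

Lemma fword_cat q1 q2 u : fword (q1 ++ q2) u = fword q1 (fword q2 u).
Proof. by rewrite /fword foldr_cat. Qed.

Lemma fword_f q p u : fword q (f p u) = f p (fword q u).
Proof. by elim: q => //= p' q ->; rewrite fC. Qed.

Lemma stable_fword N q u : stable N -> N u -> N (fword q u).
Proof. by move=> Nst Nu; elim: q => //= p q; apply: Nst. Qed.

Lemma iter_fC n p q u : iter n (f p) (f q u) = f q (iter n (f p) u).
Proof. by elim: n => //= n ->; rewrite fC. Qed.

Lemma powc_fword r s q u : powc r s (fword q u) = fword q (powc r s u).
Proof. by elim: q => //= p q <-; rewrite powc_f. Qed.

Definition minsum (xi : seq nat) (r : nat) : nat := \sum_(x <- xi) minn x r.

(** [N] is to be read as the zero of a quotient. The degree bound s > M_r - r is written without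
    subtraction, which would be truncated. *)
Definition pow_rel (xi : seq nat) (N : V -> Prop) (w : V) : Prop :=
  forall r s, (minsum xi r < s + r)%N -> N (powc r s w).

Lemma minsum1 xi : (minsum xi 1 <= size xi)%N.
Proof.
rewrite /minsum -sum1_size; apply: leq_sum => x _; exact: geq_minr.
Qed.

Lemma pow_rel_large xi N w p : pow_rel xi N w -> (size xi <= p)%N -> N (f p w).
Proof.
by move=> R le; rewrite -powc1; apply: R; have := minsum1 xi; lia.
Qed.

Lemma minsum_rcons2 eta a b r :
  minsum (rcons (rcons eta a) b) r = (minsum eta r + minn a r + minn b r)%N.
Proof. by rewrite /minsum -!cats1 !big_cat !big_seq1. Qed.
Lemma minsum_rcons eta a r : minsum (rcons eta a) r = (minsum eta r + minn a r)%N.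
Proof. by rewrite /minsum -!cats1 !big_cat !big_seq1. Qed.

Lemma minsum_add eta n c : (minsum eta (n + c) <= minsum eta n + size eta * c)%N.
Proof.
rewrite /minsum; elim: eta => [|x eta IH]; first by rewrite !big_nil.
rewrite !big_cons /= mulSn; move: IH; lia.
Qed.

(** * The cluster argument: [w] satisfies the relations of xi^- *)

Section Cluster.
Variables (eta : seq nat) (a b : nat) (N : V -> Prop) (w : V).
Hypotheses (Nsub : subspace N) (Nst : stable N) (leba : (b <= a)%N).
Let l := (size eta).+2.
Hypothesis Nrel : pow_rel (rcons (rcons eta a) b) N w.

(* The 0-th and first moments in the index [p] lie in [N]; together they
   determine the terms with [p = l - 1] and [p = l - 2] from the others. *)
Lemma two_moments i t u :
  N (powc i.+1 t u) ->
  (forall p, (l <= p)%N -> N (f p u)) ->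
  (forall p s, (p.+2 < l)%N -> (s + p = t)%N -> N (powc i s (f p u))) ->
  forall p s, (s + p = t)%N -> N (powc i s (f p u)).
Proof.
move=> N0 Nl Nsmall.
(* Extending by 0 beyond [t] lets the sums run far enough to contain the indices l - 2 = [size eta]
   and l - 1, even when [t] is small. *)
pose Z p := if (p <= t)%N then powc i (t - p) (f p u) else 0.
have Zsum (c : nat -> K) : \sum_(p < t.+1) c p *: f p (powc i (t - p) u) =
    \sum_(p < maxn t.+1 l) c p *: Z p.
  rewrite -[RHS](big_mkord xpredT (fun p => c p *: Z p)).
  rewrite (big_cat_nat (n := t.+1)) //= ?leq_maxl //.
  rewrite [X in _ = _ + X]big_nat [X in _ = _ + X]big1 ?addr0; last first.
    by move=> p /andP[lp _]; rewrite /Z leqNgt lp scaler0.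
  rewrite big_mkord; apply: eq_bigr => p _.
  by rewrite /Z -ltnS ltn_ord powc_f.
have NZ p : (p.+2 < l)%N || (l <= p)%N -> N (Z p).
  rewrite /Z; case: (leqP p t) => [pt|_ _]; last exact: Nsub.1.
  case/orP=> [ps|pl]; first by apply: Nsmall => //; rewrite subnK.
  by apply: stable_powc => //; apply: Nl.
have split (c : nat -> K) : N (\sum_(p < maxn t.+1 l) c p *: Z p) ->
    N (c (size eta) *: Z (size eta) + c (size eta).+1 *: Z (size eta).+1).
  rewrite -(big_mkord xpredT (fun p => c p *: Z p)).
  rewrite (big_cat_nat (n := size eta)) //=; last by rewrite leq_max /l; lia.
  rewrite big_nat [X in _ + X](big_cat_nat (n := l)) /l /= ?leq_maxr //; last by lia.
  rewrite [X in _ + (X + _)](_ : _ = c (size eta) *: Z (size eta) +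
      c (size eta).+1 *: Z (size eta).+1); last first.
    by rewrite big_ltn // big_ltn // big_geq // addr0.
  set A := \sum_(_ <= _ < _ | _) _; set B := \sum_(_ <= _ < _) _.
  set C := _ *: Z _ + _ *: Z _.+1 => NABC.
  have NA : N A.
    apply: (subsp_sum Nsub) => p /= ps; apply: (subspZ Nsub); apply: NZ.
    by rewrite /l !ltnS ps.
  have NB : N B.
    rewrite /B big_nat; apply: (subsp_sum Nsub) => p /andP[ps _].
    by apply: (subspZ Nsub); apply: NZ; rewrite /l ps orbT.
  rewrite (_ : C = A + (C + B) - A - B); last by rewrite [A + _]addrC !addrK.
  by do 2 apply: (subspB Nsub) => //.
have S0 : N (Z (size eta) + Z (size eta).+1).
  have := split (fun=> 1); rewrite !scale1r; apply; rewrite -(Zsum (fun=> 1)).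
  by under eq_bigr => p _ do rewrite scale1r.
(* By [powc_moment] the first moment is t / (i + 1) times [powc i.+1 t u]. *)
have S1 : N ((size eta)%:R *: Z (size eta) + (size eta).+1%:R *: Z (size eta).+1).
  apply: (split (fun p => p%:R)); rewrite -(Zsum (fun p => p%:R)).
  have /(congr1 (fun x => i.+1%:R^-1 *: x)) := powc_moment i t u.
  rewrite scalerA mulVf ?pnatr_eq0 // scale1r => ->.
  by rewrite scalerA; apply: (subspZ Nsub).
(* The first moment minus [size eta] times the 0-th one leaves this term with coefficient 1. *)
have NZ1 : N (Z (size eta).+1).
  rewrite (_ : Z _ = ((size eta)%:R *: Z (size eta) +
     (size eta).+1%:R *: Z (size eta).+1) - (size eta)%:R *:
     (Z (size eta) + Z (size eta).+1)); last first.
    by rewrite scalerDr -natr1 scalerDl scale1r addrA [RHS]addrAC subrr add0r.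
  by apply: (subspB Nsub) => //; apply: (subspZ Nsub).
have NZ0 : N (Z (size eta)).
  by rewrite -[Z _](addrK (Z (size eta).+1)); apply: (subspB Nsub).
move=> p s ts.
have NZp : N (Z p).
  have [ps|pl] := ltnP p.+2 l; first by apply: NZ; rewrite ps.
  have [pl'|pl'] := leqP l p; first by apply: NZ; rewrite pl' orbT.
  have [->//|ne] := eqVneq p (size eta).
  by rewrite (_ : p = (size eta).+1) //; move: pl pl' ne; rewrite /l; lia.
by move: NZp; rewrite /Z -ts leq_addl addnK.
Qed.

(* Downward induction on the number [n + b - d] of equal variables, the [d] other
   ones being free; in [gen] those of index at most [l - 3] are collected in [q2]. *)
Lemma pow_rel_cluster : pow_rel (rcons eta (a - b)%N) N (iter b (f l.-1) w).
Proof.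
move=> n s; rewrite minsum_rcons => lt_s.
have Nlarge p q : (l <= p)%N -> N (f p (fword q w)).
  move=> lp; rewrite -fword_f; apply: stable_fword => //.
  by apply: (pow_rel_large Nrel); rewrite !size_rcons.
(* The threshold [s + l.-1 * b] is the total degree of the target: it is attained for d = b, t = s
   and all free indices equal to l - 1. *)
have step d : (d <= b)%N -> forall q t, size q = d ->
    (s + l.-1 * b <= t + sumn q)%N -> N (powc (n + b - d) t (fword q w)).
  elim: d => [_ [|//] t _|d IHd ltdb q t szq le_t].
    rewrite addn0 subn0 => le_t; apply: Nrel; rewrite minsum_rcons2.
    have := minsum_add eta n b; rewrite mulnC; move: lt_s le_t; rewrite /l /=.
    by nia.
  suff gen q1 q2 u : (size q1 + size q2 = d.+1)%N -> all (fun p => p.+2 < l)%N q2 ->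
      (s + l.-1 * b <= u + (sumn q1 + sumn q2))%N ->
      N (powc (n + b - d.+1) u (fword (q1 ++ q2) w)).
    by rewrite -[q]cats0; apply: gen; rewrite //= ?addn0.
  elim: q1 q2 u => [|p q1 IHq] q2 u.
    rewrite add0n => szq2 small le_u; rewrite powc_fword.
    apply: stable_fword => //; apply: Nrel; rewrite minsum_rcons2.
    (* With d + 1 free indices of size at most l - 3 and x = b - d - 1, the equal variables carry
       degree at least s + (l - 1) x + 2 (d + 1), which exceeds the bound in the relation of xi for
       the power n + x. *)
    have Hsum : (sumn q2 + 3 * size q2 <= l * size q2)%N.
      elim: (q2) small {szq2 le_u} => //= x r IH /andP[ltx /IH].
      by move: ltx; nia.
    pose x := (b - d.+1)%N; have Eb : b = (x + d.+1)%N by rewrite /x; lia.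
    have := minsum_add eta n x; rewrite (_ : n + b - d.+1 = n + x)%N; last by lia.
    move: Hsum le_u; rewrite szq2 /l /= Eb mulnDr !mulSn; move: lt_s leba; rewrite Eb.
    by move: (size eta * d.+1)%N (size eta * x)%N => A B; lia.
  rewrite /= addSn => -[szq1] small le_u.
  (* The free index [p] varies with [u + p] fixed. Its 0-th moment absorbs it into the equal
     variables and is covered by [IHd]; an index below l - 2 moves to [q2] and is covered by
     [IHq]. *)
  apply: (@two_moments _ (u + p)) => //.
  - rewrite subnSK; last by lia.
    apply: IHd; rewrite ?(ltnW ltdb) ?size_cat ?sumn_cat //.
    by move: le_u; lia.
  - by move=> p' lp; apply: Nlarge.
  move=> p' u' small' up'.
  have -> : f p' (fword (q1 ++ q2) w) = fword (q1 ++ p' :: q2) w.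
    by rewrite !fword_cat /= fword_f.
  by apply: IHq; rewrite /= ?small' //; lia.
have := step b (leqnn b) (nseq b l.-1) s.
rewrite addnK size_nseq sumn_nseq => /(_ erefl (leqnn _)).
suff -> : fword (nseq b l.-1) w = iter b (f l.-1) w by [].
by elim: (b) => //= k ->.
Qed.
End Cluster.

(* In a monomial of degree [r] and weight at least [e r + b] in the operators
   [f p], [p <= e.+1], the top operator occurs at least [b] times. *)
Lemma powc_top N e b w r s : subspace N -> stable N ->
  (forall p, (e.+2 <= p)%N -> N (f p w)) -> N (iter b (f e.+1) w) ->
  (e * r + b <= s)%N -> N (powc r s w).
Proof.
move=> Nsub Nst Nlarge Nb.
(* [c] counts the copies of the top operator already taken out of the power. *)
suff gen c : (e * r + b <= s + c)%N -> N (powc r s (iter c (f e.+1) w)).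
  by move=> le_s; apply: (gen 0); rewrite addn0.
elim: r s c => [|r IH] s c le_s.
  rewrite powc0; case: s le_s => [|s] le_s; last by rewrite scale0r; apply: Nsub.1.
  apply: (subspZ Nsub); have -> : c = (c - b + b)%N by lia.
  by rewrite iterD; elim: (c - b)%N => //= k; apply: Nst.
rewrite powcS; apply: (subsp_sum Nsub) => p _; have := ltn_ord p.
case: (ltngtP p e.+1) => [lp|lp|->] ps; last first.
- by rewrite -powc_f -iterS; apply: IH; lia.
- rewrite -powc_f -iter_fC; apply: stable_powc => //.
  by elim: c {le_s} => [|c] /=; [apply: Nlarge|apply: Nst].
- by apply: Nst; apply: IH; lia.
Qed.

Definition fmon (i : seq nat) (u : V) : V :=
  foldr (fun p u => iter (nth 0%N i p) (f p) u) u (iota 0 (size i)).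

Lemma fmon_rcons i x u : fmon (rcons i x) u = fmon i (iter x (f (size i)) u).
Proof.
rewrite /fmon size_rcons -addn1 iotaD add0n foldr_cat /= nth_rcons ltnn eqxx.
have : all (fun p => p < size i)%N (iota 0 (size i)).
  by apply/allP => p; rewrite mem_iota.
elim: (iota 0 _) => //= p r IH /andP[lp /IH ->].
by rewrite nth_rcons lp.
Qed.

End CommutingOperators.

Lemma minsum_full eta r : all (leq r) eta -> minsum eta r = (size eta * r)%N.
Proof.
rewrite /minsum; elim: eta => [|x eta IH] /=; first by rewrite big_nil.
by case/andP=> rx /IH; rewrite big_cons mulSn => ->; rewrite (minn_idPr rx).
Qed.

Lemma minsum_plus eta c a b r :
  minsum (rcons (eta ++ a.+1 :: nseq c a) b.-1) r =
  (minsum (eta ++ nseq c a) r + minn a.+1 r + minn b.-1 r)%N.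
Proof.
rewrite minsum_rcons /minsum !big_cat big_cons /=.
by move: (minn a.+1 r) => x; lia.
Qed.

(** * Spanning by the monomials of I(xi) *)

Section Span.
Variables (K : numFieldType) (V : lmodType K) (f : nat -> {linear V -> V}).
Hypothesis fC : forall p q u, f p (f q u) = f q (f p u).

Lemma powc_n0 n u : powc f n 0 u = iter n (f 0%N) u.
Proof.
elim: n => [|n IH]; first by rewrite powc0 scale1r.
by rewrite powcS big_ord_recl big_ord0 addr0 IH.
Qed.

Lemma fword_large q p N w : stable f N -> p \in q -> N (f p w) -> N (fword f q w).
Proof.
move=> Nst + Np; elim: q => //= x q IH; rewrite inE => /orP[/eqP<-|/IH]; last first.
  exact: Nst.
by rewrite -fword_f //; apply: stable_fword.
Qed.

(** The form with arbitrary [N] and [Q] is what the induction needs. The case of xi^- is applied to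
    the vector [w'] with the same [N], that of xi^+ to the same [w] with [N] enlarged by what [w']
    generates; [Q] absorbs this enlargement because the first case has been settled. *)
Lemma index_set_span xi : sorted geq xi -> forall N w Q,
  subspace N -> stable f N -> pow_rel f xi N w ->
  subspace Q -> (forall u, N u -> Q u) ->
  (forall i, in_index_set xi i -> Q (fmon f i w)) ->
  forall q, Q (fword f q w).
Proof.
move: xi; apply: weak_partition_ind.
- move=> N w Q Nsub Nst Nrel Qsub NQ Qm [|p q]; first by apply: (Qm [::]); split=> // k m /=; lia.
  apply: NQ; apply: (@fword_large _ p) => //; first exact: mem_head.
  exact: (pow_rel_large Nrel).
- move=> b N w Q Nsub Nst Nrel Qsub NQ Qm q.
  have [/hasP[p qp p0]|] := boolP (has (leq 1) q).
    by apply: NQ; apply: (@fword_large _ p) => //; apply: (pow_rel_large Nrel).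
  rewrite -all_predC => q0.
  have -> : fword f q w = iter (size q) (f 0%N) w.
    by elim: q q0 => //= p q IH /andP[+ /IH ->]; rewrite -leqNgt leqn0 => /eqP->.
  case: (leqP (size q) b) => [le|lt]; first exact: (Qm [:: size q] (in_index_set1 le)).
  by rewrite -powc_n0; apply/NQ/Nrel; rewrite /minsum big_seq1; lia.
- move=> xi IH N w Q Nsub Nst Nrel Qsub NQ Qm; apply: (IH N) => //.
    by move=> r s lt; apply: Nrel; rewrite minsum_rcons min0n addn0.
  move=> i Hi; have := Qm (rcons i 0%N); rewrite fmon_rcons; apply.
  exact: (in_index_set_rcons0 xi i).1.
move=> eta c a b eta_a b_range IHm IHp N w Q Nsub Nst Nrel Qsub NQ Qm.
have leba : (b <= a)%N by case/andP: b_range.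
pose eta' := eta ++ nseq c a; pose w' := iter b (f (size eta').+1) w.
have eta'_a : all (leq a) eta'.
  rewrite all_cat; apply/andP; split; apply/allP => t.
    by move/(allP eta_a); apply: ltnW.
  by rewrite mem_nseq => /andP[_ /eqP->] /=.
have Qw' q : Q (fword f q w').
  apply: (IHm N w' Q) => //.
    exact: (pow_rel_cluster fC Nsub Nst leba Nrel).
  move=> i Hi; rewrite /w' -(_ : size i = (size eta').+1); last first.
    by case: Hi => ->; rewrite size_rcons.
  by rewrite -fmon_rcons; apply: Qm; apply/in_index_set_minus.
pose N' := lspan (fun u => N u \/ exists q, u = fword f q w').
have N'sub : subspace N' by split; [exact: lspan0|move=> *; exact: lspan_lin].
have NN' u : N u -> N' u by move=> Nu; apply: lspan_gen; left.
have N'st : stable f N'.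
  move=> p u; elim=> [|k v x Sv _ IH]; first by rewrite linear0; apply: lspan0.
  rewrite linearP; apply: lspanP => //; case: Sv => [Nv|[q ->]]; [left|right].
    exact: Nst.
  by exists (p :: q).
apply: (IHp N' w Q) => //.
- move=> r s; rewrite minsum_plus -/eta' => lt.
  have [lt'|ge] := ltnP (minsum (rcons (rcons eta' a) b) r) (s + r)%N.
    by apply/NN'/Nrel.
  (* M_r(xi^+) differs from M_r(xi) only for b <= r <= a, and then by one. So a single new degree
     remains, s = [size eta' * r + b], which forces [b] top operators. *)
  have [br ra] : (b <= r)%N /\ (r <= a)%N.
    by move: lt ge b_range; rewrite minsum_rcons2; lia.
  apply: (@powc_top _ _ _ fC N' (size eta') b) => //.
  + move=> p lp; apply/NN'/(pow_rel_large Nrel); by rewrite !size_rcons.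
  + by apply: lspan_gen; right; exists [::].
  + move: lt; rewrite minsum_full; first by lia.
    by apply: sub_all eta'_a => t; apply: leq_trans.
- move=> u; elim=> [|k v x Sv _ IH]; first exact: Qsub.1.
  by apply: Qsub.2 => //; case: Sv => [/NQ//|[q ->]].
- by move=> i Hi; apply/Qm/in_index_set_plus.
Qed.
End Span.

(** * Highest weight vectors and Garland's identity *)

Section HighestWeight.
Variable K : numFieldType.
Implicit Types (W : gtmod K).

Definition low W : nat -> {linear W -> W} := fun p => gt_act (xm ⊗ 'X^p).
Arguments low : clear implicits.

Lemma lowE W p (u : W) : low W p u = gt_act (xm ⊗ 'X^p) u.
Proof. by []. Qed.

Lemma bracket_xm_xm : bracket xm xm = 0 :> sl2 K.
Proof. exact: bracket_alternating. Qed.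

Lemma bracket_hh_xm (g : {poly K}) : bracket hh xm ⊗ g = (-2) *: (xm ⊗ g).
Proof.
by apply: sl2_ext; rewrite /= scalerA; congr (_ *: _); ring.
Qed.

Lemma bracket_xp_xm : bracket xp xm = hh :> sl2 K.
Proof. by apply: sl2_ext; rewrite /bracket /xm /hh /xp /=; ring. Qed.

Lemma tens_decomp (a : sl2 K) g :
  a ⊗ g = a.1.1 *: (xp ⊗ g) + a.1.2 *: (hh ⊗ g) + a.2 *: (xm ⊗ g).
Proof.
by case: a => [[x y] z]; apply: sl2_ext;
  rewrite /= ?scale0r ?scale1r ?scaler0 ?addr0 ?add0r.
Qed.

Lemma act_comm W (a b : sl2 K) (g1 g2 : {poly K}) (u : W) :
  gt_act (a ⊗ g1) (gt_act (b ⊗ g2) u) =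
  gt_act (b ⊗ g2) (gt_act (a ⊗ g1) u) + gt_act (bracket a b ⊗ (g1 * g2)) u.
Proof. by rewrite -tens_bracket gt_act_bracket addrC subrK. Qed.

Lemma xm_act_comm W g1 g2 (u : W) :
  gt_act (xm ⊗ g1) (gt_act (xm ⊗ g2) u) = gt_act (xm ⊗ g2) (gt_act (xm ⊗ g1) u).
Proof. by rewrite act_comm bracket_xm_xm tens0 gt_act0l addr0. Qed.

Lemma low_comm W p q (u : W) : low W p (low W q u) = low W q (low W p u).
Proof. exact: xm_act_comm. Qed.

Lemma hh_low W m p (u : W) : gt_act (hh ⊗ 'X^m) (low W p u) =
  low W p (gt_act (hh ⊗ 'X^m) u) - 2 *: low W (m + p) u.
Proof.
by rewrite !lowE act_comm bracket_hh_xm -exprD gt_actZl scaleNr.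
Qed.

Lemma xp_low W m p (u : W) : gt_act (xp ⊗ 'X^m) (low W p u) =
  low W p (gt_act (xp ⊗ 'X^m) u) + gt_act (hh ⊗ 'X^(m + p)) u.
Proof. by rewrite !lowE act_comm bracket_xp_xm -exprD. Qed.

Section Garland.
Variables (W : gtmod K) (w : W).
Hypothesis xp_w : forall s, gt_act (xp ⊗ 'X^s) w = 0.
Hypothesis hh_w : forall s, gt_act (hh ⊗ 'X^(s.+1)) w = 0.
Local Notation powl := (powc (low W)).

(** [hh ⊗ 'X^(m.+1)] kills [w] and acts on powers of the series as a derivation, sending [low p] to
    -2 [low (m.+1 + p)]. *)
Lemma hh_powc m r s : gt_act (hh ⊗ 'X^(m.+1)) (powl r.+1 s w) =
  (- (2 * r.+1%:R)) *: \sum_(q < s.+1) low W (m.+1 + q) (powl r (s - q) w).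
Proof.
elim: r s => [|r IH] s.
  rewrite powc1 hh_low hh_w linear0 add0r mulr1 -scaleNr; congr (_ *: _).
  rewrite big_ord_recr /= subnn powc0 scale1r big1 ?add0r // => q _.
  by rewrite powc0 subn_eq0 leqNgt ltn_ord scale0r linear0.
rewrite powcS linear_sum /=; under eq_bigr do rewrite hh_low IH linearZ linear_sum.
rewrite sumrB -!scaler_sumr.
have -> : \sum_(p < s.+1) \sum_(q < (s - p).+1)
      low W p (low W (m.+1 + q) (powl r (s - p - q) w)) =
    \sum_(q < s.+1) low W (m.+1 + q) (powl r.+1 (s - q) w).
  rewrite (sum_triangle s (fun p q => low W p (low W (m.+1 + q) (powl r (s - p - q) w)))).
  apply: eq_bigr => q _; rewrite powcS linear_sum.
  by apply: eq_bigr => p _; rewrite low_comm subnAC.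
by rewrite -scalerBl -[in RHS]natr1; congr (_ *: _); ring.
Qed.

Lemma sum_diagonal (V : nmodType) s (F : nat -> V) :
  \sum_(p < s.+1) \sum_(q < (s - p).+1) F (p + q)%N = \sum_(m < s.+1) F m *+ m.+1.
Proof.
elim: s F => [|s IH] F; first by rewrite !big_ord1 /= mulr1n.
rewrite big_ord_recl subn0 [X in X + _]big_ord_recl [RHS]big_ord_recl /=.
rewrite (IH (fun m => F m.+1)) -addrA mulr1n; congr (_ + _).
by rewrite -big_split /=; apply: eq_bigr => m _; rewrite [RHS]mulrS.
Qed.

(** For the series f(u): [xp ⊗ 'X] sends f(u)^(r+1) w to -(r + 1) times the derivative of f(u)^r
    w. *)
Lemma xp_powc r s : gt_act (xp ⊗ 'X^1) (powl r.+1 s w) =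
  (- (r.+1%:R * s.+1%:R)) *: powl r s.+1 w.
Proof.
elim: r s => [|r IH] s.
  by rewrite powc1 xp_low xp_w linear0 add0r add1n hh_w powc0 scale0r scaler0.
rewrite powcS linear_sum /=.
under eq_bigr => p _.
  rewrite xp_low IH add1n hh_powc linearZ.
  over.
rewrite big_split /= -scaler_sumr.
(* Both the double sum coming from [hh] and the induction hypothesis reduce to this first moment,
   which [powc_moment] evaluates. *)
pose Y := \sum_(p < s.+2) p%:R *: low W p (powl r (s.+1 - p) w).
have EY : \sum_(p < s.+1) \sum_(q < (s - p).+1)
    low W (p.+1 + q) (powl r (s - p - q) w) = Y.
  under eq_bigr => p _ do under eq_bigr => q _ do rewrite -subnDA addSn.
  rewrite (sum_diagonal s (fun m => low W m.+1 (powl r (s - m) w))).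
  rewrite /Y [RHS]big_ord_recl scale0r add0r; apply: eq_bigr => p _.
  by rewrite scaler_nat subSS.
rewrite EY.
have EZ : \sum_(p < s.+1) (- (r.+1%:R * (s - p).+1%:R)) *:
     low W p (powl r (s - p).+1 w) =
   (- r.+1%:R) *: (s.+1%:R *: powl r.+1 s.+1 w - Y).
  rewrite powcS /Y scaler_sumr -sumrB scaler_sumr [RHS]big_ord_recr /= subrr scaler0 addr0.
  apply: eq_bigr => p _; rewrite -scalerBl scalerA -(subSn (leq_ord p)) natrB; last by rewrite ltnW.
  by rewrite mulNr.
rewrite EZ.
have := powc_moment (@low_comm W) r s.+1 w; rewrite -/Y => EM.
have -> : (- (2 * r.+1%:R)) *: Y = (-2) *: (r.+1%:R *: Y) by rewrite scalerA mulNr.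
rewrite scalerBr [(- r.+1%:R) *: Y]scaleNr EM opprK !scalerA -!scalerDl.
by congr (_ *: _); ring.
Qed.

(** Iterating [xp_powc] from [powc (s + r) 0 w]: each step lowers the power and raises the degree by
    one, with a nonzero scalar. *)
Lemma garland s r : exists2 c : K, c != 0 &
  iter s (@gt_act K W (xp ⊗ 'X)) (iter (s + r) (gt_act (xm ⊗ 1)) w) = c *: powl r s w.
Proof.
rewrite -[iter (s + r) _ w](powc_n0 (low W)).
elim: s r => [|s IH] r; first by exists 1; rewrite ?oner_neq0 // scale1r.
rewrite iterS addSnnS; have [c c0 ->] := IH r.+1.
exists (- (c * (r.+1%:R * s.+1%:R))).
  by rewrite oppr_eq0 !mulf_neq0 // pnatr_eq0.
by rewrite linearZ /= xp_powc scalerA mulrN.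
Qed.
End Garland.

Definition highest (xi : seq nat) W (w : W) : Prop :=
  [/\ forall s, gt_act (xp ⊗ 'X^s) w = 0,
      forall s, gt_act (hh ⊗ 'X^s) w = ((s == 0%N)%:R * (sumn xi)%:R) *: w
    & pow_rel (low W) xi (fun u => u = 0) w].

Definition words W (w : W) : W -> Prop :=
  lspan (fun u => exists q, u = fword (low W) q w).

(** Straightening: moving [xp] or [hh] to the right past [low] operators produces only further [hh]
    and [low] operators, and [w] is an eigenvector at the end. *)
Lemma words_act xi W (w : W) x u : highest xi w -> words w u -> words w (gt_act x u).
Proof.
move=> [xpw hhw _]; have W0 : words w 0 by exact: lspan0.
have Wl k u1 u2 : words w u1 -> words w u2 -> words w (k *: u1 + u2) by exact: lspan_lin.
have WZ k u1 : words w u1 -> words w (k *: u1).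
  by move=> W1; rewrite -[_ *: _]addr0; apply: Wl.
have WD u1 u2 : words w u1 -> words w u2 -> words w (u1 + u2).
  by move=> W1 W2; rewrite -[u1]scale1r; apply: Wl.
have Wlow p v : words w v -> words w (low W p v).
  elim=> [|k v1 v2 [q ->] _ IH]; first by rewrite linear0.
  by rewrite linearP; apply: lspanP => //; exists (p :: q).
have Wq q : words w (fword (low W) q w) by apply: lspan_gen; exists q.
have Whh m q : words w (gt_act (hh ⊗ 'X^m) (fword (low W) q w)).
  elim: q m => [|p q IH] m /=; first by rewrite hhw; apply/WZ/(Wq [::]).
  by rewrite hh_low addrC -scaleNr; apply/Wl/Wlow; [apply: (Wq (_ :: q))|].
have Wxp m q : words w (gt_act (xp ⊗ 'X^m) (fword (low W) q w)).
  elim: q m => [|p q IH] m /=; first by rewrite xpw.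
  by rewrite xp_low; apply: WD => //; apply: Wlow.
elim/(@cur_ind K): x => [|a s|x y IHx IHy] Wu; first by rewrite gt_act0l.
  rewrite tens_decomp !gt_actDl !gt_actZl.
  apply/WD/WZ/Wlow => //.
  have ext y : (forall q, words w (gt_act y (fword (low W) q w))) -> words w (gt_act y u).
    move=> Wy; elim: Wu => [|k v1 v2 [q ->] _ IH]; first by rewrite linear0.
    by rewrite linearP; apply: (Wl _ _ _ (Wy q) IH).
  by apply: (WD _ _ (WZ _ _ (ext _ _)) (WZ _ _ (ext _ _))).
by rewrite gt_actDl; apply: WD; [apply: IHx|apply: IHy].
Qed.

(** The first [k] parts are bounded by [r]. Together with [minsum_eq], M_r is the minimum of r k +
    sum_{j > k} xi_j over k >= 0, so the numerical conditions of the presentation amount to s + r >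
    M_r. *)
Lemma minsum_le xi r k : (minsum xi r <= r * k + sumn (drop k xi))%N.
Proof.
rewrite -{1}(cat_take_drop k xi) /minsum big_cat /=; apply: leq_add.
  apply: (@leq_trans (\sum_(x <- take k xi) r)%N).
    by apply: leq_sum => x _; exact: geq_minr.
  by rewrite big_const_seq count_predT iter_addn_0 size_take_min leq_mul2l geq_minl orbT.
rewrite sumnE; apply: leq_sum => x _; exact: geq_minl.
Qed.

Lemma minsum_eq xi r : sorted geq xi ->
  exists k, minsum xi r = (r * k + sumn (drop k xi))%N.
Proof.
move=> sxi; exists (find (gtn r) xi).
move: sxi; rewrite (sorted_pairwise geq_trans) /minsum.
elim: xi => [|x xi IH] /=; first by rewrite big_nil muln0.
case/andP=> xall sxi; rewrite big_cons; case: ltnP => xr /=.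
  rewrite muln0; congr (_ + _)%N; rewrite sumnE.
  rewrite !big_seq; apply: eq_bigr => y /(allP xall) /= yx.
  by apply/minn_idPl; apply: leq_trans yx (ltnW xr).
by rewrite IH // mulnS addnA.
Qed.

Lemma highest_pres xi : sorted geq xi -> highest xi (V_pres_gen K xi).
Proof.
move=> sxi.
have xpg s : gt_act (xp ⊗ 'X^s) (V_pres_gen K xi) = 0.
  by have := V_rel0 (V_rel_xp K xi s); rewrite -popE.
have hhg s : gt_act (hh ⊗ 'X^s) (V_pres_gen K xi) =
    ((s == 0%N)%:R * (sumn xi)%:R) *: V_pres_gen K xi.
  by have := V_rel0 (V_rel_h K xi s); rewrite -popE pclsZ.
have hhg0 s : gt_act (hh ⊗ 'X^(s.+1)) (V_pres_gen K xi) = 0.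
  by rewrite hhg mul0r scale0r.
split=> // r s; have [k ->] := minsum_eq r sxi => lt.
case: r lt => [|r] lt.
  by rewrite powc0; case: s lt => [|s] lt; [lia|rewrite scale0r].
have [c c0 E] := garland xpg hhg0 s r.+1.
apply: (scalerI c0); rewrite -E scaler0.
have iter0 (x : sl2 {poly K}) n : iter n (@gt_act K (V_pres K xi) x) 0 = 0.
  by elim: n => // n IH; rewrite iterS IH linear0.
(* The mixed relations require k > 0. For k = 0 one has s + r.+1 > |xi|, and the relation (x^- ⊗
   1)^(|xi|+1) v = 0 takes over. *)
case: k lt => [|k] lt.
  have := V_rel0 (V_rel_xm K xi); rewrite pcls_iter => E0.
  rewrite (_ : s + r.+1 = (s + r.+1 - (sumn xi).+1) + (sumn xi).+1)%N; last first.
    by move: lt; rewrite drop0; lia.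
  by rewrite iterD [iter (sumn xi).+1 _ _]E0 !iter0.
have := @V_rel0 _ xi _ _ (@V_rel_mixed K xi s r.+1 k.+1 _ _ _ _).
by rewrite !pcls_iter; apply => //; move: lt; lia.
Qed.

Lemma highest_lift xi W (w : W) : sorted geq xi -> highest xi w ->
  exists2 phi : V_pres K xi -> W, is_gthom phi & phi (V_pres_gen K xi) = w.
Proof.
move=> sxi [xpw hhw roww].
have wlin (x : sl2 {poly K}) : linear (@gt_act K W x) by exact: gt_act_linear.
pose ev := teval (fun _ : unit => w) (@gt_act K W).
have ev_iter n x t : ev (iter n (Op x) t) = iter n (gt_act x) (ev t).
  by elim: n => //= n ->.
have wrel t u : gt_rel (V_rel (K := K) xi) t u -> ev t = ev u.
  case=> {t u} [t u tu|k x y t|x y t]; last 2 first.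
  - by rewrite /ev /= gt_act_linearl.
  - by rewrite /ev /= gt_act_bracket scaleN1r.
  case: tu => [s|s||s r k s0 r0 k0 le].
  - exact: xpw.
  - exact: hhw.
  - rewrite ev_iter /= -[RHS](roww (sumn xi).+1 0%N).
      by rewrite powc_n0.
    by rewrite add0n ltnS; have := minsum_le xi (sumn xi).+1 0; rewrite muln0 drop0.
  - rewrite !ev_iter /=; have [|c _ ->] := garland xpw _ s r.
      by move=> m; rewrite hhw mul0r scale0r.
    by rewrite roww ?scaler0 //; have := minsum_le xi r k; lia.
exists (pres_lift (Rel := gt_rel (V_rel (K := K) xi)) (fun=> w) (@gt_act K W)).
  by split; [apply: pres_lift_linear|move=> x v; apply: pres_lift_op].
exact: pres_lift_gen.
Qed.

Lemma Vmod_highest xi : sorted geq xi -> highest xi (Vgen K xi).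
Proof.
case: xi => [|n xi]; last exact: highest_pres.
move=> _; split=> [s|s|r s].
- by [].
- by rewrite mulr0 scale0r.
- rewrite /minsum big_nil; case: r => [|r] lt.
    by rewrite powc0; case: s lt => // s _; rewrite scale0r.
  by rewrite powcS big1.
Qed.

Lemma Vmod_lift xi W (w : W) : sorted geq xi -> highest xi w ->
  exists2 phi : Vmod K xi -> W, is_gthom phi & phi (Vgen K xi) = w.
Proof.
case: xi => [|n xi]; last exact: highest_lift.
move=> _ [xpw hhw roww].
exists (fun c : K^o => c *: w); last by rewrite scale1r.
split=> [k u v|x v]; first by rewrite scalerDl scalerA.
rewrite linearZ scale0r /= (_ : gt_act x w = 0) ?scaler0 //.
elim/(@cur_ind K): x => [|a s|x y IHx IHy]; first exact: gt_act0l.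
  rewrite tens_decomp !gt_actDl !gt_actZl xpw hhw mulr0 scale0r !scaler0 !add0r.
  (* For the empty partition M_1 = 0, so every [low p w] vanishes. *)
  rewrite -lowE -(powc1 (low W)) roww ?scaler0 //.
  by rewrite /minsum big_nil addn1.
by rewrite gt_actDl IHx IHy addr0.
Qed.

Lemma Vmod_words xi (u : Vmod K xi) : sorted geq xi -> words (Vgen K xi) u.
Proof.
move=> sxi; have hw := Vmod_highest sxi.
have W1 : words (Vgen K xi) (Vgen K xi) by apply: lspan_gen; exists [::].
case: xi u sxi hw W1 => [|n xi] u sxi hw W1.
  by rewrite -[u]mulr1 -[_ * _]addr0; apply: lspan_lin => //; apply: lspan0.
elim/V_pres_ind: u => //; [exact: lspan0|by move=> *; apply: lspan_lin|].
by move=> x u; apply: words_act hw.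
Qed.

Lemma Vmod_gthom_grade xi (W : grmod K) (phi : Vmod K xi -> W) r :
  is_gthom phi -> grade r (phi (Vgen K xi)) ->
  forall s u, grade s u -> grade (s + r) (phi u).
Proof.
move=> [lphi aphi] g0 s.
have phi0 : phi 0 = 0.
  by have := lphi (-1) 0 0; rewrite scaler0 addr0 scaleN1r addNr.
case: xi phi lphi aphi g0 phi0 => [|n xi] phi lphi aphi g0 phi0 u.
  case: s => [|s] gu; last by rewrite gu // phi0; apply: grade0.
  rewrite add0n -[u]mulr1 -[_ * _]addr0 lphi phi0.
  by apply: grade_lin => //; apply: grade0.
elim=> [|k v1 v2 [m [<- ->]] _ IH]; first by rewrite phi0; apply: grade0.
rewrite lphi; apply: grade_lin => //.
elim: m {IH} => [|[a p] m IH] //=; rewrite aphi -addnA; exact: grade_act.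
Qed.

Lemma Vgen_grade xi : grade 0%N (Vgen K xi).
Proof. by case: xi => [|n xi] //; apply: Upart_gen. Qed.
End HighestWeight.

(** * Associated graded modules and tensor products of evaluation modules *)

Section Filtration.
Variables (K : numFieldType) (V : gtmod K) (v0 : V).

Lemma filt_S s u : filt v0 s u -> filt v0 s.+1 u.
Proof.
move=> [w [Uw ->]]; exists (fun t => if (t <= s)%N then w t else 0); split=> [t|].
  by case: ifP => _; [exact: Uw|exact: Upart0].
rewrite [RHS]big_ord_recr /= ltnn addr0.
by apply: eq_bigr => i _; rewrite -ltnS ltn_ord.
Qed.

Lemma filt_pred_filt s u : filt_pred v0 s u -> filt v0 s u.
Proof. by case: s => [|s] /=; [move=> ->; exact: filt0|exact: filt_S]. Qed.

Lemma Upart_filt s u : Upart v0 s u -> filt v0 s u.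
Proof.
move=> Uu; exists (fun t => if t == s then u else 0); split=> [t|].
  by case: eqP => [->|_] //; exact: Upart0.
by rewrite big_ord_recr /= eqxx big1 ?add0r // => i _; rewrite ltn_eqF.
Qed.

Definition gr_single s u (Fu : filt v0 s u) : filt_sum v0.
Proof.
refine (@FiltSum K V v0 (fun t => if t == s then u else 0) _ _).
  by move=> t; case: eqP => [->|_] //; apply: filt0.
by exists s.+1 => t lt; rewrite gtn_eqF.
Defined.

(* The class of [u] in [F^s V / F^(s-1) V], with junk value [0] when [u] is not
   in [F^s V]. *)
Definition gr_class s u : gr_gtmod v0 :=
  if pselect (filt v0 s u) is left Fu then gr_cls (gr_single Fu) else 0.

Lemma gr_classE s u (Fu : filt v0 s u) : gr_class s u = gr_cls (gr_single Fu).
Proof.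
rewrite /gr_class; case: pselect => // Fu'; apply/gr_clsP/fs_eqW => t /=.
by [].
Qed.

Lemma gr_class_lin s k u w : filt v0 s u -> filt v0 s w ->
  gr_class s (k *: u + w) = k *: gr_class s u + gr_class s w.
Proof.
move=> Fu Fw; rewrite (gr_classE (filt_lin k Fu Fw)) (gr_classE Fu) (gr_classE Fw).
rewrite -gr_cls_lin; apply/gr_clsP/fs_eqW => t /=.
by case: eqP => // _; rewrite scaler0 addr0.
Qed.

Lemma gr_class_eq0 s u : filt v0 s u -> gr_class s u = 0 <-> filt_pred v0 s u.
Proof.
move=> Fu; rewrite (gr_classE Fu) -[0]/(gr_cls (fs_zero v0)); split.
  by move/gr_clsP/(_ s); rewrite /= eqxx subr0.
move=> Pu; apply/gr_clsP => t /=; rewrite subr0.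
by case: eqP => [->|_] //; apply: filt_pred0.
Qed.

Lemma gr_class0 s : gr_class s 0 = 0.
Proof. by apply/gr_class_eq0; [apply: filt0|apply: filt_pred0]. Qed.

Lemma gr_classZ s k u : filt v0 s u -> gr_class s (k *: u) = k *: gr_class s u.
Proof.
move=> Fu; rewrite -[k *: u]addr0 gr_class_lin ?gr_class0 ?addr0 //; exact: filt0.
Qed.

Lemma gr_class_act a p s u : filt v0 s u ->
  gt_act (a ⊗ 'X^p) (gr_class s u) = gr_class (p + s) (gt_act (a ⊗ 'X^p) u).
Proof.
move=> Fu; rewrite (gr_classE Fu) (gr_classE (filt_act a p Fu)).
rewrite -[LHS]/(gr_act (a ⊗ 'X^p) (gr_cls (gr_single Fu))) gr_actE.
apply/gr_clsP/fs_eqW => t; rewrite fs_act_homog /=.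
case: (leqP p t) => [pt|tp]; last by rewrite ltn_eqF // ltn_addr.
rewrite -(eqn_add2l p) subnKC //.
by case: eqP => // _; rewrite linear0.
Qed.

Lemma gr_class_grade s u : gr_grade s (gr_class s u).
Proof.
rewrite /gr_class; case: pselect => [Fu|_]; last exact: gr_grade0.
by exists (gr_single Fu) => // t /eqP ts /=; rewrite (negbTE ts).
Qed.

Lemma gr_class_sum (q : gr_gtmod v0) : exists n (w : nat -> V),
  (forall s, filt v0 s (w s)) /\ q = \sum_(s < n) gr_class s (w s).
Proof.
have [n [w [gw ->]]] := gr_grade_sum q.
have H s : exists u, filt v0 s u /\ w s = gr_class s u.
  have [f f0 ->] := gw s; exists (f s); split; first exact: fs_filt.
  rewrite (gr_classE (fs_filt f s)); apply/gr_clsP/fs_eqW => t /=.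
  by case: eqP => [->|/f0].
have [u Hu] := choice H; exists n, u; split=> [s|]; first by case: (Hu s).
by apply: eq_bigr => s _; case: (Hu s).
Qed.

Lemma gr_class_mono s m : sumn [seq p.2 | p <- m] = s ->
  gr_class s (mono_act m v0) = mono_act m (gr_class 0 v0) /\ filt v0 s (mono_act m v0).
Proof.
move=> <-; elim: m => [|[a p] m [IH Fm]] /=.
  by split=> //; apply: Upart_filt; exact: Upart_gen.
by split; [rewrite -IH -gr_class_act|apply: filt_act].
Qed.

Lemma gr_class_Upart s u : filt v0 s u ->
  exists2 w, Upart v0 s w & gr_class s u = gr_class s w.
Proof.
case=> w [Uw ->]; exists (w s) => //.
have Fw : filt_pred v0 s (\sum_(i < s) w i).
  by case: s => [|s] /=; [rewrite big_ord0|exists w].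
rewrite big_ord_recr /= -[X in X + _]scale1r gr_class_lin.
- rewrite (gr_class_eq0 (filt_pred_filt Fw)).2 //.
  by rewrite scaler0 add0r.
- exact: filt_pred_filt.
- exact: Upart_filt.
Qed.

(** A class of degree s has a representative in U(g[t])[s] v0, hence gr V is cyclic on the class of
    [v0]. *)
Lemma gr_generated (P : gr_gtmod v0 -> Prop) :
  P 0 -> (forall k u w, P u -> P w -> P (k *: u + w)) ->
  (forall m, P (mono_act m (gr_class 0 v0))) -> forall q, P q.
Proof.
move=> P0 Pl Pm q; have [n [w [Fw ->]]] := gr_class_sum q.
elim/big_ind: _ => // [x y Px Py|s _]; first by rewrite -[x]scale1r; apply: Pl.
have [u Uu ->] := gr_class_Upart (Fw s).
have [//] : P (gr_class s u) /\ filt v0 s u.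
elim: Uu => [|k x y [m [ms ->]] _ [IH Fy]].
  by split; [rewrite gr_class0|apply: filt0].
have [E Fm] := gr_class_mono ms.
by split; [rewrite gr_class_lin // E; apply: Pl|apply: filt_lin].
Qed.

Lemma Upart_powc n s : Upart v0 s (powc (low V) n s v0).
Proof.
elim: n s => [|n IH] s.
  rewrite powc0; case: s => [|s] /=; first by rewrite scale1r; apply: Upart_gen.
  by rewrite scale0r; apply: Upart0.
rewrite powcS; elim/big_ind: _ => [|u w Uu Uw|p _]; first exact: Upart0.
  by rewrite -[u]scale1r; apply: Upart_lin.
by rewrite -{1}(subnKC (leq_ord p)); apply: Upart_act.
Qed.

Lemma gr_class_big s (I : Type) (e : seq I) (P : pred I) (A : I -> V) :
  (forall i, P i -> filt v0 s (A i)) ->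
  gr_class s (\sum_(i <- e | P i) A i) = \sum_(i <- e | P i) gr_class s (A i).
Proof.
move=> FA; suff [] : filt v0 s (\sum_(i <- e | P i) A i) /\
    gr_class s (\sum_(i <- e | P i) A i) = \sum_(i <- e | P i) gr_class s (A i) by [].
elim/big_rec2: _ => [|i y x Pi [Fx <-]].
  by split; [exact: filt0|exact: gr_class0].
rewrite -[A i]scale1r; split; first by apply: filt_lin => //; apply: FA.
by rewrite gr_class_lin ?scale1r //; apply: FA.
Qed.

Lemma gr_class_powc n s :
  gr_class s (powc (low V) n s v0) = powc (low (gr_gtmod v0)) n s (gr_class 0 v0).
Proof.
elim: n s => [|n IH] s.
  rewrite !powc0; case: s => [|s] /=; first by rewrite !scale1r.
  by rewrite !scale0r gr_class0.
rewrite !powcS gr_class_big => [|p _]; last first.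
  by rewrite -{1}(subnKC (leq_ord p)); apply: filt_act; apply: Upart_filt; exact: Upart_powc.
apply: eq_bigr => p _; rewrite -IH [RHS]lowE [RHS]gr_class_act ?subnKC ?leq_ord //.
by apply: Upart_filt; exact: Upart_powc.
Qed.

End Filtration.

(** * Power relations and cyclicity in the tensor product *)

Section EvaluationTensor.
Variables (K : numFieldType) (m : nat) (z : 'I_m -> K) (r : 'I_m -> nat).
Hypothesis z_inj : injective z.

Local Notation U := (fun k : 'I_m => twist (z k) (ev0V K (r k))).
Local Notation T := (tensor U).
Local Notation v0 := (pure (V := U) (fun k : 'I_m => irr_gen K (r k))).

Lemma twist_ev0_act i (a : sl2 K) g (u : U i) :
  gt_act (a ⊗ g) u = g.[z i] *: irr_act a u.
Proof.
have E (k : K) : ((k *: g) \Po ('X + (z i)%:P)).[0] = g.[z i] * k.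
  by rewrite horner_comp !hornerE mulrC.
rewrite -[LHS]/(irr_act (cur_ev0 (cur_subst ('X + (z i)%:P) (a ⊗ g))) u).
by rewrite /irr_act /cur_ev0 /cur_subst /= !E !scalerDr !scalerA.
Qed.

Lemma pure_dfwith0 (v : forall k, U k) i : pure (V := U) (dfwith v (0 : U i)) = 0.
Proof.
have := pure_lin v (-1) (0 : U i) 0; rewrite scaler0 addr0 scaleN1r => {1}->.
by rewrite addNr.
Qed.

Lemma pure_dfwithZ (v : forall k, U k) i k (u : U i) :
  pure (V := U) (dfwith v (k *: u)) = k *: pure (V := U) (dfwith v u).
Proof. by have := pure_lin v k u 0; rewrite pure_dfwith0 !addr0. Qed.

Lemma act_pure (a : sl2 K) g (v : forall k, U k) :
  @gt_act K T (a ⊗ g) (pure (V := U) v) =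
  \sum_i g.[z i] *: pure (V := U) (dfwith v (irr_act a (v i) : U i)).
Proof.
rewrite -[LHS]/(tensor_act (a ⊗ g) (pure (V := U) v)) tensor_actE.
by apply: eq_bigr => i _; rewrite twist_ev0_act pure_dfwithZ.
Qed.

(* The Lagrange interpolation polynomial at the [z j]: by [factor_act] the
   element [a ⊗ lagrange i] acts as [a] on the [i]-th tensor factor only. *)
Definition lagrange (i : 'I_m) : {poly K} :=
  \prod_(j | j != i) ((z i - z j)^-1 *: ('X - (z j)%:P)).

Lemma lagrangeE i j : (lagrange i).[z j] = (i == j)%:R.
Proof.
rewrite /lagrange horner_prod; case: eqVneq => [<-|ij].
  rewrite big1 // => k ki; rewrite !hornerE mulVf // subr_eq0.
  by apply: contraNneq ki => /z_inj ->.
by rewrite (bigD1 j) 1?eq_sym //= !hornerE subrr mulr0 mul0r.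
Qed.

Lemma factor_act a i (v : forall k, U k) :
  @gt_act K T (a ⊗ lagrange i) (pure (V := U) v) =
  pure (V := U) (dfwith v (irr_act a (v i) : U i)).
Proof.
rewrite act_pure (bigD1 i) //= lagrangeE eqxx scale1r big1 ?addr0 // => j ji.
by rewrite lagrangeE eq_sym (negbTE ji) scale0r.
Qed.

Definition fac (i : 'I_m) : {linear T -> T} := gt_act (xm ⊗ lagrange i).

Lemma facE i u : fac i u = gt_act (xm ⊗ lagrange i) u.
Proof. by []. Qed.

Lemma xm_act_fac g (u : T) : gt_act (xm ⊗ g) u = \sum_i g.[z i] *: fac i u.
Proof.
elim/tensor_ind: u => [|v|c u w IHu IHw].
- by rewrite linear0 big1 // => i _; rewrite linear0 scaler0.
- by rewrite act_pure; apply: eq_bigr => i _; rewrite facE factor_act.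
- rewrite (@gt_act_linear K T) IHu IHw scaler_sumr -big_split /=; apply: eq_bigr => i _.
  by rewrite linearP scalerDr !scalerA mulrC.
Qed.

Lemma fac_low i p u : fac i (low T p u) = low T p (fac i u).
Proof. exact: xm_act_comm. Qed.

Lemma fac_powc i n s u : fac i (powc (low T) n s u) = powc (low T) n s (fac i u).
Proof.
elim: n s => [|n IH] s; first by rewrite !powc0 linearZ.
by rewrite !powcS linear_sum; apply: eq_bigr => p _; rewrite fac_low IH.
Qed.

Lemma fac_comm i j u : fac i (fac j u) = fac j (fac i u).
Proof. exact: xm_act_comm. Qed.

Lemma irr_act_xm (k : nat) (u : 'cV[K]_k.+1) : irr_act xm u = irr_xm u.
Proof. by rewrite /irr_act /xm /= !scale0r !add0r scale1r. Qed.

Lemma iter_irr_xm (k n : nat) (i : 'I_k.+1) :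
  iter n (@irr_xm K k) (delta_mx ord0 ord0) i 0 = (i == n :> nat)%:R.
Proof.
elim: n i => [|n IH] i; first by rewrite mxE eqxx andbT.
rewrite iterS mxE; case E: (i : nat) => [|i'] //.
rewrite IH inordK ?eqSS //; have := ltn_ord i; rewrite E; exact: ltnW.
Qed.

Lemma iter_fac i n (v : forall k, U k) :
  iter n (fac i) (pure (V := U) v) =
  pure (V := U) (dfwith v (iter n (@irr_xm K (r i)) (v i) : U i)).
Proof.
have dfid : dfwith v (v i) = v.
  by apply: functional_extensionality_dep => j; case: dfwithP.
elim: n => [|n IH]; first by rewrite /= dfid.
rewrite !iterS IH facE factor_act dfwith_in dfwith_same; congr (pure _); congr dfwith.
exact: irr_act_xm.
Qed.

Lemma fac_nilpotent i : iter (r i).+1 (fac i) v0 = 0.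
Proof.
rewrite iter_fac (_ : iter _ _ _ = 0); last first.
  apply/matrixP=> a b; rewrite (ord1 b) iter_irr_xm mxE.
  by rewrite ltn_eqF.
exact: pure_dfwith0.
Qed.

Lemma xp_v0 s : @gt_act K T (xp ⊗ 'X^s) v0 = 0.
Proof.
rewrite act_pure big1 // => i _.
rewrite (_ : irr_act _ _ = 0).
  by rewrite pure_dfwith0 scaler0.
apply/matrixP => a b; rewrite /irr_act /xp /= !scale0r !addr0 scale1r !mxE.
case: (ltnP a (r i)) => lt; last by rewrite (eqP (lt : (_ - _)%N == 0%N)) muln0 mul0r.
by rewrite -val_eqE /= inordK // mulr0.
Qed.

Lemma hh_v0 s : @gt_act K T (hh ⊗ 'X^s) v0 = (\sum_i (z i) ^+ s * (r i)%:R) *: v0.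
Proof.
rewrite act_pure scaler_suml; apply: eq_bigr => i _.
have -> : irr_act hh (irr_gen K (r i)) = (r i)%:R *: irr_gen K (r i).
  apply/matrixP => a b; rewrite /irr_act /hh /= !scale0r addr0 add0r scale1r !mxE.
  by rewrite (ord1 b) -val_eqE /=; case: (a : nat) => [|k]; rewrite ?mulr0 ?subr0.
rewrite pure_dfwithZ scalerA hornerXn; congr (_ *: pure _).
by apply: functional_extensionality_dep => j; case: dfwithP.
Qed.

(* [mul1 x] multiplies a formal series with coefficients in [T] by [1 - x u],
   and [geo x] multiplies it by [(1 - x u)^-1]. *)
Definition mul1 (x : K) (A : nat -> T) : nat -> T :=
  fun s => A s - x *: (if s is s'.+1 then A s' else 0).

Definition geo (x : K) (A : nat -> T) : nat -> T :=
  fun s => \sum_(p < s.+1) x ^+ p *: A (s - p)%N.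

Lemma mul1_geo x A : mul1 x (geo x A) = A.
Proof.
apply: functional_extensionality_dep => s; rewrite /mul1 /geo.
case: s => [|s]; first by rewrite big_ord1 scaler0 subr0 scale1r.
rewrite big_ord_recl scale1r scaler_sumr subn0 -addrA -sumrB big1 ?addr0 // => p _.
by rewrite /= subSS scalerA -exprS subrr.
Qed.

Lemma mul1C x y A : mul1 x (mul1 y A) = mul1 y (mul1 x A).
Proof.
apply: functional_extensionality_dep => s; rewrite /mul1.
case: s => [|[|s]]; rewrite ?scaler0 ?subr0 //.
  by rewrite addrAC.
rewrite !scalerBr !scalerA [y * x]mulrC !opprB addrACA [RHS]addrACA.
by congr (_ + _); rewrite addrC.
Qed.

(** Multiplication of a series by prod_i (1 - z_i u)^(c i). *)
Definition mulE (c : 'I_m -> nat) (A : nat -> T) : nat -> T :=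
  foldr (fun i => iter (c i) (mul1 (z i))) A (enum 'I_m).

Lemma mul1_iterC x y n A : mul1 x (iter n (mul1 y) A) = iter n (mul1 y) (mul1 x A).
Proof. by elim: n => //= n IH; rewrite mul1C IH. Qed.

Lemma mulED c d A : mulE (fun i => c i + d i)%N A = mulE c (mulE d A).
Proof.
rewrite /mulE; elim: (enum _) => //= i e ->; rewrite iterD; congr (iter _ _ _).
move: (foldr _ A e) => B; elim: (d i) => //= n ->; move: (iter n _ B) => C.
by elim: e => //= j e IH; rewrite mul1_iterC IH.
Qed.

Lemma mulE_delta i A : mulE (fun j => j == i) A = mul1 (z i) A.
Proof.
rewrite /mulE; have := mem_enum 'I_m i; have := enum_uniq 'I_m.
rewrite inE; elim: (enum _) => //= j e IH /andP[je ue]; rewrite inE.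
case: (eqVneq j i) => [ji|ji] /=; last exact: IH.
subst j => _; congr mul1.
elim: e je {IH ue} => //= j e IH; rewrite inE negb_or => /andP[ij /IH ->].
by rewrite eq_sym (negbTE ij).
Qed.

Lemma mulE_sum c (I : Type) (e : seq I) (A : I -> nat -> T) s :
  mulE c (fun t => \sum_(i <- e) A i t) s = \sum_(i <- e) mulE c (A i) s.
Proof.
have mul1_sum x (B : I -> nat -> T) : mul1 x (fun t => \sum_(i <- e) B i t) =
    fun t => \sum_(i <- e) mul1 x (B i) t.
  apply: functional_extensionality_dep => t; rewrite /mul1 sumrB; congr (_ - _).
  by rewrite -scaler_sumr; congr (_ *: _); case: t => //; rewrite big1.
suff -> : mulE c (fun t => \sum_(i <- e) A i t) =
    fun t => \sum_(i <- e) mulE c (A i) t by [].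
rewrite /mulE; elim: (enum _) => //= i l ->.
by elim: (c i) => //= n ->; rewrite mul1_sum.
Qed.

Lemma mulE_vanish c A M n :
  (forall s, (M < s + n)%N -> A s = 0) ->
  forall s, (M + \sum_i c i < s + n)%N -> mulE c A s = 0.
Proof.
move=> A0; rewrite -big_enum /mulE /=.
elim: (enum _) => [|i e IH] s /=; first by rewrite big_nil addn0; exact: A0.
rewrite big_cons addnCA; elim: (c i) s => [|k IHk] s lt /=; first exact: IH.
rewrite /mul1; case: s lt => [|s] lt; rewrite !IHk ?scaler0 ?subr0 //; lia.
Qed.

(** Induction by peeling off one operator: f(u)^(n+1) w = sum_i (1 - z_i u)^(-1) f(u)^n
    ([fac i w]). *)
Lemma fac_pow_vanish n (e : 'I_m -> nat) (w : T) :
  (forall i, iter (e i).+1 (fac i) w = 0) ->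
  forall s, (\sum_i minn (e i) n < s + n)%N ->
  mulE (fun i => minn (e i) n) (fun t => powc (low T) n t w) s = 0.
Proof.
elim: n e w => [|n IH] e w e0 s lt.
  rewrite [mulE _ _](_ : _ = fun t => powc (low T) 0 t w).
    by rewrite powc0; case: s lt => [|s] lt; [lia|rewrite scale0r].
  by rewrite /mulE; elim: (enum _) => //= i l ->; rewrite minn0.
have -> : (fun t => powc (low T) n.+1 t w) =
    fun t => \sum_i geo (z i) (fun t' => powc (low T) n t' (fac i w)) t.
  apply: functional_extensionality_dep => t; rewrite powcS /geo exchange_big.
  apply: eq_bigr => p _; rewrite lowE xm_act_fac; apply: eq_bigr => i _.
  by rewrite hornerXn fac_powc.
rewrite mulE_sum big1 // => i _.
case Ei: (e i) => [|k].
  have F0 : fac i w = 0 by have := e0 i; rewrite Ei.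
  rewrite F0 (_ : geo _ _ = fun t => \sum_(j <- [::] : seq nat) (0 : T)).
    by rewrite (mulE_sum _ [::] (fun _ _ => 0)) big_nil.
  apply: functional_extensionality_dep => t; rewrite big_nil /geo big1 // => p _.
  have := powc_linear (low T) n (t - p) (-1) 0 0.
  by rewrite scaler0 addr0 scaleN1r addNr => ->; rewrite scaler0.
(* [fac i w] has nilpotency exponents [e']. Of the min(e_j, n + 1) factors at j, min(e'_j, n) serve
   the induction hypothesis, one at j = i cancels [geo], and the surplus [x j] only raises the
   degree. *)
pose e' j := (e j - (j == i))%N.
pose x j := (minn (e j) n.+1 - minn (e' j) n - (j == i))%N.
have xE j : minn (e j) n.+1 = (x j + (minn (e' j) n + (j == i)))%N.
  by rewrite /x /e'; case: eqVneq => [->|_]; rewrite ?Ei /=; lia.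
rewrite (_ : mulE (fun j => minn (e j) n.+1) =
  mulE (fun j => x j + (minn (e' j) n + (j == i)))%N); last first.
  by congr mulE; apply: functional_extensionality_dep => j; exact: xE.
rewrite mulED mulED mulE_delta mul1_geo.
apply: (mulE_vanish (M := \sum_j minn (e' j) n) (n := n)); last first.
  move: lt; under eq_bigr do rewrite xE.
  rewrite !big_split /= [X in (_ + (_ + X))%N](_ : _ = 1%N); first by lia.
  by rewrite (bigD1 i) //= eqxx big1 // => j /negbTE->.
apply: IH => j; rewrite /e'; case: (eqVneq j i) => [->|ji].
  by rewrite -iterSr -[RHS](e0 i) Ei subn1.
rewrite subn0; have := e0 j.
have iter_comm k' u : iter k' (fac j) (fac i u) = fac i (iter k' (fac j) u).
  by elim: k' => //= k' ->; rewrite fac_comm.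
by rewrite iter_comm => ->; rewrite linear0.
Qed.

Local Notation Fil := (@filt K T v0).
Local Notation Fpred := (@filt_pred K T v0).
Local Notation Upt := (@Upart K T v0).

(** Each 1 - z_i u has constant term 1, and its other term shifts coefficients by one degree; the
    change at u^s thus lies in F^(s-1), so these factors become invisible in gr. *)
Lemma mulE_filt c (A : nat -> T) : (forall s, Fil s (A s)) ->
  forall s, Fpred s (A s - mulE c A s).
Proof.
move=> FA; suff : forall s, Fil s (mulE c A s) /\ Fpred s (A s - mulE c A s).
  by move=> H s; case: (H s).
pose R B := forall s, Fil s (B s) /\ Fpred s (A s - B s).
have Rmul1 x B : R B -> R (mul1 x B).
  move=> RB s; have P : Fpred s (x *: (if s is s'.+1 then B s' else 0)).
    rewrite -[_ *: _]addr0; apply: filt_pred_lin; last exact: filt_pred0.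
    by case: s => [|s] //=; case: (RB s).
  rewrite /mul1; split.
    rewrite addrC -scaleN1r; apply: filt_lin; first exact: filt_pred_filt.
    by case: (RB s).
  rewrite opprB addrCA -[x *: _]scale1r; apply: filt_pred_lin => //.
  by case: (RB s).
rewrite -/(R (mulE c A)) /mulE; elim: (enum _) => [|i e IH] /=.
  by move=> s; split; [exact: FA|rewrite subrr; exact: filt_pred0].
by elim: (c i) => //= n; apply: Rmul1.
Qed.

Lemma powc_filt_pred n s : (\sum_i minn (r i) n < s + n)%N ->
  Fpred s (powc (low T) n s v0).
Proof.
move=> lt; have := mulE_filt (fun i => minn (r i) n)
  (fun s => Upart_filt (@Upart_powc K T v0 n s)) s.
by rewrite (fac_pow_vanish fac_nilpotent lt) subr0.
Qed.

(** Distinct parameters give operators [fac i] acting on one factor only. They turn the generator of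
    that factor into its whole basis, so factors are replaced one after another. *)
Lemma tensor_cyclic (u : T) : exists s, Fil s u.
Proof.
pose P u := exists s, Fil s u.
have filt_le s t v : (s <= t)%N -> Fil s v -> Fil t v.
  by move/subnK <-; elim: (t - s)%N => // k IH /IH; apply: filt_S.
have P0 : P 0 by exists 0%N; exact: filt0.
have Pl k v w : P v -> P w -> P (k *: v + w).
  move=> [s sv] [t tw]; exists (maxn s t).
  by apply: filt_lin; [apply: filt_le sv|apply: filt_le tw]; rewrite ?leq_maxl ?leq_maxr.
have Pact x v : P v -> P (@gt_act K T x v).
  move=> Pv; elim/(@cur_ind K): x => [|a p|x y Px Py].
  - by rewrite gt_act0l.
  - by case: Pv => s sv; exists (p + s)%N; apply: filt_act.
  - by rewrite gt_actDl -[gt_act x v]scale1r; apply: (Pl 1).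
suff Ppure (e : seq 'I_m) (v : forall k, U k) :
    (forall j, j \notin e -> v j = irr_gen K (r j)) -> P (pure (V := U) v).
  elim/tensor_ind: u => [|v|k v w Pv Pw] //; last exact: (Pl k).
  by apply: (Ppure (enum 'I_m)) => j; rewrite mem_enum.
elim: e v => [|i e IH] v ve.
  have -> : v = fun k => irr_gen K (r k).
    by apply: functional_extensionality_dep => j; apply: ve.
  by exists 0%N; apply: Upart_filt; exact: Upart_gen.
pose v' := dfwith v (irr_gen K (r i) : U i).
have Pv' : P (pure (V := U) v').
  apply: IH => j je; rewrite /v'; case: (eqVneq i j) => [<-|ij].
    by rewrite dfwith_in.
  by rewrite dfwith_out // ve // inE eq_sym (negbTE ij).
have vE : v i = \sum_(k < (r i).+1) (v i) k 0 *: iter k (@irr_xm K (r i)) (irr_gen K (r i)).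
  apply/matrixP => a b; rewrite (ord1 b) summxE (bigD1 a) //= mxE iter_irr_xm eqxx mulr1.
  by rewrite big1 ?addr0 // => k ka; rewrite mxE iter_irr_xm val_eqE eq_sym (negbTE ka) mulr0.
have -> : v = dfwith v' (v i).
  by rewrite dfwith_same; apply: functional_extensionality_dep => j; case: dfwithP.
rewrite vE; elim/big_ind: _ => [|x y Px Py|k _].
- by rewrite pure_dfwith0.
- by rewrite -[x]scale1r pure_lin; apply: (Pl 1).
- rewrite pure_dfwithZ -[_ *: _]addr0; apply: (Pl) => //.
  have := iter_fac i k v'; rewrite {3}/v' dfwith_in => <-.
  by elim: (k : nat) => //= n Pn; apply: Pact.
Qed.

End EvaluationTensor.

(** * Bases and dual families *)

Section Combinations.
Variables (K : fieldType) (V : lmodType K) (I : eqType) (E : seq I) (b : I -> V).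

Definition comb (P : pred I) (u : V) : Prop :=
  exists c : I -> K, u = \sum_(i <- E | P i) c i *: b i.

Definition free_on : Prop :=
  forall c : I -> K, \sum_(i <- E) c i *: b i = 0 -> forall i, i \in E -> c i = 0.

Lemma comb_lin P k u w : comb P u -> comb P w -> comb P (k *: u + w).
Proof.
move=> [c ->] [d ->]; exists (fun i => k * c i + d i).
rewrite scaler_sumr -big_split /=; apply: eq_bigr => i _.
by rewrite scalerDl scalerA.
Qed.

Lemma comb0 P : comb P 0.
Proof. by exists (fun=> 0); rewrite big1 // => i _; rewrite scale0r. Qed.

Lemma comb_gen (P : pred I) i : uniq E -> i \in E -> P i -> comb P (b i).
Proof.
move=> uE iE Pi; exists (fun j => (j == i)%:R).
rewrite big_mkcond (bigD1_seq i) //= Pi eqxx scale1r big1 ?addr0 // => j /negbTE->.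
by rewrite scale0r if_same.
Qed.

Lemma comb_sub (P Q : pred I) u : subpred P Q -> comb P u -> comb Q u.
Proof.
move=> PQ [c ->]; exists (fun i => if P i then c i else 0).
rewrite big_mkcond [RHS]big_mkcond; apply: eq_bigr => i _.
by case: ifP => [/PQ->|_] //; rewrite scale0r if_same.
Qed.

Lemma free_subseq (s : seq I) (c : I -> K) : uniq E -> free_on ->
  uniq s -> {subset s <= E} -> \sum_(i <- s) c i *: b i = 0 ->
  forall i, i \in s -> c i = 0.
Proof.
move=> uE fE us sE s0 i si.
have := fE (fun j => if j \in s then c j else 0); move/(_ _ i (sE _ si)).
rewrite si; apply; rewrite -[RHS]s0.
have ps : perm_eq [seq j <- E | j \in s] s.
  apply: uniq_perm; rewrite ?filter_uniq // => j; rewrite mem_filter.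
  by case: (boolP (j \in s)) => // /sE.
rewrite -(perm_big _ ps) /= big_filter [RHS]big_mkcond /=.
by apply: eq_bigr => j _; case: ifP => // _; rewrite scale0r.
Qed.

End Combinations.

(** Expanding [eps] in the spanning family gives A with A B = 1, where B holds the values
    lam_j(b_k). As E has at most |J| entries, B has full row rank, and a linear relation among the
    b_k is a row vector annihilated by B. *)
Lemma dual_family_free (K : fieldType) (V : lmodType K) (I : eqType) (E : seq I)
    (b : I -> V) (J : finType) (eps : J -> V) (lam : J -> V -> K^o) :
  (size E <= #|J|)%N -> (forall j, linear (lam j)) ->
  (forall j j', lam j (eps j') = (j == j')%:R) ->
  (forall u, comb E b predT u) -> free_on E b.
Proof.
move=> szE linl dual spanE c c0.
pose t := tnth (in_tuple E).
have [a aE] := choice (fun j => spanE (eps j)).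
pose A := \matrix_(j < #|J|, k < size E) a (enum_val j) (t k).
pose B := \matrix_(k < size E, j < #|J|) (lam (enum_val j) (b (t k)) : K).
have lam0 j : lam j 0 = 0.
  by have := linl j (-1) 0 0; rewrite scaler0 addr0 scaleN1r addNr.
have lam_sum j (F : I -> K) : lam j (\sum_(i <- E) F i *: b i) =
    \sum_(k < size E) F (t k) * lam j (b (t k)).
  rewrite (big_morph _ (id1 := 0) (op1 := +%R)) //; last first.
    by move=> x y; rewrite -[x]scale1r linl !scale1r.
  rewrite big_tnth; apply: eq_bigr => k _.
  by rewrite -[_ *: _]addr0 linl lam0 addr0.
have AB : A *m B = 1%:M.
  apply/matrixP => j j'; rewrite !mxE -(inj_eq enum_val_inj) eq_sym -dual aE lam_sum.
  by apply: eq_bigr => k _; rewrite !mxE.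
have freeB : row_free B.
  rewrite /row_free eqn_leq rank_leq_row /= (leq_trans szE) //.
  by rewrite -[X in (X <= _)%N](mxrank1 K) -AB mxrankM_maxr.
have : (\row_k c (t k)) *m B = 0.
  apply/rowP => j; rewrite !mxE; under eq_bigr do rewrite !mxE.
  by rewrite -lam_sum c0 lam0.
move/eqP; rewrite mulmx_free_eq0 // => /eqP/rowP c_eq0 i iE.
have /tnthP[k ->] : i \in in_tuple E by [].
by have := c_eq0 k; rewrite !mxE.
Qed.

Section TensorDual.
Variables (K : numFieldType) (m : nat) (z : 'I_m -> K) (r : 'I_m -> nat).
Local Notation U := (fun k : 'I_m => twist (z k) (ev0V K (r k))).
Local Notation T := (tensor U).

Definition multi_index : finType := {dffun forall k : 'I_m, 'I_(r k).+1}.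

Definition tensor_basis (j : multi_index) : T :=
  pure (V := U) (fun k => delta_mx (j k) 0 : 'cV[K]_(r k).+1).

Definition tensor_coord (j : multi_index) : T -> K^o :=
  pres_lift (Rel := @multilin K _ U)
    (fun v : forall k, U k => \prod_k ((v k : 'cV[K]_(r k).+1) (j k) 0) : K^o)
    (of_void _).

Lemma tensor_coord_rel (j : multi_index) t u : @multilin K _ U t u ->
  teval (fun v : forall k, U k => \prod_k ((v k : 'cV[K]_(r k).+1) (j k) 0) : K^o)
    (of_void _) t =
  teval (fun v : forall k, U k => \prod_k ((v k : 'cV[K]_(r k).+1) (j k) 0) : K^o)
    (of_void _) u.
Proof.
case=> {t u} v i k u w /=.
have E (x : U i) : \prod_k0 ((dfwith v x k0 : 'cV[K]_(r k0).+1) (j k0) 0) =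
    (x : 'cV[K]_(r i).+1) (j i) 0 *
    \prod_(k0 | k0 != i) ((v k0 : 'cV[K]_(r k0).+1) (j k0) 0).
  rewrite (bigD1 i) //= dfwith_in; congr (_ * _); apply: eq_bigr => k0 ne.
  by rewrite dfwith_out // eq_sym.
rewrite !E !mxE mulrDl; congr (_ + _); by rewrite -mulrA.
Qed.

Lemma tensor_coord_linear j : linear (tensor_coord j).
Proof. by apply: pres_lift_linear => [[]|]; apply: tensor_coord_rel. Qed.

Lemma tensor_coord_basis j j' : tensor_coord j (tensor_basis j') = (j == j')%:R.
Proof.
rewrite [LHS]pres_lift_gen; [|by case|exact: tensor_coord_rel].
case: eqVneq => [->|ne].
  by rewrite big1 // => k _; rewrite mxE !eqxx.
have [k jk] : exists k, j k != j' k.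
  apply/existsP; rewrite -negb_forall; apply: contra ne => /forallP H.
  by apply/eqP/ffunP => k; apply/eqP.
by rewrite (bigD1 k) //= mxE (negbTE jk) mul0r.
Qed.

Lemma card_multi_index : #|multi_index| = (\prod_k (r k).+1)%N.
Proof.
rewrite card_dep_ffun -big_enum /image_mem /=.
elim: (enum _) => [|k e IH] /=; first by rewrite big_nil.
by rewrite big_cons -IH card_ord.
Qed.
End TensorDual.

(** * The fusion product *)

Section Monomials.
Variable K : numFieldType.

Definition fmon_word (i : seq nat) : seq (sl2 K * nat) :=
  flatten [seq nseq (nth 0%N i p) (xm, p) | p <- iota 0 (size i)].

Definition weight (i : seq nat) : nat := sumn [seq x.2 | x <- fmon_word i].

Lemma fmonE (W : gtmod K) i (w : W) : fmon (low W) i w = mono_act (fmon_word i) w.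
Proof.
rewrite /fmon /fmon_word; elim: (iota 0 _) => //= p e ->.
rewrite /mono_act foldr_cat; move: (foldr _ w _) => u.
by elim: (nth _ _ _) => //= n ->.
Qed.

Lemma gthom_fword (V W : gtmod K) (phi : V -> W) q v :
  is_gthom phi -> phi (fword (low V) q v) = fword (low W) q (phi v).
Proof. by move=> [_ phiA]; elim: q => //= p q IH; rewrite phiA IH. Qed.

Lemma gthom_mono (V W : gtmod K) (phi : V -> W) m v :
  is_gthom phi -> phi (mono_act m v) = mono_act m (phi v).
Proof. by move=> [_ phiA]; elim: m => //= p m IH; rewrite phiA IH. Qed.

Lemma gthom_fmon (V W : gtmod K) (phi : V -> W) i v :
  is_gthom phi -> phi (fmon (low V) i v) = fmon (low W) i (phi v).
Proof. by move=> hphi; rewrite !fmonE gthom_mono. Qed.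

Lemma gthom0 (V W : gtmod K) (phi : V -> W) : is_gthom phi -> phi 0 = 0.
Proof.
move=> [lphi _]; have := lphi (-1) 0 0.
by rewrite scaler0 addr0 scaleN1r addNr.
Qed.

Lemma gthom_sum (V W : gtmod K) (phi : V -> W) (I : Type) (e : seq I) (P : pred I)
    (c : I -> K) (b : I -> V) : is_gthom phi ->
  phi (\sum_(i <- e | P i) c i *: b i) = \sum_(i <- e | P i) c i *: phi (b i).
Proof.
move=> hphi; have [lphi _] := hphi.
elim/big_rec2: _ => [|i y x _ <-]; [exact: gthom0|exact: lphi].
Qed.

Lemma highest_span xi (W : gtmod K) (w : W) (E : seq (seq nat)) :
  sorted geq xi -> highest xi w -> uniq E -> (forall i, in_index_set xi i -> i \in E) ->
  forall u, words w u -> comb E (fun i => fmon (low W) i w) predT u.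
Proof.
move=> sxi [_ _ roww] uE HE u; elim=> [|k x y [q ->] _ IH]; first exact: comb0.
apply: comb_lin => //.
apply: (index_set_span (@low_comm K W) sxi _ _ roww) => //.
- by split=> // k' u' w' -> ->; rewrite scaler0 addr0.
- by move=> p u' ->; rewrite linear0.
- by split; [exact: comb0|move=> *; exact: comb_lin].
- by move=> u' ->; exact: comb0.
- by move=> i /HE iE; apply: comb_gen.
Qed.

(** Smaller M_r means stronger relations. This serves both for the map onto V(xi^+) and for
    exchanging a list with the partition obtained by sorting it and dropping zeros. *)
Lemma highest_ext xi xi' (W : gtmod K) (w : W) :
  sumn xi = sumn xi' -> (forall r, minsum xi r <= minsum xi' r)%N ->
  highest xi w -> highest xi' w.
Proof.
move=> Es le [xpw hhw roww]; split=> // [s|r s lt]; first by rewrite hhw Es.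
by apply: roww; apply: leq_ltn_trans (le r) lt.
Qed.

End Monomials.

Section FusionFree.
Variables (K : numFieldType) (xi : seq nat).
Hypothesis sxi : sorted geq xi.
Variable z : 'I_(size xi) -> K.
Hypothesis z_inj : injective z.

Local Notation r := (fun k : 'I_(size xi) => part xi k.+1).
Local Notation U := (fun k : 'I_(size xi) => twist (z k) (ev0V K (r k))).
Local Notation T := (tensor U).
Local Notation v0 := (pure (V := U) (fun k : 'I_(size xi) => irr_gen K (r k))).
Local Notation G := (@gr_gtmod K T v0).
Local Notation g0 := (@gr_class K T v0 0 v0).

Lemma sum_parts (F : nat -> nat) : (\sum_(k < size xi) F (r k) = \sum_(x <- xi) F x)%N.
Proof. by rewrite (big_nth 0%N) big_mkord. Qed.

Lemma prod_parts (F : nat -> nat) : (\prod_(k < size xi) F (r k) = \prod_(x <- xi) F x)%N.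
Proof. by rewrite (big_nth 0%N) big_mkord. Qed.

Lemma filt_v0 : @filt K T v0 0 v0.
Proof. by apply: Upart_filt; exact: Upart_gen. Qed.

Lemma highest_fusion : highest xi (g0 : G).
Proof.
split=> [s|s|n s lt].
- by rewrite (gr_class_act _ _ filt_v0) xp_v0 gr_class0.
- rewrite (gr_class_act _ _ filt_v0) hh_v0 addn0.
  set c := \sum_i _; case: s @c => [|s] c.
    have -> : c = (sumn xi)%:R.
      rewrite sumnE -(sum_parts id) natr_sum; apply: eq_bigr => k _.
      by rewrite mul1r.
    by rewrite mul1r (gr_classZ _ filt_v0).
  (* [hh ⊗ 'X^(s.+1)] multiplies [v0] by a scalar, so the result stays in F^0 and its class in the
     positive degree s + 1 is 0. *)
  rewrite mul0r scale0r; apply/gr_class_eq0.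
    rewrite -[c *: _]addr0; apply: filt_lin; last exact: filt0.
    by have := filt_v0; elim: s.+1 => // t IH /IH; apply: filt_S.
  rewrite -[c *: _]addr0; apply: filt_pred_lin; last exact: filt_pred0.
  by have := filt_v0; rewrite /=; elim: s {c} => // t IH /IH; apply: filt_S.
rewrite -gr_class_powc; apply/gr_class_eq0.
  by apply: Upart_filt; exact: Upart_powc.
by apply: powc_filt_pred => //; rewrite (sum_parts (fun x => minn x n)).
Qed.

Local Notation cl := (@gr_class K T v0).
Local Notation gproj := (@gr_proj K T v0).

Lemma fusion_words (q : G) : words (g0 : G) q.
Proof.
move: q; apply: gr_generated; [exact: lspan0|by move=> *; apply: lspan_lin|].
elim=> [|x m IH]; first by apply: lspan_gen; exists [::].
exact: words_act highest_fusion IH.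
Qed.

Lemma fmon_gr_class i :
  fmon (low G) i g0 = cl (weight K i) (fmon (low T) i v0 : T) /\
  @filt K T v0 (weight K i) (fmon (low T) i v0).
Proof.
have [E F] := @gr_class_mono K T v0 _ _ (erefl (weight K i)).
by rewrite !fmonE -E.
Qed.

Variable E : seq (seq nat).
Hypotheses (uE : uniq E) (HE : forall i, i \in E <-> in_index_set xi i).

Lemma gr_proj_span s (q : G) :
  comb E (fun i => fmon (low G) i g0) (fun i => weight K i == s) (gproj s q).
Proof.
have [_ _ rowg] := highest_fusion.
elim: (fusion_words q) => [|k x y [w ->] _ IH]; first by rewrite linear0; exact: comb0.
rewrite linearP; apply: comb_lin => //.
pose Q (u : G) := comb E (fun i => fmon (low G) i g0) (fun i => weight K i == s) (gproj s u).
apply: (index_set_span (@low_comm K G) (Q := Q) sxi _ _ rowg).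
- by split=> // k' u' w' -> ->; rewrite scaler0 addr0.
- by move=> p u' ->; rewrite linear0.
- split=> [|k' u' w' Qu Qw]; first by rewrite /Q linear0; exact: comb0.
  by rewrite /Q linearP; apply: comb_lin.
- by move=> u' ->; rewrite /Q linear0; exact: comb0.
- move=> i /HE iE; rewrite /Q (@gr_proj_grade _ _ _ _ (weight K i)); last first.
    by rewrite (fmon_gr_class i).1; apply: gr_class_grade.
  by case: eqP => [ws|_]; [apply: comb_gen => //; apply/eqP|exact: comb0].
Qed.

(** Lift to T the expression of the class of [u] by monomials of weight s; the error lies in
    F^(s-1), to which induction applies. *)
Lemma filt_span s (u : T) : @filt K T v0 s u ->
  comb E (fun i => fmon (low T) i v0) (fun i => weight K i < s.+1)%N u.
Proof.
elim/ltn_ind: s u => s IHs.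
have Hp v : @filt_pred K T v0 s v ->
    comb E (fun i => fmon (low T) i v0) (fun i => weight K i < s.+1)%N v.
  case: s IHs => [|s] IHs /= Pv; first by rewrite Pv; exact: comb0.
  by apply: comb_sub (IHs s _ _ Pv) => // i /ltnW.
move=> u Fu.
have : gproj s (cl s u) = cl s u.
  by rewrite (gr_proj_grade _ (@gr_class_grade K T v0 s u)) eqxx.
have [c ->] := gr_proj_span s (cl s u) => Ec.
pose y : T := \sum_(i <- E | weight K i == s) c i *: fmon (low T) i v0.
have Fc i : weight K i == s -> @filt K T v0 s (c i *: fmon (low T) i v0).
  move=> /eqP <-; rewrite -[_ *: _]addr0; apply: filt_lin; last exact: filt0.
  exact: (fmon_gr_class i).2.
have Fy : @filt K T v0 s y.
  rewrite /y; elim/big_ind: _ => [|a b Fa Fb|i /Fc //]; first exact: filt0.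
  by rewrite -[a]scale1r; apply: filt_lin.
have Py : @filt_pred K T v0 s (u - y).
  apply/gr_class_eq0.
    by rewrite -scaleN1r addrC; apply: filt_lin.
  rewrite addrC -scaleN1r gr_class_lin // scaleN1r -Ec /y gr_class_big //.
  apply/eqP; rewrite addrC subr_eq0; apply/eqP; apply: eq_bigr => i /[dup] /Fc _ /eqP ws.
  rewrite (fmon_gr_class i).1 ws gr_classZ //.
  by rewrite -ws; exact: (fmon_gr_class i).2.
rewrite -(subrK y u) -[u - y]scale1r; apply: comb_lin.
  exact: Hp.
apply: (@comb_sub _ _ _ _ _ (fun i => weight K i == s)); last by exists c.
by move=> i /eqP->.
Qed.

Lemma tensor_span (u : T) : comb E (fun i => fmon (low T) i v0) predT u.
Proof.
have [s Fu] := tensor_cyclic z_inj u.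
exact: comb_sub (filt_span Fu).
Qed.

Hypothesis szE : (size E <= dim_prod xi)%N.

Lemma tensor_free : free_on E (fun i => fmon (low T) i v0).
Proof.
apply: (dual_family_free (eps := @tensor_basis K _ z r) (lam := @tensor_coord K _ z r)).
- by rewrite card_multi_index (prod_parts succn).
- exact: tensor_coord_linear.
- exact: tensor_coord_basis.
- exact: tensor_span.
Qed.

(** The part of weight s of a relation in gr lifts to an element of F^s lying in F^(s-1), hence to a
    combination of monomials of weight below s. The difference is a relation in T, where the
    monomials are free. *)
Lemma fusion_free : free_on E (fun i => fmon (low G) i g0).
Proof.
move=> c c0 i iE; set s := weight K i.
pose y : T := \sum_(j <- E | weight K j == s) c j *: fmon (low T) j v0.
have Fc j : weight K j == s -> @filt K T v0 s (c j *: fmon (low T) j v0).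
  move=> /eqP <-; rewrite -[_ *: _]addr0; apply: filt_lin; last exact: filt0.
  exact: (fmon_gr_class j).2.
have Fy : @filt K T v0 s y.
  rewrite /y; elim/big_ind: _ => [|a b Fa Fb|j /Fc //]; first exact: filt0.
  by rewrite -[a]scale1r; apply: filt_lin.
have gy : cl s y = 0.
  rewrite -[RHS](linear0 (gproj s)) -c0 linear_sum /y gr_class_big //.
  rewrite big_mkcond; apply: eq_bigr => j _; rewrite linearZ /=.
  rewrite (@gr_proj_grade _ _ _ _ (weight K j)); last first.
    by rewrite (fmon_gr_class j).1; apply: gr_class_grade.
  case: eqP => [ws|_]; last by rewrite scaler0.
  rewrite (fmon_gr_class j).1 ws gr_classZ //.
  by rewrite -ws; exact: (fmon_gr_class j).2.
have [d yE] : comb E (fun i => fmon (low T) i v0) (fun i => weight K i < s)%N y.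
  have /gr_class_eq0 := gy; move/(_ Fy).
  by case: (s) => [->|t /filt_span //]; exact: comb0.
have := @tensor_free (fun j => (if weight K j == s then c j else 0) -
    (if (weight K j < s)%N then d j else 0)) _ i iE.
rewrite eqxx ltnn subr0; apply.
under eq_bigr do rewrite scalerBl; rewrite sumrB; apply/eqP; rewrite subr_eq0.
have mk (P : pred (seq nat)) (e : seq nat -> K) :
    \sum_(j <- E) (if P j then e j else 0) *: fmon (low T) j v0 =
    \sum_(j <- E | P j) e j *: fmon (low T) j v0.
  by rewrite [RHS]big_mkcond; apply: eq_bigr => j _; case: ifP; rewrite ?scale0r.
by rewrite (mk (fun j => weight K j == s)) (mk (fun j => weight K j < s)%N) -yE.
Qed.

End FusionFree.

(** * The exact sequence *)

Lemma index_set_list xi : sorted geq xi -> exists E : seq (seq nat),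
  [/\ uniq E, forall i, i \in E <-> in_index_set xi i & (size E <= dim_prod xi)%N].
Proof.
move=> sxi; have [E HE sE] := index_set_enum sxi.
exists [seq i <- undup E | `[<in_index_set xi i>]]; split.
- by rewrite filter_uniq // undup_uniq.
- move=> i; rewrite mem_filter mem_undup; split=> [/andP[/asboolP //]|Hi].
  by rewrite HE // andbT; apply/asboolP.
- by rewrite size_filter (leq_trans (count_size _ _)) // (leq_trans (size_undup _)).
Qed.

Section VmodBasis.
Variable K : numFieldType.

(* [xi'] will be [xi] with its zero parts removed and its parts reordered. *)
Lemma Vmod_free xi xi' E : sorted geq xi -> sorted geq xi' ->
  sumn xi = sumn xi' -> minsum xi =1 minsum xi' ->
  uniq E -> (forall i, i \in E <-> in_index_set xi i) -> (size E <= dim_prod xi)%N ->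
  free_on E (fun i => fmon (low (Vmod K xi')) i (Vgen K xi')).
Proof.
move=> sxi sxi' Es Em uE HE szE c c0.
(* Any choice of distinct parameters would serve here. *)
pose z (k : 'I_(size xi)) : K := (k : nat)%:R.
have z_inj : injective z.
  by move=> k k' /eqP; rewrite eqr_nat => /eqP kk; apply: val_inj.
have hw : highest xi' _ := highest_ext Es (fun r => eq_leq (Em r)) (highest_fusion z_inj).
have [phi hphi phiv] := Vmod_lift sxi' hw.
apply: (fusion_free sxi z_inj uE HE szE).
have := gthom_sum E predT c (fun i => fmon (low (Vmod K xi')) i (Vgen K xi')) hphi.
rewrite c0 (gthom0 hphi) => Esum; rewrite [RHS]Esum; apply: eq_bigr => i _.
by rewrite (gthom_fmon _ _ hphi) phiv.
Qed.

Lemma Vmod_span xi xi' E : sorted geq xi -> sorted geq xi' ->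
  sumn xi = sumn xi' -> minsum xi =1 minsum xi' ->
  uniq E -> (forall i, i \in E <-> in_index_set xi i) ->
  forall u, comb E (fun i => fmon (low (Vmod K xi')) i (Vgen K xi')) predT u.
Proof.
move=> sxi sxi' Es Em uE HE u.
have hw : highest xi (Vgen K xi').
  exact: highest_ext (esym Es) (fun r => eq_leq (esym (Em r))) (Vmod_highest K sxi').
apply: (highest_span sxi hw uE); last exact: Vmod_words.
by move=> i /HE.
Qed.

End VmodBasis.

Section LowestVector.
Variables (K : numFieldType) (W : gtmod K) (w : W) (xi : seq nat) (p : nat).
Hypothesis hw : highest xi w.
Hypotheses (p0 : (0 < p)%N) (pxi : (size xi <= p.+1)%N).

Lemma low_large q : (size xi <= q)%N -> low W q w = 0.
Proof. by case: hw => _ _ roww; apply: (pow_rel_large roww). Qed.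

(** For m > 0 the commutator replaces one [low p] by [low (m + p)], whose index is at least the
    number of parts, so it kills [w]. *)
Lemma hh_iter_low n m : gt_act (hh ⊗ 'X^m) (iter n (low W p) w) =
  ((m == 0%N)%:R * ((sumn xi)%:R - (2 * n)%:R)) *: iter n (low W p) w.
Proof.
elim: n => [|n IH]; first by case: hw => _ -> _; rewrite muln0 subr0.
rewrite iterS hh_low IH linearZ_LR -iterS.
case: m {IH} => [|m].
  rewrite add0n -iterS -scalerBl !mul1r; congr (_ *: _).
  by rewrite mulnS natrD; ring.
rewrite !mul0r !scale0r sub0r (_ : low W _ _ = 0) ?scaler0 ?oppr0 //.
rewrite -(iter_fC (@low_comm K W)) low_large; last by lia.
by elim: n => // n IH; rewrite iterS IH linear0.
Qed.

Lemma xp_iter_low n m : gt_act (xp ⊗ 'X^m) (iter n (low W p) w) = 0.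
Proof.
elim: n => [|n IH]; first by case: hw.
rewrite iterS xp_low IH linear0 add0r hh_iter_low.
by rewrite (_ : (m + p == 0)%N = false) ?mul0r ?scale0r //; lia.
Qed.

End LowestVector.

Lemma minsum_filter0 xi : minsum [seq x <- xi | (0 < x)%N] =1 minsum xi.
Proof.
move=> r; rewrite /minsum big_filter big_mkcond; apply: eq_bigr => -[|x] _ //.
by rewrite min0n.
Qed.

Lemma sumn_filter0 xi : sumn [seq x <- xi | (0 < x)%N] = sumn xi.
Proof. by elim: xi => //= -[|x] xi /= ->. Qed.

(** With p = [size y], operators of index above p vanish, so the coefficient of u^(n p) in f(u)^n is
    ([low p])^n. For n = x + 1 one has M_n <= p n + x < p n + n. *)
Lemma pow_rel_last (K : numFieldType) (W : gtmod K) (w : W) y x :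
  pow_rel (low W) (rcons y x) (fun u => u = 0) w -> iter x.+1 (low W (size y)) w = 0.
Proof.
move=> roww; set p := size y.
have large q : (p < q)%N -> low W q w = 0.
  by move=> lt; apply: (pow_rel_large roww); rewrite size_rcons.
have iter0 n q : iter n (low W q) 0 = 0.
  by elim: n => // n IH; rewrite iterS IH linear0.
have gt n k s : (n * p < s)%N -> powc (low W) n s (iter k (low W p) w) = 0.
  elim: n k s => [|n IH] k s lt; first by rewrite powc0 gtn_eqF // scale0r.
  rewrite powcS big1 // => q _; case: (leqP q p) => qp.
    by rewrite IH ?linear0 //; move: lt; rewrite mulSn; lia.
  rewrite -(powc_f (@low_comm K W)) -(iter_fC (@low_comm K W)) large // iter0.
  have := powc_linear (low W) n (s - q) (-1) 0 0.
  by rewrite scaler0 addr0 scaleN1r addNr.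
have eq n k : powc (low W) n (n * p) (iter k (low W p) w) = iter (n + k) (low W p) w.
  elim: n k => [|n IH] k; first by rewrite powc0 scale1r.
  have lt : (p < (n.+1 * p).+1)%N by rewrite mulSn; lia.
  rewrite powcS (bigD1 (Ordinal lt)) //= big1 => [|q].
    by rewrite addr0 mulSn addKn IH.
  rewrite -val_eqE /= => qp; have := ltn_ord q; rewrite ltnS.
  move: (nat_of_ord q) qp => {}q qp qs.
  case: (ltnP q p) => [lt'|le]; first by rewrite gt ?linear0 //; move: qs; rewrite mulSn; lia.
  rewrite -(powc_f (@low_comm K W)) -(iter_fC (@low_comm K W)) large ?iter0; last by lia.
  have := powc_linear (low W) n (n.+1 * p - q) (-1) 0 0.
  by rewrite scaler0 addr0 scaleN1r addNr.
rewrite -[x.+1]addn0 -eq; apply: roww; rewrite minsum_rcons.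
have y0 : minsum y 0 = 0%N by rewrite /minsum big1 // => t _; rewrite minn0.
by have := minsum_add y 0 x.+1; rewrite y0 !add0n -/p [(p * _)%N]mulnC; lia.
Qed.

Section ExactSequence.
Variables (K : numFieldType) (eta : seq nat) (c a b : nat) (xm' xp' : seq nat).
Hypotheses (eta_a : all (ltn a) eta) (b_range : (0 < b <= a)%N).
Let y := eta ++ nseq c a.
Let xi := rcons (rcons y a) b.
Let xm := rcons y (a - b)%N.
Let xp := rcons (eta ++ a.+1 :: nseq c a) b.-1.
Hypotheses (sxi : sorted geq xi) (sxm : sorted geq xm) (sxp : sorted geq xp).
Hypotheses (sxm' : sorted geq xm') (sxp' : sorted geq xp').
Hypotheses (Em : sumn xm = sumn xm') (Mm : minsum xm =1 minsum xm').
Hypotheses (Ep : sumn xp = sumn xp') (Mp : minsum xp =1 minsum xp').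

(** Here [l] is the number of parts of xi minus one, the top operator index; [l * b] is the grade of
    [w]. *)
Local Notation l := (size y).+1.
Local Notation v := (Vgen K xi).
Local Notation vm := (Vgen K xm').
Local Notation vp := (Vgen K xp').
Local Notation w := (iter b (low (Vmod K xi) l) v).

Let leba : (b <= a)%N. Proof. by case/andP: b_range. Qed.

Let ya : all (leq a) y.
Proof.
rewrite all_cat; apply/andP; split; apply/allP => t.
  by move/(allP eta_a); apply: ltnW.
by rewrite mem_nseq => /andP[_ /eqP->] /=.
Qed.

Lemma highest_lowest_vector : highest xm' w.
Proof.
have hv := Vmod_highest K sxi; have [_ _ rowv] := hv.
have lxi : (size xi <= l.+1)%N by rewrite !size_rcons.
apply: (@highest_ext K xm) => // [r|]; first by rewrite Mm.
split=> [s|s|].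
- exact: (xp_iter_low hv).
- rewrite (hh_iter_low hv) //; congr (_ * _ *: _).
  rewrite -natrB ?leq_mul2l; first by congr _%:R; rewrite /xi /xm !sumn_rcons; lia.
  by rewrite /xi !sumn_rcons; lia.
- apply: (pow_rel_cluster (@low_comm K _) _ _ leba rowv).
    by split=> // k' u' w' -> ->; rewrite scaler0 addr0.
  by move=> p u ->; rewrite linear0.
Qed.

Lemma highest_quotient : highest xi vp.
Proof.
apply: highest_ext (Vmod_highest K sxp'); last first.
  by move=> r; rewrite -Mp /xp minsum_plus /xi minsum_rcons2 -/y; lia.
by rewrite -Ep /xi /xp rcons_block !sumn_rcons !sumn_cat /=; lia.
Qed.

(** The map from V(xi^-) sends the monomial of [i] to that of [rcons i b], hence is injective. The
    remaining indices of I(xi) lie in I(xi^+), so their monomials have independent images in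
    V(xi^+), which gives exactness in the middle. *)
Lemma exact_sequence : exists (phi_minus : tau (l * b) (Vmod K xm') -> Vmod K xi)
    (phi_plus : Vmod K xi -> Vmod K xp'), short_exact phi_minus phi_plus.
Proof.
have [phim hm phimv] := Vmod_lift sxm' highest_lowest_vector.
have [phip hp phipv] := Vmod_lift sxi highest_quotient.
have [E [uE HE szE]] := index_set_list sxi.
have [Em' [uEm HEm szEm]] := index_set_list sxm.
have [Ep' [uEp HEp szEp]] := index_set_list sxp.
have free := Vmod_free (K := K) sxi sxi erefl (frefl _) uE HE szE.
have freep := Vmod_free (K := K) sxp sxp' Ep Mp uEp HEp szEp.
have spanm := Vmod_span (K := K) sxm sxm' Em Mm uEm HEm.
have span := Vmod_span (K := K) sxi sxi erefl (frefl _) uE HE.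
have memE i : i \in Em' -> rcons i b \in E.
  by move/HEm => Hi; apply/HE/(in_index_set_minus _ leba ya).
have size_m i : i \in Em' -> size i = l.
  by move=> /HEm[-> _]; rewrite size_rcons.
have phim_mon i : i \in Em' -> phim (fmon (low _) i vm) = fmon (low _) (rcons i b) v.
  by move=> /size_m si; rewrite (gthom_fmon _ _ hm) phimv fmon_rcons si.
have phim_sum e : phim (\sum_(i <- Em') e i *: fmon (low _) i vm) =
    \sum_(i <- Em') e i *: fmon (low _) (rcons i b) v.
  rewrite (gthom_sum _ _ _ _ hm) !big_seq; apply: eq_bigr => i iE.
  by rewrite phim_mon.
(* The last part of xi^+ is b - 1, so the [b]-th power of the top operator kills its generator. *)
have phipw : phip w = 0.
  have -> : phip w = iter b (low (Vmod K xp') l) vp.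
    by rewrite -phipv; case: hp => _ hpA; elim: b => //= n IH; rewrite hpA IH.
  have [_ _ roww] : highest xp vp.
    by apply: highest_ext (Vmod_highest K sxp') => // r; rewrite Mp.
  have := pow_rel_last roww; rewrite prednK; last by case/andP: b_range.
  by rewrite !size_cat /= addnS.
exists phim, phip; split.
- have gw : grade (l * b) (phim vm).
    rewrite phimv; elim: {phimv hm phim_mon phim_sum phipw memE} b => [|n IH].
      by rewrite muln0; exact: Vgen_grade.
    by rewrite mulnS iterS; apply: grade_act.
  split; first exact: hm.
  move=> s u; rewrite /= /tau_grade; case: leqP => [ls gu|_ ->]; last first.
    by rewrite (gthom0 hm); apply: grade0.
  by have := Vmod_gthom_grade hm gw gu; rewrite subnK.
- split=> // s u gu; rewrite -[s]addn0; apply: (Vmod_gthom_grade hp) => //.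
  by rewrite phipv; exact: Vgen_grade.
- have inj0 u : phim u = 0 -> u = 0.
    have [e ->] := spanm u; rewrite phim_sum => e0.
    have umap : uniq (map (rcons^~ b) Em').
      by rewrite map_inj_uniq // => i j /rcons_inj[].
    have smap : {subset map (rcons^~ b) Em' <= E} by move=> _ /mapP[i /memE iE ->].
    have := free_subseq (c := fun j => e (take l j)) uE free umap smap.
    rewrite big_map => H; rewrite big_seq big1 // => i iE.
    suff -> : e i = 0 by rewrite scale0r.
    have tk j : j \in Em' -> take l (rcons j b) = j.
      by move=> /size_m <-; rewrite -cats1 take_size_cat.
    rewrite -(tk i iE); apply: H; last by apply: map_f.
    by rewrite -[RHS]e0 !big_seq; apply: eq_bigr => j /tk->.
  move=> u1 u2 E12; apply/eqP; rewrite -subr_eq0; apply/eqP/inj0.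
  have := hm.1 (-1) u2 u1; rewrite !scaleN1r [- u2 + _]addrC => ->.
  by rewrite E12 addNr.
- move=> u; split=> [u0|[u' <-]]; last first.
    elim: (Vmod_words u' sxm') => [|k x1 x2 [q ->] _ IH].
      by rewrite (gthom0 hm) (gthom0 hp).
    rewrite hm.1 hp.1 IH addr0 (gthom_fword _ _ hm) (gthom_fword _ _ hp) phimv phipw.
    have : fword (low (Vmod K xp')) q 0 = 0.
      by elim: q => //= p q ->; exact: linear0.
    by move=> ->; rewrite scaler0.
  have [e eE] := span u; rewrite eE.
  have act0 m : mono_act m (0 : Vmod K xp') = 0.
    by elim: m => // p m IH; rewrite /mono_act /= -/(mono_act m 0) IH linear0.
  have b0 : (0 < b)%N by case/andP: b_range.
  have mon_b i : i \in E -> last 0%N i = b ->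
      (exists u', phim u' = fmon (low _) i v) /\ phip (fmon (low _) i v) = 0.
    case/lastP: i => [|i x] iE; first by move=> E0; move: b0; rewrite -E0.
    rewrite last_rcons => xb; subst x.
    have iE' : i \in Em' by apply/HEm/(in_index_set_minus _ leba ya)/HE.
    split; first by exists (fmon (low _) i vm); exact: phim_mon.
    by rewrite -phim_mon // (gthom_fmon _ _ hm) (gthom_fmon _ _ hp) phimv phipw fmonE act0.
  have mon_lt i : i \in E -> last 0%N i != b -> i \in Ep'.
    case/lastP: i => [|i x] iE; first by case: (HE [::]) => /(_ iE)[]; rewrite !size_rcons.
    rewrite last_rcons => xb; have Hi := (HE _).1 iE.
    have xb' : (x < b)%N by rewrite ltn_neqAle xb; exact: in_index_set_last Hi.
    exact/HEp/(in_index_set_plus_lt b_range xb' Hi).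
  have e0 i : i \in [seq i <- E | last 0%N i != b] -> e i = 0.
    move=> iE; apply: (free_subseq (c := e) uEp freep) iE.
    + exact: filter_uniq.
    + by move=> j; rewrite mem_filter => /andP[jb jE]; apply: mon_lt.
    rewrite big_filter -[RHS]u0 eE (gthom_sum _ _ _ _ hp).
    rewrite [RHS](bigID (fun i => last 0%N i == b)) /= [X in _ = X + _]big_seq_cond.
    rewrite [X in _ = X + _]big1 ?add0r => [|j /andP[jE /eqP jb]].
      by apply: eq_bigr => j _; rewrite (gthom_fmon _ _ hp) phipv.
    by rewrite (mon_b j jE jb).2 scaler0.
  rewrite big_seq; elim/big_ind: _ => [|x1 x2 [u1 <-] [u2 <-]|i iE].
  + by exists 0; exact: gthom0.
  + by exists (1 *: u1 + u2); rewrite hm.1 scale1r.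
  case: (eqVneq (last 0%N i) b) => ib.
    have [[u' <-] _] := mon_b i iE ib; exists (e i *: u' + 0).
    by rewrite hm.1 (gthom0 hm) addr0.
  by exists 0; rewrite e0 ?mem_filter ?ib // scale0r; exact: gthom0.
- move=> u; elim: (Vmod_words u sxp') => [|k x1 x2 [q ->] _ [u2 E2]].
    by exists 0; rewrite (gthom0 hp).
  exists (k *: fword (low _) q v + u2).
  by rewrite hp.1 E2 (gthom_fword _ _ hp) phipv.
Qed.
End ExactSequence.

(** * The fusion isomorphism and the monomial basis *)

Section Conclusions.
Variables (K : numFieldType) (xi : seq nat).
Hypothesis sxi : sorted geq xi.

Lemma Vmod_fusion (z : 'I_(size xi) -> K) : injective z ->
  gr_isomorphic (Vmod K xi)
    (fusion z (fun k : 'I_(size xi) => irr_gen K (part xi k.+1))).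
Proof.
move=> z_inj.
have [phi hphi phiv] := Vmod_lift sxi (highest_fusion z_inj).
have [E [uE HE szE]] := index_set_list sxi.
have free := fusion_free sxi z_inj uE HE szE.
have span := Vmod_span (K := K) sxi sxi erefl (frefl _) uE HE.
have inj0 u : phi u = 0 -> u = 0.
  have [e ->] := span u; rewrite (gthom_sum _ _ _ _ hphi) => e0.
  rewrite big_seq big1 // => i iE; rewrite (free e _ i iE) ?scale0r //.
  by rewrite -[RHS]e0; apply: eq_bigr => j _; rewrite (gthom_fmon _ _ hphi) phiv.
have surj q : exists u, phi u = q.
  move: q; apply: gr_generated.
  - by exists 0; apply: gthom0.
  - by move=> k q1 q2 [u1 <-] [u2 <-]; exists (k *: u1 + u2); rewrite hphi.1.
  - by move=> m; exists (mono_act m (Vgen K xi)); rewrite (gthom_mono _ _ hphi) phiv.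
have inj : injective phi.
  move=> u1 u2 E12; apply/eqP; rewrite -subr_eq0; apply/eqP/inj0.
  have := hphi.1 (-1) u2 u1; rewrite !scaleN1r [- u2 + _]addrC => ->.
  by rewrite E12 addNr.
exists phi.
  split=> // s u gu; rewrite -[s]addn0; apply: (@Vmod_gthom_grade K xi
    (fusion z (fun k : 'I_(size xi) => irr_gen K (part xi k.+1))) phi 0%N hphi) => //.
  by rewrite phiv; exact: gr_class_grade.
have [psi psiK] := choice surj.
by exists psi => // u; apply: inj; rewrite psiK.
Qed.

Lemma sum_part (s : seq nat) m :
  (\sum_(m.+1 <= p < (size s).+1) part s p = sumn (drop m s))%N.
Proof.
rewrite big_add1 /= sumnE [RHS](big_nth 0%N) size_drop -{1}[m]add0n big_addn.
by apply: eq_bigr => p _; rewrite nth_drop addnC.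
Qed.

Lemma index_setE (i : (size xi).-tuple nat) : index_set i <-> in_index_set xi i.
Proof.
split=> [H|[_ H] k j le_k le_j].
  split=> [|k m mk]; first exact: size_tuple.
  have := H k.+1 (k - m)%N; rewrite !addn1 => /(_ ltac:(lia) ltac:(lia)).
  have -> : (k.+1 - (k - m) = m.+1)%N by lia.
  have := sum_part i k.+1; rewrite size_tuple => ->.
  by rewrite sum_part /ineq_lhs /part subn1.
have mk : ((k - j).-1 < k.-1 <= size xi)%N by lia.
have := H _ _ mk; rewrite /ineq_lhs.
have -> : (k.-1 - (k - j).-1 = j)%N by lia.
have -> : (k.-1.+1 = k)%N by lia.
have := sum_part i k; rewrite size_tuple !addn1 => ->.
have {2}-> : (k - j = (k - j).-1.+1)%N by lia.
by rewrite sum_part /part subn1.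
Qed.

Lemma basis_eltE (i : (size xi).-tuple nat) :
  basis_elt K i = fmon (low (Vmod K xi)) i (Vgen K xi).
Proof. by rewrite /fmon size_tuple. Qed.

Lemma Vmod_basis : is_basis (@index_set xi) (@basis_elt K xi).
Proof.
have [E [uE HE szE]] := index_set_list sxi.
have free := Vmod_free (K := K) sxi sxi erefl (frefl _) uE HE szE.
have span := Vmod_span (K := K) sxi sxi erefl (frefl _) uE HE.
split=> [s c us sP s0 i iS|u].
  pose c' (j : seq nat) := if insub j is Some t then c t else 0.
  have c'E t : c' (val t) = c t by rewrite /c' valK.
  rewrite -c'E; apply: (free_subseq (c := c') uE free (s := map val s)).
  - by rewrite map_inj_uniq //; exact: val_inj.
  - by move=> _ /mapP[t /sP /index_setE /HE tE ->].
  - rewrite big_map -[RHS]s0; apply: eq_bigr => t _.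
    by rewrite c'E basis_eltE.
  - exact: map_f.
have [e ->] := span u; pose t0 : (size xi).-tuple nat := [tuple of nseq (size xi) 0%N].
have valE j : j \in E -> val (insubd t0 j) = j.
  by move=> /HE[sj _]; rewrite val_insubd /= sj eqxx.
exists (map (insubd t0) E), (fun t => e (val t)); split.
  by move=> _ /mapP[j jE ->]; apply/index_setE; rewrite [tval _](valE _ jE); apply/HE.
rewrite big_map !big_seq; apply: eq_bigr => j /valE jE.
by rewrite basis_eltE [tval _]jE jE.
Qed.

End Conclusions.

Section ShortExact.
Variables (K : numFieldType) (xi : seq nat).
Hypotheses (xi_part : is_partition xi) (xi_gt1 : (1 < size xi)%N).

Lemma Vmod_short_exact :
  exists (phi_minus : tau ((size xi - 1) * part xi (size xi))
                          (Vmod K (xi_minus xi)) -> Vmod K xi)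
         (phi_plus : Vmod K xi -> Vmod K (xi_plus xi)),
    short_exact phi_minus phi_plus.
Proof.
move: xi_part xi_gt1; case/andP.
case/lastP: xi => // y' b; case/lastP: y' => // y a sxi n0 _.
have := sxi; rewrite sorted_rcons_geq all_rcons => /andP[sya /andP[/= leba _]].
have [eta eta_a [c yE]] := sorted_last_block sya; subst y.
have b0 : (0 < b)%N.
  by rewrite lt0n; apply: contraNneq n0 => ->; rewrite mem_rcons mem_head.
have b_range : (0 < b <= a)%N by rewrite b0.
have [sxm sxp] := sorted_minus_plus eta_a sxi.
set y := eta ++ nseq c a in sxi sxm *.
have szE : size (rcons (rcons y a) b) = (size y).+2 by rewrite !size_rcons.
have takeE : take (size y) (rcons (rcons y a) b) = y.
  by rewrite -!cats1 -catA take_size_cat.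
have part_a : part (rcons (rcons y a) b) (size y).+1 = a.
  by rewrite /part /= !nth_rcons size_rcons ltnSn ltnn eqxx.
have part_b : part (rcons (rcons y a) b) (size y).+2 = b.
  by rewrite /part /= nth_rcons size_rcons ltnn eqxx.
rewrite /xi_minus /xi_plus szE subn1 subn2 /= takeE part_a part_b addn1 subn1.
have sort_perm : perm_eq (sort geq (y ++ [:: a.+1; b.-1])) (y ++ [:: a.+1; b.-1]).
  by rewrite perm_sort.
apply: (@exact_sequence K eta c a b) => //.
- by apply: sorted_filter sxm; exact: geq_trans.
- by apply: sorted_filter (sort_sorted _ _); [exact: geq_trans|move=> m n; exact: leq_total].
- by rewrite sumn_filter0.
- by move=> r; rewrite minsum_filter0.
- rewrite sumn_filter0 (perm_sumn sort_perm) sumn_rcons !sumn_cat /=; lia.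
- move=> r; rewrite minsum_filter0 minsum_plus -/y [RHS](perm_big _ sort_perm) /=.
  by rewrite big_cat /= !big_cons big_nil addn0 addnA.
Qed.

End ShortExact.

Theorem theorem5 (R : realType) (xi : seq nat)
    (xi_part : is_partition xi) (xi_nonempty : (1 <= size xi)%N) :
  [/\ (1 < size xi)%N ->
      exists (phi_minus : tau ((size xi - 1) * part xi (size xi))
                              (Vmod R[i] (xi_minus xi)) -> Vmod R[i] xi)
             (phi_plus : Vmod R[i] xi -> Vmod R[i] (xi_plus xi)),
        short_exact phi_minus phi_plus,
      forall z : 'I_(size xi) -> R[i], injective z ->
        gr_isomorphic (Vmod R[i] xi)
          (fusion z (fun k : 'I_(size xi) => irr_gen R[i] (part xi k.+1)))
    & is_basis (@index_set xi) (@basis_elt R[i] xi)].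
Proof.
have sxi : sorted geq xi by case/andP: xi_part.
split; [exact: Vmod_short_exact|exact: Vmod_fusion|exact: Vmod_basis].
Qed.
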